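(* There is an absolute constant $c>0$ such that for every integer $n\ge2$ the following hold. (i) If $X$ is a random vector in $\mathbb{R}^n$ with finite first moment $M_1$, and $Y$ is an independent copy of $X$, then $$ c\,\mathbb{E}_\theta\, \rho(F_\theta,F) \, \leq \, M_1\sqrt{\frac{\log n}{n}} + \sqrt{\mathbb{P}\big\{|X-Y|^2 \leq n/4\big\}}\; \log n + \frac{1}{n}. $$ (ii) If $X$ is a random vector in $\mathbb{R}^n$ with finite second moment $M_2$ and $\mathbb{E}|X|^2=n$, then $$ c\,\mathbb{E}_\theta\, \rho(F_\theta,F) \, \leq \, (M_1 + m_2 + \sigma_2)\,\frac{\log n}{\sqrt{n}} . $$ (iii) Under the assumptions of (ii), the same bound holds with the standard normal distribution function in place of $F$: $$ c\,\mathbb{E}_\theta\, \rho(F_\theta,\Phi) \, \leq \, (M_1 + m_2 + \sigma_2)\,\frac{\log n}{\sqrt{n}} . $$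
   Context: $|\cdot|$ and $\langle\cdot,\cdot\rangle$ are the Euclidean norm and inner product on $\mathbb{R}^n$. $S^{n-1}$ is the unit sphere in $\mathbb{R}^n$, $\mu_{n-1}$ is the uniform probability measure on it, and $\mathbb{E}_\theta$ denotes integration over $\theta\in S^{n-1}$ with respect to $\mu_{n-1}$. For $\theta\in S^{n-1}$, $F_\theta(x)=\mathbb{P}\{\langle X,\theta\rangle\le x\}$, $x\in\mathbb{R}$; $F(x)=\mathbb{E}_\theta F_\theta(x)$ is the typical distribution function. $\Phi$ is the standard normal distribution function. $\rho(U,V)=\sup_{x\in\mathbb{R}}|U(x)-V(x)|$. With $Y$ an independent copy of $X$, $$M_p=\sup_{\theta\in S^{n-1}}\big(\mathbb{E}|\langle X,\theta\rangle|^p\big)^{1/p},\qquad m_2=\frac{1}{\sqrt n}\big(\mathbb{E}\langle X,Y\rangle^2\big)^{1/2},\qquad \sigma_2=\frac{1}{\sqrt n}\,\mathbb{E}\,\big||X|^2-n\big|.$$ ''Absolute constant'' means independent of $n$ and of the distribution of $X$. *)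

(* Defs.v *)
From HB Require Import structures.
From mathcomp Require Import all_boot all_order all_algebra.
From mathcomp Require Import all_classical all_reals all_analysis.
From mathcomp Require Import measurable_realfun.
Set Implicit Arguments.
Unset Strict Implicit.
Unset Printing Implicit Defensive.
Import Order.TTheory GRing.Theory Num.Theory.
Import numFieldNormedType.Exports.
Local Open Scope classical_set_scope.
Local Open Scope ring_scope.

Section euclidean.
Context {R : realType} {n : nat}.
Implicit Types x y : n.-tuple R.

Definition dotp x y : R := \sum_(i < n) tnth x i * tnth y i.

Definition enorm x : R := Num.sqrt (dotp x x).

Definition tsub x y : n.-tuple R := [tuple tnth x i - tnth y i | i < n].

Definition normalize x : n.-tuple R := [tuple tnth x i / enorm x | i < n].

Definition sphere : set (n.-tuple R) := [set x | enorm x = 1].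

Definition punctured_ball : set (n.-tuple R) := [set x | 0 < enorm x <= 1].

Lemma measurable_sqnorm : measurable_fun [set: n.-tuple R] (fun x => dotp x x).
Proof.
apply: measurable_sum => i; apply: measurable_funM; exact: measurable_tnth.
Qed.

Lemma measurable_enorm : measurable_fun [set: n.-tuple R] enorm.
Proof.
apply: measurableT_comp measurable_sqnorm.
apply: continuous_measurable_fun.
exact: sqrt_continuous.
Qed.

Lemma measurable_normalize : measurable_fun [set: n.-tuple R] normalize.
Proof.
apply/measurable_fun_tnthP => i.
rewrite (_ : _ \o _ = fun x => tnth x i * (enorm x) `^ (-1)); last first.
  by apply/funext => x /=; rewrite tnth_mktuple powR_inv1// sqrtr_ge0.
apply: measurable_funM; first exact: measurable_tnth.
apply: (measurableT_comp (measurable_powR (-1)) measurable_enorm).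
Qed.

Lemma measurable_punctured_ball : measurable punctured_ball.
Proof.
have -> : punctured_ball = enorm @^-1` `]0, 1]%classic.
  by apply/seteqP; split => x /=; rewrite in_itv.
by rewrite -[X in measurable X]setTI; apply: measurable_enorm.
Qed.

End euclidean.
Arguments sphere : clear implicits.
Arguments punctured_ball : clear implicits.

Definition consT {R : realType} {n : nat} (p : R * n.-tuple R) :
  n.+1.-tuple R := [tuple of p.1 :: p.2].

Lemma measurable_consT (R : realType) (n : nat) :
  measurable_fun [set: R * n.-tuple R] (@consT R n).
Proof. exact: measurable_cons. Qed.

HB.instance Definition _ (R : realType) (n : nat) :=
  isMeasurableFun.Build _ _ _ _ (@consT R n) (@measurable_consT R n).

Section lebesgue_cons.
Context {R : realType} {n : nat}.
Variable m : {sigma_finite_measure set (n.-tuple R) -> \bar R}.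
Local Open Scope ereal_scope.

Definition lebesgue_cons : set (n.+1.-tuple R) -> \bar R :=
  pushforward (@lebesgue_measure R \x m) (@consT R n).

Let lebesgue_cons0 : lebesgue_cons set0 = 0.
Proof. by rewrite /lebesgue_cons /pushforward preimage_set0 measure0. Qed.

Let lebesgue_cons_ge0 A : 0 <= lebesgue_cons A.
Proof. by rewrite /lebesgue_cons /pushforward measure_ge0. Qed.

Let lebesgue_cons_sigma_additive : semi_sigma_additive lebesgue_cons.
Proof.
apply: (@measure_semi_sigma_additive _ _ _ (pushforward _ _)).
exact: measurable_consT.
Qed.

HB.instance Definition _ := isMeasure.Build _ _ _ lebesgue_cons
  lebesgue_cons0 lebesgue_cons_ge0 lebesgue_cons_sigma_additive.

Let lebesgue_cons_sigma_finite : sigma_finite [set: n.+1.-tuple R] lebesgue_cons.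
Proof.
have /sigma_finiteP[F [TF ndF Foo]] := sigma_finiteT (@lebesgue_measure R).
have /sigma_finiteP[G [TG ndG Goo]] := sigma_finiteT m.
pose g (t : n.+1.-tuple R) := (thead t, [tuple of behead t]).
have mg : measurable_fun setT g.
  apply/measurable_fun_pairP; split.
    exact: measurable_tnth.
  exact: measurable_behead.
have gK : cancel (@consT R n) g.
  by move=> -[x t]; congr pair; apply/val_inj.
exists (fun k => g @^-1` (F k `*` G k)) => [|k].
  rewrite -preimage_bigcup (_ : \bigcup_k _ = setT) ?preimage_setT//.
  rewrite -subTset => -[x y] _.
  have [i _ Fx] : (\bigcup_k F k) x by rewrite -TF.
  have [j _ Gy] : (\bigcup_k G k) y by rewrite -TG.
  exists (maxn i j) => //; split => /=.
    by move: x Fx; exact/subsetPset/ndF/leq_maxl.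
  by move: y Gy; exact/subsetPset/ndG/leq_maxr.
have [mF Fk] := Foo k; have [mG Gk] := Goo k; split.
  by rewrite -[X in measurable X]setTI; apply: mg => //; exact: measurableX.
rewrite /lebesgue_cons /pushforward (_ : _ @^-1` _ = F k `*` G k).
  by rewrite product_measure1E// lte_mul_pinfty// ge0_fin_numE.
by rewrite -comp_preimage (_ : g \o _ = id)//; apply/funext.
Qed.

HB.instance Definition _ :=
  Measure_isSigmaFinite.Build _ _ _ lebesgue_cons lebesgue_cons_sigma_finite.

End lebesgue_cons.

(* The library only has Lebesgue measure on R; on R^n it is taken as the product
   measure on R * R^(n-1), transported along [consT]. *)
Fixpoint lebesgue_tuple {R : realType} (n : nat) :
    {sigma_finite_measure set (n.-tuple R) -> \bar R} :=
  if n is n'.+1 then lebesgue_cons (lebesgue_tuple n') else \d_[tuple]%E.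

Section uniform_sphere.
Context {R : realType} (n : nat).
Local Open Scope ereal_scope.

HB.instance Definition _ :=
  isMeasurableFun.Build _ _ _ _ (@normalize R n) measurable_normalize.

(* The default value 0 of normalization is never used when n > 0, by
   [ball_volume_gt0] and [ball_volume_lty]. *)
Definition uniform_ball : probability (n.-tuple R) R :=
  mnormalize (mrestr (lebesgue_tuple n) (@measurable_punctured_ball R n))
             \d_(nseq_tuple n (0%R : R)).

(* The normalized surface measure on the unit sphere, seen as a probability
   measure on R^n: the mass of A is the proportion of the volume of the unit
   ball that lies in the cone spanned by A (see [uniform_sphereE]). *)
Definition uniform_sphere : probability (n.-tuple R) R :=
  distribution uniform_ball (@normalize R n).

End uniform_sphere.

Lemma mnormalizeE d (T : measurableType d) (R : realType)
    (mu : {measure set T -> \bar R}) (P : probability T R) (A : set T) :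
  (0 < mu [set: T] < +oo)%E ->
  mnormalize mu P A = (mu A * (fine (mu [set: T]))^-1%:E)%E.
Proof.
by rewrite /mnormalize => /andP[/gt_eqF -> /lt_eqF ->].
Qed.

Section ball_volume.
Context {R : realType}.
Local Open Scope ereal_scope.

Definition box n (a b : R) : set (n.-tuple R) :=
  [set t | forall i, (a <= tnth t i <= b)%R].

Arguments box : clear implicits.

Lemma measurable_box n (a b : R) : measurable (box n a b).
Proof.
have -> : box n a b = \bigcap_(i in [set: 'I_n])
    ((fun t => tnth t i) @^-1` `[a, b]%classic).
  apply/seteqP; split => t /=.
    by move=> ab i _ /=; rewrite in_itv/=.
  by move=> ab i; have /= := ab i Logic.I; rewrite in_itv/=.
apply: fin_bigcap_measurable => // i _.
by rewrite -[X in measurable X]setTI; apply: measurable_tnth.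
Qed.

Lemma lebesgue_tuple_box n (a b : R) : (a <= b)%R ->
  lebesgue_tuple n (box n a b) = ((b - a) ^+ n)%:E.
Proof.
move=> ab; elim: n => [|n IHn].
  by rewrite /= diracE mem_set ?expr0// => -[].
transitivity ((@lebesgue_measure R \x lebesgue_tuple n)
    (`[a, b]%classic `*` box n a b)).
  rewrite [LHS]/= /lebesgue_cons /pushforward; congr (_ _).
  apply/seteqP; split => -[x t] /=.
    move=> h; split; first by have := h ord0; rewrite in_itv.
    by move=> i; have := h (lift ord0 i); rewrite /consT /= tnthS.
  rewrite in_itv/= => -[hx ht] i; rewrite /consT /=.
  by case: (unliftP ord0 i) => [j|] ->; rewrite ?tnthS ?tnth0.
rewrite product_measure1E//; last exact: measurable_box.
rewrite IHn [X in X * _](lebesgue_measure_itv `[a, b])/= lte_fin.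
move: ab; rewrite le_eqVlt => /predU1P[->|->]; last by rewrite -EFinB -EFinM exprS.
by rewrite ltxx mul0e subrr exprS mul0r.
Qed.

Lemma ball_volume_lty n : lebesgue_tuple n (punctured_ball R n) < +oo.
Proof.
apply: (@le_lt_trans _ _ (lebesgue_tuple n (box n (-1) 1))); last first.
  by rewrite lebesgue_tuple_box ?ltry// (le_trans (lerN10 _))//.
apply: le_measure; rewrite ?inE.
- exact: measurable_punctured_ball.
- exact: measurable_box.
move=> t /= /andP[_ t1] i; rewrite -ler_norml.
rewrite -sqrtr_sqr (le_trans _ t1)// ler_wsqrtr// /dotp (bigD1 i)//= expr2.
by rewrite lerDl sumr_ge0// => j _; rewrite -expr2 sqr_ge0.
Qed.

Lemma ball_volume_gt0 n : (0 < n)%N -> 0 < lebesgue_tuple n (punctured_ball R n).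
Proof.
move=> n0; pose r : R := (n%:R^-1)%R.
have r0 : (0 < r)%R by rewrite invr_gt0 ltr0n.
apply: (@lt_le_trans _ _ (lebesgue_tuple n (box n (r / 2) r))).
  rewrite lebesgue_tuple_box; last by rewrite ler_pdivrMr// ler_peMr ?ler1n// ltW.
  by rewrite lte_fin exprn_gt0// subr_gt0 ltr_pdivrMr// ltr_pMr// ltr1n.
apply: le_measure; rewrite ?inE.
- exact: measurable_box.
- exact: measurable_punctured_ball.
move=> t /= ht.
have t0 i : (0 < tnth t i)%R.
  by have /andP[+ _] := ht i; apply: lt_le_trans; rewrite divr_gt0.
apply/andP; split.
  rewrite sqrtr_gt0 /dotp (bigD1 (Ordinal n0))//= ltr_pwDl//.
    by rewrite mulr_gt0.
  by rewrite sumr_ge0// => j _; rewrite -expr2 sqr_ge0.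
rewrite -[leRHS]sqrtr1 ler_wsqrtr//.
apply: (@le_trans _ _ (\sum_(i < n) r)%R); last first.
  by rewrite sumr_const card_ord /r -[X in (X <= _)%R]mulr_natr mulVf// pnatr_eq0 -lt0n.
apply: ler_sum => i _; have /andP[_ tr] := ht i.
rewrite (le_trans (ler_pM (ltW (t0 i)) (ltW (t0 i)) tr tr))// ler_piMr ?(ltW r0)//.
by rewrite /r invf_le1 ?ler1n ?ltr0n.
Qed.

Lemma uniform_sphereE n (A : set (n.-tuple R)) : (0 < n)%N ->
  uniform_sphere n A = lebesgue_tuple n
    ([set x | A (normalize x)] `&` punctured_ball R n) *
    (fine (lebesgue_tuple n (punctured_ball R n)))^-1%:E.
Proof.
move=> n0; rewrite /uniform_sphere /distribution /pushforward /uniform_ball /=.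
have mT : mrestr (lebesgue_tuple n) (@measurable_punctured_ball R n) setT =
    lebesgue_tuple n (punctured_ball R n) by rewrite /mrestr setTI.
rewrite mnormalizeE; last first.
  by rewrite [X in _ < X]mT ball_volume_gt0// [X in X < _]mT ball_volume_lty.
by rewrite [X in fine X]mT.
Qed.

Lemma uniform_sphere_sphere n : (0 < n)%N ->
  uniform_sphere n (sphere R n) = 1.
Proof.
move=> n0; rewrite uniform_sphereE// (_ : _ `&` _ = punctured_ball R n).
  have v0 := ball_volume_gt0 n0.
  have vf : lebesgue_tuple n (punctured_ball R n) \is a fin_num.
    by rewrite ge0_fin_numE ?ball_volume_lty.
  rewrite -[X in X * _]fineK// -EFinM divff// gt_eqF// fine_gt0// v0.
  exact: ball_volume_lty.
apply/seteqP; split => [x []//|x xB]; split => //=.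
have /andP[x0 _] := xB; rewrite /sphere /= /enorm.
have -> : dotp (normalize x) (normalize x) = 1%R; last by rewrite sqrtr1.
rewrite /dotp; under eq_bigr do rewrite !tnth_mktuple mulrACA.
rewrite -mulr_suml -/(dotp x x) -invfM -expr2 sqr_sqrtr.
  by rewrite divff// gt_eqF// -sqrtr_gt0.
by rewrite ltW// -sqrtr_gt0.
Qed.

End ball_volume.

Section random_vector.
Context d (T : measurableType d) (R : realType) (P : probability T R) (n : nat).
Implicit Types X Y : {RV P >-> n.-tuple R}.
Local Open Scope ereal_scope.

Definition independent_copy X Y :=
  (forall A, measurable A -> distribution P Y A = distribution P X A) /\
  (forall A B, measurable A -> measurable B ->
    P (X @^-1` A `&` Y @^-1` B) = P (X @^-1` A) * P (Y @^-1` B)).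

(* F_theta *)
Definition proj_cdf X (theta : n.-tuple R) (x : R) : \bar R :=
  P [set w | (dotp (X w) theta <= x)%R].

(* F *)
Definition typical_cdf X (x : R) : \bar R :=
  \int[uniform_sphere n]_theta proj_cdf X theta x.

(* M_p *)
Definition maxmoment X (p : R) : \bar R :=
  ereal_sup [set 'N[P]_(p%:E)[(fun w => (dotp (X w) theta)%:E)]
            | theta in sphere R n].

(* m_2; the independent copy is realized on the product space, so that m_2 is
   defined for every X, whether or not (T, P) itself carries such a copy. *)
Definition m2 X : \bar R :=
  (Num.sqrt n%:R)^-1%:E *
  sqrte (\int[P \x P]_w (dotp (X w.1) (X w.2) ^+ 2)%:E).

(* sigma_2 *)
Definition sigma2 X : \bar R :=
  (Num.sqrt n%:R)^-1%:E * 'E_P[(fun w => `|enorm (X w) ^+ 2 - n%:R|%R)].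

End random_vector.

Definition std_normal_cdf {R : realType} (x : R) : \bar R :=
  normal_prob 0 1 `]-oo, x]%classic.

Definition kolmogorov_dist {R : realType} (U V : R -> \bar R) : \bar R :=
  ereal_sup (range (fun x => `|U x - V x|%E)).

(* Main.v *)
Require Import Defs.
From HB Require Import structures.
From mathcomp Require Import all_boot all_order all_algebra.
From mathcomp Require Import all_classical all_reals all_analysis.
From mathcomp Require Import measurable_realfun.
From mathcomp Require Import ring lra.
Set Implicit Arguments.
Unset Strict Implicit.
Unset Printing Implicit Defensive.
Import Order.TTheory GRing.Theory Num.Theory.
Import numFieldNormedType.Exports.
Local Open Scope classical_set_scope.
Local Open Scope ring_scope.

(** A uniform direction is [z / |z|] for a standard Gaussian vector [z]. The
    distribution functions [F_theta] are compared not with [F] but with the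
    distribution function [G] of [|X| g / sqrt n], where [g] is standard normal
    and independent of [X]; averaging then shows that [F] is close to [G], and
    [Phi] differs from [G] by at most [2 E | |X|^2 / n - 1 |].

    The characteristic function [s |-> E exp (i s <X, z>)] has Gaussian mean
    [E exp (- s^2 |X|^2 / 2)], which is that of [G] up to scaling. Its variance
    [E exp (- s^2 |X - Y|^2 / 2) - (E exp (- s^2 |X|^2 / 2))^2] is at most
    [2 s^2 M_1^2] and at most [P (|X - Y|^2 <= n / 4) + exp (- s^2 n / 8)].
    Convolution with a normal law of standard deviation [1 / n] bounds the
    distance between [F_theta] and [G] by a Gaussian integral of the difference
    of the two characteristic functions at [sqrt n * u], divided by [|u|]. The
    first variance bound is used for [|u| <= sqrt (32 ln n) / n] and the second
    one beyond; the integral of [1 / |u|] over [1 / n < |u| < 1] produces the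
    logarithm.

    The smoothing needs [G] to be Lipschitz outside an event
    [|X|^2 <= n / 16], whose squared probability is at most
    [P (|X - Y|^2 <= n / 4)], and the change from [z] to [z / |z|] costs
    [1 / sqrt n]. The latter is absorbed by the right-hand side because
    [1 - exp (- 1 / 8) <= P (|X - Y|^2 <= n / 4) + 2 M_1]. *)

(** * Integrals with respect to probability measures *)

(** The obstacle to averaging over directions is the supremum over [x] inside the Kolmogorov
    distance. The Fourier bound for the smoothed distribution functions does not depend on [x], so
    the supremum is taken before the average and costs nothing; it is then integrated over the
    direction by Tonelli, frequency by frequency.

    Gaussian directions replace points of the sphere because each mean over them is an explicit
    exponential, which makes both variance bounds elementary. Smoothing at scale [1 / n] means
    frequencies of order [n] for the projection divided by [sqrt n], that is, [sqrt n * u] for the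
    projection itself.

    The last two inequalities are deduced from the rate of the first one: a Markov bound gives [P
    (|X - Y|^2 <= n / 4) <= 16 (m_2^2 + sigma_2^2) / n]. The summand [1 / n], absent from their
    right-hand sides, is absorbed by the same lower bound on [P (|X - Y|^2 <= n / 4) + 2 M_1] that
    absorbs [1 / sqrt n]. *)

Section lower_integral.
Context d (T : measurableType d) (R : realType).
Local Open Scope ereal_scope.

(* The integral of a nonnegative function is a supremum over the simple
   functions below it, so no measurability of [f] is required. *)
Lemma ge0_le_integral_measurable_ub (mu : {measure set T -> \bar R}) (f g : T -> \bar R) :
  (forall x, 0 <= f x) -> (forall x, f x <= g x) ->
  \int[mu]_x f x <= \int[mu]_x g x.
Proof.
move=> f0 fg; rewrite !ge0_integralTE//; last first.
  by move=> x; apply: le_trans (fg x).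
apply: ge_ereal_sup => _ [h /= hf <-]; apply: ereal_sup_ubound => /=.
by exists h => // x; apply: le_trans (fg x).
Qed.

Import HBNNSimple.

(** The change of variables is performed on each simple function below [f], whose composition with
    [phi] lies below [g] almost everywhere; the supremum over simple functions then gives the bound.
    It serves to integrate a Kolmogorov distance over the sphere through [normalize]. *)
Lemma ge0_integral_pushforward_le d' (U : measurableType d') (phi : T -> U)
    (mphi : measurable_fun [set: T] phi) (mu : {measure set T -> \bar R})
    (nu : {measure set U -> \bar R})
    (f : U -> \bar R) (g : T -> \bar R) :
  (forall A, measurable A -> nu A = mu (phi @^-1` A)) ->
  (forall x, 0 <= f x) -> measurable_fun setT g -> (forall x, 0 <= g x) ->
  {ae mu, forall x, f (phi x) <= g x} ->
  \int[nu]_x f x <= \int[mu]_x g x.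
Proof.
move=> numu f0 mg g0 fg; rewrite ge0_integralTE//.
apply: ge_ereal_sup => _ [h /= hf <-].
rewrite -integralT_nnsfun.
have -> : \int[nu]_x (h x)%:E = \int[pushforward mu phi]_x (h x)%:E.
  by apply: eq_measure_integral => A mA _; exact: numu.
rewrite ge0_integral_pushforward//=; last 2 first.
  exact/measurable_EFinP.
  by move=> x _; rewrite lee_fin.
apply: ae_ge0_le_integral => //.
- by rewrite preimage_setT.
- by move=> x _ /=; rewrite lee_fin.
- rewrite preimage_setT.
  by apply/measurable_EFinP; apply: measurableT_comp.
- apply: filterS fg => x fgx _; apply: le_trans fgx; exact: hf.
Qed.

End lower_integral.

Section bounded.
Context d (T : measurableType d) (R : realType) (P : probability T R).
Implicit Types f g : T -> R.

Lemma prob_bounded_integrable f (M : R) : measurable_fun setT f ->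
  (forall x, `|f x| <= M) -> P.-integrable setT (EFin \o f).
Proof.
move=> mf fM; apply: measurable_bounded_integrable => //.
  by rewrite [X in (X < _)%E]probability_setT ltry.
exists M; split; first exact: num_real.
by move=> x Mx y _ /=; apply: le_trans (fM y) (ltW Mx).
Qed.

Lemma prob_integrable_cst (r : R) : P.-integrable setT (EFin \o (fun=> r)).
Proof. by apply: (@prob_bounded_integrable _ `|r|). Qed.

Lemma prob_fin_num (A : set T) : measurable A -> P A \is a fin_num.
Proof. exact: fin_num_measure. Qed.

Lemma Rintegral_EFin f : P.-integrable setT (EFin \o f) ->
  (\int[P]_x (f x)%:E)%E = (\int[P]_x f x)%:E.
Proof. by move=> fi; rewrite fineK//; exact: integrable_fin_num. Qed.

Lemma integrable_scale (r : R) f : P.-integrable setT (EFin \o f) ->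
  P.-integrable setT (EFin \o (fun x => r * f x)).
Proof. exact: integrableZl. Qed.

Lemma integrable_bigsum (I : finType) (f : I -> T -> R) :
  (forall i, P.-integrable setT (EFin \o f i)) ->
  P.-integrable setT (EFin \o (fun x => \sum_i f i x)).
Proof.
move=> fi; have := @integrable_sum _ _ _ P _ measurableT _ (index_enum I) xpredT
  (fun i => EFin \o f i) (fun i _ => fi i).
by apply: eq_integrable => // x _; rewrite /= sumEFin.
Qed.

Lemma Rintegral_bigsum (I : finType) (f : I -> T -> R) :
  (forall i, P.-integrable setT (EFin \o f i)) ->
  \int[P]_x (\sum_i f i x) = \sum_i \int[P]_x f i x.
Proof.
move=> fi; apply: EFin_inj; rewrite -Rintegral_EFin; last exact: integrable_bigsum.
under eq_integral do rewrite -sumEFin.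
rewrite integral_sum// -sumEFin; apply: eq_bigr => i _.
by rewrite (Rintegral_EFin (fi i)).
Qed.

Lemma Rintegral_cstT (r : R) : \int[P]_x r = r.
Proof. by rewrite Rintegral_cst// [X in fine X]probability_setT mulr1. Qed.

Lemma normr_Rintegral_le f (M : R) : measurable_fun setT f ->
  (forall x, `|f x| <= M) -> `|\int[P]_x f x| <= M.
Proof.
move=> mf fM; have fi := prob_bounded_integrable mf fM.
apply: (le_trans (le_normr_Rintegral _ fi)) => //.
rewrite -[leRHS]Rintegral_cstT; apply: le_Rintegral => //.
  exact: (integrable_norm fi).
by apply: (@prob_bounded_integrable _ `|M|) => // x.
Qed.

End bounded.

Section fubini.
Context d (T : measurableType d) d' (U : measurableType d') (R : realType)
  (P : probability T R) (Q : probability U R).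
Variable f : T * U -> R.

Lemma Rintegral_prod1 : (P \x Q)%E.-integrable setT (EFin \o f) ->
  (forall x, Q.-integrable setT (fun y => (f (x, y))%:E)) ->
  \int[(P \x Q)%E]_z f z = \int[P]_x \int[Q]_y f (x, y).
Proof.
move=> fi fQ; rewrite /Rintegral -integral12_prod_meas1//; congr fine.
by apply: eq_integral => x _; rewrite /fubini_F /= fineK//; apply: integrable_fin_num.
Qed.

Lemma Rintegral_prod2 : (P \x Q)%E.-integrable setT (EFin \o f) ->
  (forall y, P.-integrable setT (fun x => (f (x, y))%:E)) ->
  \int[(P \x Q)%E]_z f z = \int[Q]_y \int[P]_x f (x, y).
Proof.
move=> fi fP; rewrite /Rintegral -integral21_prod_meas1//; congr fine.
by apply: eq_integral => x _; rewrite /fubini_G /= fineK//; apply: integrable_fin_num.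
Qed.

Lemma Rintegral_Fubini : (P \x Q)%E.-integrable setT (EFin \o f) ->
  (forall x, Q.-integrable setT (fun y => (f (x, y))%:E)) ->
  (forall y, P.-integrable setT (fun x => (f (x, y))%:E)) ->
  \int[P]_x \int[Q]_y f (x, y) = \int[Q]_y \int[P]_x f (x, y).
Proof. by move=> fi fQ fP; rewrite -Rintegral_prod1// Rintegral_prod2. Qed.

Lemma integrable_Rintegral1 : (P \x Q)%E.-integrable setT (EFin \o f) ->
  (forall x, Q.-integrable setT (fun y => (f (x, y))%:E)) ->
  P.-integrable setT (fun x => (\int[Q]_y f (x, y))%:E).
Proof.
move=> fi fQ; apply: eq_integrable (integrable_fubini_F fi) => // x _.
by rewrite /fubini_F /= fineK//; apply: integrable_fin_num.
Qed.

Lemma measurable_Rintegral1 : measurable_fun setT f ->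
  measurable_fun setT (fun x => \int[Q]_y f (x, y)).
Proof.
move=> mf; have mef : measurable_fun setT (EFin \o f) by exact/measurable_EFinP.
rewrite /Rintegral; apply: measurableT_comp => //.
under eq_fun do rewrite integralE.
apply: emeasurable_funB.
  have := @measurable_fun_fubini_tonelli_F _ _ _ _ R Q (EFin \o f)^\+%E (measurable_funepos mef) (fun=> funepos_ge0 _ _).
  congr measurable_fun; apply/funext => x.
  by apply: eq_integral => y _; rewrite !funeposE.
have := @measurable_fun_fubini_tonelli_F _ _ _ _ R Q (EFin \o f)^\-%E (measurable_funeneg mef) (fun=> funeneg_ge0 _ _).
congr measurable_fun; apply/funext => x.
by apply: eq_integral => y _; rewrite !funenegE.
Qed.

Lemma measurable_sect1 (x : T) : measurable_fun setT f ->
  measurable_fun setT (fun y => f (x, y)).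
Proof. by move=> mf; apply: measurableT_comp. Qed.

Lemma measurable_sect2 (y : U) : measurable_fun setT f ->
  measurable_fun setT (fun x => f (x, y)).
Proof. by move=> mf; apply: measurableT_comp. Qed.

End fubini.

Lemma Rintegral_Fubini_bounded d (T : measurableType d) d' (U : measurableType d')
    (R : realType) (P : probability T R) (Q : probability U R) (f : T -> U -> R) M :
  measurable_fun setT (fun z => f z.1 z.2) -> (forall x y, `|f x y| <= M) ->
  \int[P]_x \int[Q]_y f x y = \int[Q]_y \int[P]_x f x y.
Proof.
move=> mf fM; apply: (@Rintegral_Fubini _ _ _ _ _ _ _ (fun z => f z.1 z.2)).
- exact: (@prob_bounded_integrable _ _ _ _ _ M).
- move=> x; apply: (@prob_bounded_integrable _ _ _ _ _ M) => //.
  exact: (measurable_sect1 x mf).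
- move=> x; apply: (@prob_bounded_integrable _ _ _ _ _ M) => //.
  exact: (measurable_sect2 x mf).
Qed.

(** * Integration against a measure with a density *)

Section density.
Context d (T : measurableType d) (R : realType).
Variables (mu nu : {measure set T -> \bar R}) (w : T -> R).
Hypotheses (mw : measurable_fun setT w) (w0 : forall x, 0 <= w x).
Hypothesis nuE : forall A, measurable A -> nu A = (\int[mu]_(x in A) (w x)%:E)%E.
Local Open Scope ereal_scope.
Import HBNNSimple.

Let nnsfun_density (h : {nnsfun T >-> R}) :
  \int[nu]_x (h x)%:E = \int[mu]_x ((h x)%:E * (w x)%:E).
Proof.
under [LHS]eq_integral do rewrite fimfunE -fsumEFin//.
rewrite [LHS]ge0_integral_fsum//; last 2 first.
  - by move=> r; exact/measurable_EFinP/measurableT_comp.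
  - by move=> n x _; rewrite EFinM nnfun_muleindic_ge0.
under [RHS]eq_integral.
  move=> x xD; rewrite fimfunE -fsumEFin// ge0_mule_fsuml; last first.
    by move=> r; rewrite EFinM nnfun_muleindic_ge0.
  over.
rewrite [RHS]ge0_integral_fsum//; last 2 first.
  - move=> r; apply: emeasurable_funM; last exact/measurable_EFinP.
    by apply/measurable_EFinP; exact/measurableT_comp.
  - move=> n x _; rewrite EFinM mule_ge0//; last by rewrite lee_fin.
    by rewrite nnfun_muleindic_ge0.
apply: eq_fsbigr => r /[!inE] -[x _ <-].
under [RHS]eq_integral do rewrite EFinM -muleA.
have mA : measurable (h @^-1` [set h x]) by [].
rewrite [RHS]ge0_integralZl//; last 3 first.
  - apply: emeasurable_funM; last exact/measurable_EFinP.
    by apply/measurable_EFinP; exact: measurable_indic.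
  - by move=> y _; rewrite mule_ge0// lee_fin.
  - by rewrite lee_fin.
under [LHS]eq_integral do rewrite EFinM.
rewrite [LHS]ge0_integralZl//; last 2 first.
  - by apply/measurable_EFinP; exact: measurable_indic.
  - by rewrite lee_fin.
congr (_ * _); rewrite integral_indic// setIT nuE// integral_mkcond.
apply: eq_integral => y _; rewrite patchE indicE; case: ifPn => _.
  by rewrite mul1e.
by rewrite mul0e.
Qed.

Lemma ge0_integral_density (f : T -> \bar R) :
  measurable_fun setT f -> (forall x, 0 <= f x) ->
  \int[nu]_x f x = \int[mu]_x (f x * (w x)%:E).
Proof.
move=> mf f0; pose f_ := nnsfun_approx measurableT mf.
have cvgf x : (f_ n x)%:E @[n --> \oo] --> f x by exact: cvg_nnsfun_approx.
transitivity (lim (\int[nu]_x (f_ n x)%:E @[n --> \oo])).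
  rewrite -monotone_convergence//=.
  - by apply: eq_integral => ? /[!inE] xD; apply/esym/cvg_lim.
  - by move=> n; exact/measurable_EFinP/measurable_funTS.
  - by move=> n ? _; rewrite lee_fin.
  - by move=> ? _ ? ? mn; rewrite lee_fin; exact/lefP/nd_nnsfun_approx.
under eq_fun do rewrite nnsfun_density.
rewrite -monotone_convergence//=.
- apply: eq_integral => x _; apply/cvg_lim => //; apply: cvgeZr => //.
- by move=> n; apply: emeasurable_funM; apply/measurable_EFinP => //.
- by move=> n ? _; rewrite mule_ge0 ?lee_fin.
- move=> x _ a b ab; rewrite lee_wpmul2r ?lee_fin//.
  exact/lefP/nd_nnsfun_approx.
Qed.

Lemma integrable_density (f : T -> R) : measurable_fun setT f ->
  mu.-integrable setT (fun x => (f x * w x)%:E) ->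
  nu.-integrable setT (EFin \o f).
Proof.
move=> mf /integrableP[_ fw]; apply/integrableP; split; first exact/measurable_EFinP.
rewrite ge0_integral_density//; last by do 2 apply: measurableT_comp => //.
move: fw; congr (_ < _); apply: eq_integral => x _ /=.
by rewrite normrM (ger0_norm (w0 x)) EFinM.
Qed.

Lemma integral_density (f : T -> R) : measurable_fun setT f ->
  \int[nu]_x (f x)%:E = \int[mu]_x (f x * w x)%:E.
Proof.
move=> mf; have mf' : measurable_fun setT (EFin \o f) by exact/measurable_EFinP.
rewrite integralE [RHS]integralE.
rewrite !ge0_integral_density//; last 2 first.
  exact: measurable_funeneg.
  exact: measurable_funepos.
congr (_ - _); apply: eq_integral => x _; rewrite ?funeposE ?funenegE -EFin_max -?EFinN -?EFin_max -EFinM;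
  by rewrite maxr_pMl// ?mul0r ?mulNr.
Qed.

End density.

(** * Integrals of derivatives over the real line *)

Section zero_integral.
Context (R : realType).
Notation mu := (@lebesgue_measure R).

(** The fundamental theorem of calculus on [[- (n + 1), n + 1]] leaves boundary terms that tend to
    0, while dominated convergence recovers the integral over the line. The successor keeps every
    interval nondegenerate. *)
Lemma integral_derivative_eq0 (F f : R -> R) :
  (forall x, is_derive x (1 : R) F (f x)) -> continuous f ->
  mu.-integrable setT (EFin \o f) ->
  F x @[x --> +oo] --> 0 -> F x @[x --> -oo] --> 0 ->
  (\int[mu]_x (f x)%:E = 0)%E.
Proof.
move=> dF cf fi Fy FNy.
pose I n := `[(- n.+1%:R : R), n.+1%:R]%classic.
have In n : (\int[mu]_x ((EFin \o f) \_ (I n)) x)%E =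
    (F n.+1%:R - F (- n.+1%:R))%:E.
  rewrite -integral_mkcond /I /= (@continuous_FTC2 _ f F)//.
  - by rewrite gtrN.
  - exact: continuous_subspaceT.
  - have cF : continuous F.
      by move=> x; apply/differentiable_continuous/derivable1_diffP; case: (dF x).
    split.
    + by move=> x _; case: (dF x).
    + by apply: cvg_at_right_filter; exact: cF.
    + by apply: cvg_at_left_filter; exact: cF.
  - by move=> x _; rewrite derive1E; apply: derive_val.
have c1 : (\int[mu]_x ((EFin \o f) \_ (I n)) x)%E @[n --> \oo] -->
    (\int[mu]_x (f x)%:E)%E.
  apply: (@dominated_cvg _ _ _ mu setT measurableT (fun n => (EFin \o f) \_ (I n)) (EFin \o f) (abse \o (EFin \o f))) => //.
  - move=> n; apply/(measurable_restrictT _ _).1 => //.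
      exact: measurable_itv.
    by apply: measurable_funTS; case/integrableP : fi.
  - move=> x _; apply: cvg_near_cst; near=> n.
    rewrite patchE mem_set// /I /= in_itv /= -ler_norml.
    apply: (@le_trans _ _ n%:R); last by rewrite ler_nat.
    near: n; exact: nbhs_infty_ger.
  - exact: integrable_abse.
  - move=> n x _; rewrite patchE; case: ifP => // _.
    by rewrite [X in (`|X| <= _)%E](_ : _ = 0%E)// abse0 abse_ge0.
have c2 : (\int[mu]_x ((EFin \o f) \_ (I n)) x)%E @[n --> \oo] --> 0%E.
  under eq_fun do rewrite In.
  apply: cvg_EFin; first exact: nearW.
  rewrite -[X in _ --> X](subr0 0).
  have c : n.+1%:R @[n --> \oo] --> (+oo : set_system R).
    by have := @cvgr_idn R; rewrite -(cvg_shiftS).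
  apply: cvgB.
    by apply: cvg_comp Fy; exact: c.
  apply: (cvg_comp (fun n : nat => - n.+1%:R) F _ FNy).
  by apply/(cvgNrNy (fun n : nat => (n.+1%:R : R))).
exact: (cvg_unique _ c1 c2).
Unshelve. all: by end_near. Qed.

End zero_integral.

(** * The standard normal distribution *)

Section gaussian1.
Context (R : realType).
Notation mu := (@lebesgue_measure R).

Definition gauss1 : probability (measurableTypeR R) R := normal_prob 0 1.

Definition gpdf (x : R) : R := normal_peak 1 * expR (- (x ^+ 2 / 2)).

Arguments gpdf : simpl never.

Lemma normal_pdf_gpdf x : normal_pdf 0 1 x = gpdf x.
Proof.
rewrite normal_pdfE ?oner_neq0// /gpdf /normal_fun subr0 expr1n mulNr.
by [].
Qed.

Lemma gpdf_ge0 x : 0 <= gpdf x.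
Proof. by rewrite mulr_ge0 ?normal_peak_ge0 ?expR_ge0. Qed.

Lemma normal_peak1_le1 : normal_peak (1 : R) <= 1.
Proof.
rewrite /normal_peak invf_le1 ?sqrtr_gt0; last first.
  by rewrite expr1n mul1r pmulrn_lgt0// pi_gt0.
rewrite -[leLHS]sqrtr1 ler_wsqrtr// expr1n mul1r.
have := pi_ge2 R; lra.
Qed.

Lemma gpdf_le1 x : gpdf x <= 1.
Proof.
rewrite mulr_ile1 ?normal_peak_ge0 ?expR_ge0 ?normal_peak1_le1//.
by rewrite expR_le1 oppr_le0 divr_ge0 ?sqr_ge0.
Qed.

Lemma is_derive_gpdf x : is_derive x (1 : R) gpdf (- x * gpdf x).
Proof.
rewrite /gpdf; apply: trigger_derive.
rewrite /GRing.scale /=; set e := expR _; set c := normal_peak _.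
by field.
Qed.

Lemma continuous_gpdf : continuous gpdf.
Proof.
by move=> x; apply/differentiable_continuous/derivable1_diffP; case: (is_derive_gpdf x).
Qed.

Lemma measurable_gpdf : measurable_fun setT gpdf.
Proof. exact: continuous_measurable_fun continuous_gpdf. Qed.

Lemma gauss1E (A : set (measurableTypeR R)) :
  gauss1 A = (\int[mu]_(x in A) (gpdf x)%:E)%E.
Proof. by rewrite /gauss1 /= /normal_prob; apply: eq_integral => x _; rewrite normal_pdf_gpdf. Qed.

Lemma ge0_integral_gauss1 (f : measurableTypeR R -> \bar R) :
  measurable_fun setT f -> (forall x, 0 <= f x)%E ->
  (\int[gauss1]_x f x = \int[mu]_x (f x * (gpdf x)%:E))%E.
Proof.
move=> mf f0; apply: ge0_integral_density => //.
- exact: measurable_gpdf.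
- exact: gpdf_ge0.
- by move=> A mA; exact: gauss1E.
Qed.

Lemma integral_gauss1 (f : measurableTypeR R -> R) : measurable_fun setT f ->
  (\int[gauss1]_x (f x)%:E = \int[mu]_x (f x * gpdf x)%:E)%E.
Proof.
move=> mf; apply: integral_density => //.
- exact: measurable_gpdf.
- exact: gpdf_ge0.
- by move=> A mA; exact: gauss1E.
Qed.

(** Up to a constant, the product is the normal density of variance 2. The weight
    [expR (x ^+ 2 / 4)] then dominates every polynomial whose Gaussian integrability is required. *)
Lemma integrable_expR_sqr4 :
  mu.-integrable setT (fun x => (expR (x ^+ 2 / 4) * gpdf x)%:E).
Proof.
pose c : R := normal_peak 1 / normal_peak (Num.sqrt 2).
have s0 : Num.sqrt 2 != 0 :> R by rewrite sqrtr_eq0 -ltNge.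
apply: (@eq_integrable _ _ _ mu _ measurableT (fun x => c%:E * (normal_pdf 0 (Num.sqrt 2) x)%:E)%E).
  move=> x _; rewrite -EFinM; congr EFin.
  rewrite normal_pdfE// /normal_fun subr0 sqr_sqrtr// /c /gpdf.
  rewrite mulrA divfK ?gt_eqF ?normal_peak_gt0// mulrCA -expRD.
  by congr (_ * expR _); field.
by apply: integrableZl => //; exact: integrable_normal_pdf.
Qed.

Lemma gauss1_integrable (f : measurableTypeR R -> R) (C : R) :
  measurable_fun setT f -> (forall x, `|f x| <= C * expR (x ^+ 2 / 4)) ->
  mu.-integrable setT (fun x => (f x * gpdf x)%:E) /\
  gauss1.-integrable setT (EFin \o f).
Proof.
move=> mf fC; have i1 : mu.-integrable setT (fun x => (f x * gpdf x)%:E).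
  apply: (le_integrable _ _ _ (integrableZl _ C integrable_expR_sqr4)) => //.
    by apply/measurable_EFinP; apply: measurable_funM => //; exact: measurable_gpdf.
  move=> x _; rewrite /= lee_fin; have := gpdf_ge0 x; move: (gpdf x) => g g0.
  rewrite normrM (ger0_norm g0) mulrA normrM (ger0_norm g0) ler_wpM2r//.
  by rewrite (le_trans (fC x))// ler_norm.
split => //; apply: integrable_density i1 => //.
- exact: measurable_gpdf.
- exact: gpdf_ge0.
- by move=> A mA; exact: gauss1E.
Qed.

Lemma sqr_le_expR4 (x : R) : x ^+ 2 <= 4 * expR (x ^+ 2 / 4).
Proof. have := expR_ge1Dx (x ^+ 2 / 4); lra. Qed.

Lemma abs_le_expR4 (x : R) : `|x| <= 5 * expR (x ^+ 2 / 4).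
Proof.
have h : `|x| <= 1 + x ^+ 2.
  by rewrite -real_normK ?num_real//; have := sqr_ge0 (`|x| - 2^-1); nra.
have := sqr_le_expR4 x; have : 1 <= expR (x ^+ 2 / 4).
  by rewrite -expR0 ler_expR divr_ge0// sqr_ge0.
lra.
Qed.

Lemma quart_le_expR4 (x : R) : x ^+ 4 <= 64 * expR (x ^+ 2 / 4).
Proof.
have h0 : 0 <= x ^+ 2 / 4 by rewrite divr_ge0// sqr_ge0.
have := expR_ge1Dxn 1 h0; rewrite /= (_ : 2`!%:R = 2 :> R)//.
have -> : x ^+ 4 = (x ^+ 2) ^+ 2 by rewrite -exprM.
have := expR_ge0 (x ^+ 2 / 4); rewrite expr_div_n; lra.
Qed.

(** From [exp (x^2 / 2) >= 1 + x^2 / 2], the majorant is at most a multiple of [1 / |x|]. The limit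
    at [-oo] follows by reflection, [gpdf] being even. *)
Lemma cvg_gauss_decay (F : R -> R) (C : R) :
  (forall x, `|F x| <= C * (1 + `|x|) * gpdf x) ->
  F x @[x --> +oo] --> 0 /\ F x @[x --> -oo] --> 0.
Proof.
have key x : 0 < `|x| -> (1 + `|x|) * gpdf x <= 3 * `|x|^-1.
  move=> x0; rewrite ler_pdivlMr// -mulrA (mulrC (gpdf x)) mulrA.
  have p1 := normal_peak1_le1; have e0 := expR_gt0 (- (x ^+ 2 / 2)).
  have h := expR_ge1Dx (x ^+ 2 / 2).
  rewrite /gpdf expRN.
  have e1 := expR_gt0 (x ^+ 2 / 2).
  rewrite mulrCA (le_trans (ler_piMl _ p1))//.
  rewrite ler_pdivrMr// -real_normK ?num_real// in h *.
  have := sqr_ge0 (`|x| - 1); nra.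
have P G : (forall x, `|G x| <= C * (1 + `|x|) * gpdf x) ->
    G x @[x --> +oo] --> 0.
  move=> GC; have C0 : 0 <= C.
    have := GC 0; rewrite normr0 addr0 mulr1 => /(le_trans (normr_ge0 _)).
    by rewrite pmulr_lge0// /gpdf mulr_gt0 ?expR_gt0// normal_peak_gt0// oner_neq0.
  have GC' x : 0 < `|x| -> `|G x| <= (C * 3) * `|x|^-1.
    by move=> x0; rewrite (le_trans (GC x))// -!mulrA ler_wpM2l// key.
  have cv : (C * 3) * x^-1 @[x --> +oo] --> 0.
    rewrite -(mulr0 (C * 3)); apply: cvgMr; apply/gtr0_cvgV0.
      by near=> x; near: x; exact: nbhs_pinfty_gt.
    exact: cvg_id.
  apply/cvgr0Pnorm_le => e e0; have /cvgr0Pnorm_le /(_ e e0) := cv.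
  apply: filterS2 (nbhs_pinfty_gt (num_real 0)) => x x0 ce.
  have x0' : 0 < `|x| by rewrite normr_gt0 gt_eqF.
  rewrite (le_trans (GC' _ x0'))// (le_trans _ ce)// (gtr0_norm x0).
  exact: ler_norm.
move=> FC; split; first exact: P.
apply/cvgNy_compNP; apply: P => x /=; rewrite (le_trans (FC _))//.
by rewrite normrN /gpdf sqrrN.
Unshelve. all: by end_near. Qed.

(** Gaussian integration by parts (Stein's identity): [(f' x - x * f x) * gpdf x] is the derivative
    of [f * gpdf], which vanishes at both infinities by the growth bound on [f]. *)
Lemma gauss1_stein (f f' : R -> R) (C : R) :
  (forall x, is_derive x (1 : R) f (f' x)) -> continuous f' ->
  (forall x, `|f x| <= C * (1 + `|x|)) -> (forall x, `|f' x| <= C) ->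
  \int[gauss1]_x (x * f x) = \int[gauss1]_x f' x.
Proof.
move=> df cf' fC f'C.
have cf : continuous f.
  by move=> x; apply/differentiable_continuous/derivable1_diffP; case: (df x).
have mf : measurable_fun setT f by exact: continuous_measurable_fun.
have mf' : measurable_fun setT f' by exact: continuous_measurable_fun.
have C0 : 0 <= C := le_trans (normr_ge0 _) (f'C 0).
have mg : measurable_fun setT (fun x : R => f' x - x * f x).
  by apply: measurable_funB => //; apply: measurable_funM.
have mxf : measurable_fun setT (fun x : R => x * f x) by exact: measurable_funM.
have e1 (x : R) : 1 <= expR (x ^+ 2 / 4).
  by rewrite -expR0 ler_expR divr_ge0// sqr_ge0.
have b1 x : `|x * f x| <= (9 * C) * expR (x ^+ 2 / 4).
  rewrite normrM (le_trans (ler_wpM2l (normr_ge0 _) (fC x)))//.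
  have := sqr_le_expR4 x; have := abs_le_expR4 x.
  rewrite -[x ^+ 2](real_normK (num_real x)) => h1 h2.
  rewrite mulrCA [9 * C]mulrC -mulrA ler_wpM2l//; lra.
have b2 x : `|f' x| <= C * expR (x ^+ 2 / 4).
  by rewrite (le_trans (f'C x))// ler_peMr.
have [i1 j1] := gauss1_integrable mxf b1.
have [i2 j2] := gauss1_integrable mf' b2.
have b3 x : `|f' x - x * f x| <= (10 * C) * expR (x ^+ 2 / 4).
  rewrite (le_trans (ler_normB _ _))//; have := b1 x; have := b2 x; lra.
have [i3 j3] := gauss1_integrable mg b3.
have := @integral_derivative_eq0 _ (fun x => f x * gpdf x)
  (fun x => (f' x - x * f x) * gpdf x).
have dF x : is_derive x (1 : R) (fun x => f x * gpdf x)
    ((f' x - x * f x) * gpdf x).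
  apply: is_derive_eq (is_deriveM (df x) (is_derive_gpdf x)) _.
  by rewrite /GRing.scale /=; ring.
have cF : continuous (fun x => (f' x - x * f x) * gpdf x).
  move=> x; apply: cvgM; last exact: continuous_gpdf.
  by apply: cvgB; [exact: cf'|apply: cvgM; [exact: cvg_id|exact: cf]].
have [c1 c2] : (fun x => f x * gpdf x) x @[x --> +oo] --> 0 /\
    (fun x => f x * gpdf x) x @[x --> -oo] --> 0.
  apply: (@cvg_gauss_decay _ C) => x.
  by rewrite normrM (ger0_norm (gpdf_ge0 x)) ler_wpM2r ?gpdf_ge0.
move=> /(_ dF cF i3 c1 c2); rewrite -integral_gauss1// => I0.
apply/esym/eqP; rewrite -subr_eq0 -RintegralB//.
by rewrite /Rintegral I0.
Qed.

Lemma measurable_cos : measurable_fun setT (@cos R).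
Proof. exact: continuous_measurable_fun (@continuous_cos R). Qed.

Lemma measurable_sin : measurable_fun setT (@sin R).
Proof. exact: continuous_measurable_fun (@continuous_sin R). Qed.

Lemma gauss1_bounded_integrable (f : R -> R) M : measurable_fun setT f ->
  (forall x, `|f x| <= M) -> gauss1.-integrable setT (fun x => (f x)%:E).
Proof. by move=> mf fM; apply: (@prob_bounded_integrable _ _ _ gauss1 f M). Qed.

Lemma measurable_scale (a : R) : measurable_fun setT (fun x : R => a * x).
Proof. exact: measurable_funM. Qed.

Lemma normr_gauss1_integrable : gauss1.-integrable setT (fun x => (`|x| : R)%:E).
Proof.
apply: (gauss1_integrable (f := fun x : R => `|x|) _ _).2 => [|x].
  exact: measurableT_comp.
by rewrite normr_id; exact: abs_le_expR4.
Qed.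

(** Differentiation under the integral produces the mean of [- x * sin (a * x)], dominated by [|x|];
    Stein's identity turns it into [- a] times the function itself, a linear differential
    equation. *)
Lemma is_derive_gauss1_cos (a : R) :
  is_derive a (1 : R) (fun a => \int[gauss1]_x cos (a * x))
    (- a * \int[gauss1]_x cos (a * x)).
Proof.
have st : \int[gauss1]_x (x * sin (a * x)) = \int[gauss1]_x (a * cos (a * x)).
  apply: (@gauss1_stein _ _ (`|a| + 1)).
  - by move=> x; apply: trigger_derive; rewrite /GRing.scale /=; ring.
  - move=> x; apply: cvgM; first exact: cvg_cst.
    apply: (cvg_comp (fun x => a * x) cos); last exact: continuous_cos.
    by apply: cvgM; [exact: cvg_cst|exact: cvg_id].
  - move=> x; rewrite (le_trans (sin_max _))//.
    by have := normr_ge0 a; have := normr_ge0 x; nra.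
  - move=> x; rewrite normrM; have := cos_max (a * x).
    by have := normr_ge0 a; nra.
have d1 (x y : R) : is_derive x (1 : R) (fun a => cos (a * y)) (- y * sin (x * y)).
  by apply: trigger_derive; rewrite /GRing.scale /=; ring.
have p1 x y : partial1of2 (fun a x : R => cos (a * x)) x y = - y * sin (x * y).
  by rewrite partial1of2E; apply: derive_val.
have i1 x : (a - 1 < x < a + 1) -> gauss1.-integrable setT (EFin \o (fun y => cos (x * y))).
  move=> _; apply: (@gauss1_bounded_integrable _ 1).
    exact: (measurableT_comp measurable_cos (measurable_scale x)).
  by move=> y; exact: cos_max.
have Ia : `]a - 1, a + 1[%classic a by rewrite /= in_itv /= ltrBlDr ltrDl ltr01.
have H1 : forall x, `]a - 1, a + 1[%classic x ->
    gauss1.-integrable setT (EFin \o (fun y => cos (x * y))).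
  by move=> x; rewrite /= in_itv; exact: i1.
have H2 : forall x (y : R), `]a - 1, a + 1[%classic x -> setT y ->
    derivable (fun a : R => cos (a * y)) x 1.
  by move=> x y _ _; case: (d1 x y).
have H3 : forall x (y : R), `]a - 1, a + 1[%classic x -> setT y ->
    `|partial1of2 (fun a x : R => cos (a * x)) x y| <= `|y|.
  move=> x y _ _; rewrite p1 normrM normrN ler_piMr//; exact: sin_max.
have D1 := @derivable_under_integral _ _ _ gauss1 (fun a x : R => cos (a * x))
  setT measurableT a (a - 1) (a + 1) Ia H1 H2 (fun y => `|y|)
  (fun y => normr_ge0 y) normr_gauss1_integrable H3.
have D2 := @differentiation_under_integral _ _ _ gauss1 (fun a x : R => cos (a * x))
  setT measurableT a (a - 1) (a + 1) Ia H1 H2 (fun y => `|y|)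
  (fun y => normr_ge0 y) normr_gauss1_integrable H3.
split => //; rewrite -derive1E D2.
under eq_Rintegral do rewrite p1.
rewrite [RHS]mulNr -RintegralZl//; last by apply: i1; rewrite ltrBlDr ltrDl ltr01.
rewrite -st -mulN1r -RintegralZl//.
  by apply: eq_Rintegral => x _; rewrite mulN1r mulNr.
apply: (gauss1_integrable (f := fun x : R => x * sin (a * x)) _ _).2.
  apply: measurable_funM => //.
  exact: (measurableT_comp measurable_sin (measurable_scale a)).
move=> x; apply: le_trans (abs_le_expR4 x).
by rewrite normrM ler_piMr// sin_max.
Qed.

(** The differential equation makes the derivative of [expR (y ^+ 2 / 2)] times the integral vanish,
    so this product keeps its value 1 at [y = 0]. *)
Lemma gauss1_cos (a : R) : \int[gauss1]_x cos (a * x) = expR (- (a ^+ 2 / 2)).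
Proof.
have h (y : R) : expR (y ^+ 2 / 2) * (\int[gauss1]_x cos (y * x)) = 1.
  transitivity (expR (0 ^+ 2 / 2) * (\int[gauss1]_x cos (0 * x)) : R); last first.
    rewrite expr0n mul0r expR0 mul1r; under eq_Rintegral do rewrite mul0r cos0.
    exact: Rintegral_cstT.
  apply: (@is_derive_0_is_cst _ (fun y => expR (y ^+ 2 / 2) * (\int[gauss1]_x cos (y * x)))).
  move=> z; have dz := is_derive_gauss1_cos z.
  have de : is_derive z (1 : R) (fun y => expR (y ^+ 2 / 2)) (z * expR (z ^+ 2 / 2)).
    by apply: trigger_derive; rewrite /GRing.scale /=; field.
  apply: is_derive_eq (is_deriveM de dz) _.
  by rewrite /GRing.scale /=; ring.
have e0 : expR (a ^+ 2 / 2) != 0 by rewrite gt_eqF// expR_gt0.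
by rewrite (canRL (mulKf e0) (h a)) mulr1 expRN.
Qed.

Lemma gauss1_odd (f : R -> R) : measurable_fun setT f -> (forall x, f (- x) = - f x) ->
  gauss1.-integrable setT (EFin \o f) -> \int[gauss1]_x f x = 0.
Proof.
move=> mf fN fi.
have h : \int[gauss1]_x f x = \int[gauss1]_x f (- x).
  rewrite /Rintegral; congr fine.
  have mN : measurable_fun setT (-%R : R -> measurableTypeR R) by exact: oppr_measurable.
  have gN (A : set (measurableTypeR R)) : measurable A ->
      gauss1 A = pushforward gauss1 (-%R : R -> measurableTypeR R) A.
    move=> mA; have mNA : measurable ((-%R : R -> measurableTypeR R) @^-1` A).
      by rewrite -[X in measurable X]setTI; exact: mN.
    rewrite /pushforward !gauss1E [LHS]integral_mkcond [RHS]integral_mkcond.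
    transitivity (\int[pushforward lebesgue_measure (-%R : R -> measurableTypeR R)]_x
      ((fun x => (gpdf x)%:E) \_ A) x)%E.
      by apply: eq_measure_integral => B mB _; exact/esym/lebesgue_measureN.
    rewrite ge0_integral_pushforward//=; last 2 first.
    - apply/(measurable_restrictT _ _).1 => //; apply: measurable_funTS.
      by apply/measurable_EFinP; exact: measurable_gpdf.
    - by move=> x _; apply: erestrict_ge0 => y _; rewrite lee_fin gpdf_ge0.
    rewrite preimage_setT; apply: eq_integral => x _.
    by rewrite !patchE; congr (if _ then _ else _); rewrite /gpdf sqrrN.
  transitivity (\int[pushforward gauss1 (-%R : R -> measurableTypeR R)]_x (f x)%:E)%E.
    by apply: eq_measure_integral => A mA _; exact: gN.
  rewrite integral_pushforward//=.
  - by apply/measurable_EFinP.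
  - rewrite preimage_setT; apply: eq_integrable (integrableN fi) => // x _.
    by rewrite /= fN EFinN.
move: h; under [in RHS]eq_Rintegral do rewrite fN -mulN1r.
by rewrite RintegralZl// mulN1r; lra.
Qed.

Lemma gauss1_sin (a : R) : \int[gauss1]_x sin (a * x) = 0.
Proof.
have m : measurable_fun setT (fun x => sin (a * x)).
  exact: (measurableT_comp measurable_sin (measurable_scale a)).
apply: gauss1_odd => //.
- by move=> x; rewrite mulrN sinN.
- by apply: (@gauss1_bounded_integrable _ 1) => // x; exact: sin_max.
Qed.

Lemma sqr_gauss1_integrable : gauss1.-integrable setT (fun x => (x ^+ 2 : R)%:E).
Proof.
apply: (gauss1_integrable (f := fun x : R => x ^+ 2) _ _).2 => [|x].
  exact: measurable_funX.
by rewrite ger0_norm ?sqr_ge0//; exact: sqr_le_expR4.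
Qed.

Lemma gauss1_sqr : \int[gauss1]_x (x ^+ 2) = 1 :> R.
Proof.
rewrite -[RHS](Rintegral_cstT gauss1).
apply: (@gauss1_stein id (cst 1) 1).
- by move=> x; exact: cvg_cst.
- by move=> x; rewrite mul1r lerDr.
- by move=> x; rewrite normr1.
Qed.

(** The variance of the square of a standard normal variable, an absolute constant that ends up in
    [mix_const]. *)
Definition gauss1_var2 : R := \int[gauss1]_x ((x ^+ 2 - 1) ^+ 2).

Lemma gauss1_var2_integrable :
  gauss1.-integrable setT (fun x => ((x ^+ 2 - 1) ^+ 2 : R)%:E).
Proof.
apply: (@gauss1_integrable (fun x => (x ^+ 2 - 1) ^+ 2) 65 _ _).2.
  by apply: measurable_funX; apply: measurable_funB => //; exact: measurable_funX.
move=> x; rewrite ger0_norm ?sqr_ge0//.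
have : 1 <= expR (x ^+ 2 / 4).
  by rewrite -expR0 ler_expR divr_ge0// sqr_ge0.
have := quart_le_expR4 x; have := sqr_ge0 x.
rewrite (_ : (x ^+ 2 - 1) ^+ 2 = x ^+ 4 - 2 * x ^+ 2 + 1); last by ring.
lra.
Qed.

Definition Phi (y : R) : R := fine (std_normal_cdf y).

Lemma std_normal_cdfE (y : R) : std_normal_cdf y = (Phi y)%:E.
Proof.
rewrite /Phi fineK// /std_normal_cdf -/gauss1.
exact: (@fin_num_measure _ _ _ gauss1).
Qed.

Lemma Phi_gauss1 (y : R) : (gauss1 `]-oo, y]%classic = (Phi y)%:E)%E.
Proof. by rewrite -std_normal_cdfE. Qed.

Lemma Phi_ge0 y : 0 <= Phi y.
Proof. by rewrite -lee_fin -Phi_gauss1. Qed.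

Lemma Phi_le1 y : Phi y <= 1.
Proof. by rewrite -lee_fin -Phi_gauss1; exact: probability_le1. Qed.

Lemma is_derive_Phi (y : R) : is_derive y (1 : R) Phi (gpdf y).
Proof.
have ig : mu.-integrable setT (fun x => (gpdf x)%:E).
  by apply: eq_integrable (integrable_normal_pdf 0 1) => // x _; rewrite normal_pdf_gpdf.
have -> : Phi = fun x => (\int[mu]_(t in `]-oo, x]) gpdf t).
  by apply/funext => x; apply: EFin_inj; rewrite -Phi_gauss1 gauss1E /Rintegral fineK//;
    apply: integrable_fin_num => //; apply: integrableS ig.
have yy : y < y + 1 by rewrite ltrDl.
have [|||d1 d2] := @continuous_FTC1 _ gpdf (BInfty R true) y (y + 1) yy.
- by apply: integrableS ig.
- by rewrite ltNyr.
- exact: continuous_gpdf.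
- by split => //; rewrite -derive1E.
Qed.

Lemma Phi_lip x y : x <= y -> Phi y - Phi x <= y - x.
Proof.
move=> xy; have [|c _ ->] := @MVT_segment _ Phi gpdf _ _ xy (fun z _ => is_derive_Phi z).
  apply: continuous_subspaceT => z; apply/differentiable_continuous/derivable1_diffP.
  by case: (is_derive_Phi z).
by rewrite ler_piMl ?gpdf_le1// subr_ge0.
Qed.

Lemma abs_gpdf_le1 y : `|y| * gpdf y <= 1.
Proof.
rewrite /gpdf mulrCA (@le_trans _ _ (`|y| * expR (- (y ^+ 2 / 2))))//.
  by rewrite ler_piMl ?normal_peak1_le1// mulr_ge0 ?expR_ge0.
rewrite expRN ler_pdivrMr ?expR_gt0// mul1r; apply: le_trans (expR_ge1Dx _).
by rewrite -real_normK ?num_real//; have := sqr_ge0 (`|y| - 1); nra.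
Qed.

(** Mean value theorem in the dilation factor: for [v >= 1] the derivative [gpdf (v * y) * y] is
    bounded in absolute value by [|v * y| * gpdf (v * y) <= 1], whence uniformity in [y]. *)
Lemma Phi_dilate w y : 1 <= w -> `|Phi (w * y) - Phi y| <= w - 1.
Proof.
move=> w1; have dh (v : R) : is_derive v (1 : R) (fun v => Phi (v * y)) (gpdf (v * y) * y).
  have d1 : is_derive v (1 : R) (fun v => v * y) y.
    by apply: trigger_derive; rewrite /GRing.scale /=; ring.
  exact: (@is_derive1_comp _ Phi (fun v => v * y) v _ _ (is_derive_Phi _) d1).
have [|c] := @MVT_segment _ (fun v => Phi (v * y)) _ _ _ w1 (fun z _ => dh z).
  apply: continuous_subspaceT => z; apply/differentiable_continuous/derivable1_diffP.
  by case: (dh z).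
rewrite in_itv /= mul1r => /andP[c1 _] ->.
rewrite normrM (@ger0_norm _ (w - 1)) ?subr_ge0// ler_piMl ?subr_ge0//.
rewrite normrM (ger0_norm (gpdf_ge0 _)) mulrC.
apply: le_trans (abs_gpdf_le1 (c * y)); rewrite ler_wpM2r ?gpdf_ge0//.
by rewrite normrM ler_peMl// ger0_norm// (le_trans _ c1).
Qed.

(** Squares appear because [sigma_2] and the Gaussian norm control [|X|^2] and [|z|^2]. For [u >= 1]
    the point [x / u] is dilated by [u], for [1 / 2 < u < 1] the point [x] is dilated by
    [1 / u <= 2], and for [u <= 1 / 2] the right-hand side already exceeds 1. *)
Lemma Phi_scale u x : 0 < u -> `|Phi (x / u) - Phi x| <= 2 * `|u ^+ 2 - 1|.
Proof.
move=> u0; have [u1|u1] := leP 1 u.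
  have -> : Phi x = Phi (u * (x / u)) by rewrite mulrC divfK// gt_eqF.
  rewrite distrC (le_trans (Phi_dilate _ u1))// ger0_norm ?subr_ge0 ?exprn_ege1//.
  nra.
rewrite distrC [`|u ^+ 2 - 1|]distrC [`|1 - u ^+ 2|]ger0_norm; last first.
  by rewrite subr_ge0 expr_le1// ltW.
have [uh|uh] := leP u (2^-1).
  apply: (@le_trans _ _ 1); last by nra.
  have := Phi_ge0 x; have := Phi_le1 x; have := Phi_ge0 (x / u); have := Phi_le1 (x / u).
  by move=> *; rewrite ler_norml; lra.
have iu1 : 1 <= u^-1 by rewrite invf_ge1// ltW.
rewrite distrC mulrC (le_trans (Phi_dilate _ iu1))//.
have iu2 : u^-1 <= 2 by rewrite invf_ple ?posrE// ltW.
have uu : u * u^-1 = 1 by rewrite divff// gt_eqF.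
nra.
Qed.

Lemma gauss1_set0 : gauss1 [set 0] = 0%E.
Proof. by rewrite gauss1E; exact: integral_set1. Qed.

Lemma normr_sin_le (x : R) : `|sin x| <= `|x|.
Proof.
have pos (y : R) : 0 <= y -> `|sin y| <= y.
  move=> y0; have [|c _] := @MVT_segment _ (@sin R) (@cos R) _ _ y0 (fun z _ => is_derive_sin z).
    by apply: continuous_subspaceT; exact: continuous_sin.
  rewrite sin0 !subr0 => ->; rewrite normrM (ger0_norm y0) ler_piMl// cos_max//.
have [x0|x0] := ltP x 0; last by rewrite (ger0_norm x0) pos.
by rewrite (ltr0_norm x0) -normrN -sinN pos// oppr_ge0 ltW.
Qed.

Lemma measurable_invr : measurable_fun setT (fun x : R => x^-1).
Proof.
(* The real power represents the inverse on nonnegative bases, hence the square; at 0 both sides are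
   0. *)
have -> : (fun x : R => x^-1) = (fun x => x * (x ^+ 2) `^ (-1)).
  apply/funext => x; rewrite powR_inv1 ?sqr_ge0//.
  have [->|x0] := eqVneq x 0; first by rewrite invr0 mul0r.
  by rewrite expr2 invfM mulrA divff// mul1r.
apply: measurable_funM => //.
exact: (measurableT_comp (measurable_powR (-1)) (measurable_funX 2 (@measurable_id _ _ setT))).
Qed.

(** Differentiating in [a] removes the denominator and leaves the mean of [cos (a * x)], already
    computed. This is the source of the Fourier representation of [Phi]. *)
Lemma is_derive_gauss1_sinc (a : R) :
  is_derive a (1 : R) (fun a => \int[gauss1]_x (sin (a * x) / x))
    (expR (- (a ^+ 2 / 2))).
Proof.
have d1 (x y : R) : is_derive x (1 : R) (fun a => sin (a * y) / y) (y / y * cos (x * y)).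
  by apply: trigger_derive; rewrite /GRing.scale /=; ring.
have p1 x y : partial1of2 (fun a x : R => sin (a * x) / x) x y = y / y * cos (x * y).
  by rewrite partial1of2E; apply: derive_val.
have ms x : measurable_fun setT (fun y : R => sin (x * y) / y).
  apply: measurable_funM => //.
    exact: (measurableT_comp measurable_sin (measurable_scale x)).
  exact: measurable_invr.
have sb (x y : R) : `|sin (x * y) / y| <= `|x|.
  have [->|y0] := eqVneq y 0; first by rewrite invr0 mulr0 normr0.
  rewrite normrM normfV ler_pdivrMr ?normr_gt0// -normrM.
  exact: normr_sin_le.
have i1 x : gauss1.-integrable setT (EFin \o (fun y : R => sin (x * y) / y)).
  exact: (@gauss1_bounded_integrable _ `|x|).
have Ia : `]a - 1, a + 1[%classic a by rewrite /= in_itv /= ltrBlDr ltrDl ltr01.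
have H2 : forall x (y : R), `]a - 1, a + 1[%classic x -> setT y ->
    derivable (fun a : R => sin (a * y) / y) x 1.
  by move=> x y _ _; case: (d1 x y).
have H3 : forall x (y : R), `]a - 1, a + 1[%classic x -> setT y ->
    `|partial1of2 (fun a x : R => sin (a * x) / x) x y| <= 1.
  move=> x y _ _; rewrite p1 normrM mulr_ile1//; last exact: cos_max.
  by have [->|y0] := eqVneq y 0; rewrite ?mul0r ?normr0// divff// normr1.
have i2 : gauss1.-integrable setT (EFin \o (fun _ : R => 1)).
  exact: finite_measure_integrable_cst.
have D1 := @derivable_under_integral _ _ _ gauss1 (fun a x : R => sin (a * x) / x)
  setT measurableT a (a - 1) (a + 1) Ia (fun x _ => i1 x) H2 (fun y => 1)
  (fun=> ler01) i2 H3.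
have D2 := @differentiation_under_integral _ _ _ gauss1 (fun a x : R => sin (a * x) / x)
  setT measurableT a (a - 1) (a + 1) Ia (fun x _ => i1 x) H2 (fun y => 1)
  (fun=> ler01) i2 H3.
split => //; rewrite -derive1E D2 -gauss1_cos.
have mc : measurable_fun setT (fun y : R => cos (a * y)).
  exact: (measurableT_comp measurable_cos (measurable_scale a)).
under eq_Rintegral do rewrite p1.
rewrite /Rintegral; congr fine; apply: ae_eq_integral => //.
- apply/measurable_EFinP.
  apply: measurable_funM => //; apply: measurable_funM => //; exact: measurable_invr.
- exact/measurable_EFinP.
(* The quotient [y / y] is 0 instead of 1 at [y = 0], so the two integrands agree only off this null
   set. *)
- exists [set 0]; split => //; first exact: gauss1_set0.
  move=> y /=; apply: contra_notP => /eqP y0 _.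
  by rewrite divff// mul1r.
Qed.

(** Fourier inversion for [Phi]: both sides have derivative [gpdf]. The additive constant stays
    implicit because only differences of two such representations occur, where it cancels. *)
Lemma Phi_sinc : exists c : R, forall y,
  Phi y = c + normal_peak 1 * \int[gauss1]_x (sin (y * x) / x).
Proof.
pose h y := Phi y - normal_peak 1 * \int[gauss1]_x (sin (y * x) / x).
exists (h 0) => y; suff -> : h 0 = h y by rewrite /h subrK.
apply: is_derive_0_is_cst => z.
apply: is_derive_eq (is_deriveB (is_derive_Phi z) (is_deriveZ (normal_peak 1) (is_derive_gauss1_sinc z))) _.
by rewrite /gpdf /GRing.scale /= subrr.
Qed.

End gaussian1.

(** * The Gaussian measure on R^n *)

Section product_integrals.
Context d (T : measurableType d) d' (U : measurableType d') (R : realType)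
  (P : probability T R) (Q : probability U R).
Variables (f : T -> R) (g : U -> R).
Hypotheses (fi : P.-integrable setT (EFin \o f)) (gi : Q.-integrable setT (EFin \o g)).

Let mf : measurable_fun setT f. Proof. by apply/measurable_EFinP; case/integrableP : fi. Qed.
Let mg : measurable_fun setT g. Proof. by apply/measurable_EFinP; case/integrableP : gi. Qed.

Lemma integrable_prod_mul :
  (P \x Q)%E.-integrable setT (fun z => (f z.1 * g z.2)%:E).
Proof.
apply/integrable12ltyP.
  apply/measurable_EFinP; apply: measurable_funM; exact: measurableT_comp.
under eq_integral => x _.
  under eq_integral => y _ do rewrite /= normrM EFinM.
  rewrite ge0_integralZl//; last first.
    by do 2 apply: measurableT_comp => //.
  over.
rewrite ge0_integralZr//; last 2 first.
- by do 2 apply: measurableT_comp => //.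
- exact: integral_ge0.
case/integrableP : fi => _ fo; case/integrableP : gi => _ go.
have fo' : (\int[P]_x `|f x|%:E)%E \is a fin_num by rewrite ge0_fin_numE// integral_ge0.
have go' : (\int[Q]_x `|g x|%:E)%E \is a fin_num by rewrite ge0_fin_numE// integral_ge0.
by rewrite -(fineK fo') -(fineK go') -EFinM ltry.
Qed.

Lemma Rintegral_prod_mul :
  \int[(P \x Q)%E]_z (f z.1 * g z.2) = (\int[P]_x f x) * (\int[Q]_y g y).
Proof.
rewrite (@Rintegral_prod1 _ _ _ _ _ _ _ (fun z => f z.1 * g z.2))//=; last 2 first.
- exact: integrable_prod_mul.
- by move=> x; under eq_fun do rewrite EFinM; apply: integrableZl.
by under eq_Rintegral => x _ do rewrite RintegralZl//; rewrite RintegralZr.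
Qed.

End product_integrals.

(* [consT] for the sigma-algebra (and display) carried by [lebesgue_measure]. *)
Definition consTR {R : realType} {n : nat} (p : measurableTypeR R * n.-tuple R) :
  n.+1.-tuple R := consT p.

Lemma measurable_consTR (R : realType) (n : nat) :
  measurable_fun [set: measurableTypeR R * n.-tuple R] (@consTR R n).
Proof. exact: measurable_consT. Qed.

HB.instance Definition _ (R : realType) (n : nat) :=
  isMeasurableFun.Build _ _ _ _ (@consTR R n) (@measurable_consTR R n).

Section gauss_tuple.
Context {R : realType}.

Definition gauss_cons n (m : probability (n.-tuple R) R) :
  probability (n.+1.-tuple R) R := distribution (gauss1 R \x m)%E (@consTR R n).

(** The recursion is that of [lebesgue_tuple], so that its density with respect to the latter is
    obtained by induction on the dimension. *)
Fixpoint gauss (n : nat) : probability (n.-tuple R) R :=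
  if n is n'.+1 then gauss_cons (gauss n') else \d_[tuple]%E.

Lemma consTK n (z : n.+1.-tuple R) : consT (thead z, behead_tuple z) = z.
Proof. by apply/val_inj; rewrite [in RHS](tuple_eta z). Qed.

Lemma dotp_consT n (x y : R) (s t : n.-tuple R) :
  dotp (consT (x, s)) (consT (y, t)) = x * y + dotp s t.
Proof.
rewrite /dotp big_ord_recl /consT /= !tnth0; congr (_ + _).
by apply: eq_bigr => i _; rewrite !tnthS.
Qed.

Lemma dotpC n (s t : n.-tuple R) : dotp s t = dotp t s.
Proof. by apply: eq_bigr => i _; rewrite mulrC. Qed.

Lemma dotp_ge0 n (s : n.-tuple R) : 0 <= dotp s s.
Proof. by apply: sumr_ge0 => i _; rewrite -expr2 sqr_ge0. Qed.

Lemma enorm_sqr n (s : n.-tuple R) : enorm s ^+ 2 = dotp s s.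
Proof. by rewrite sqr_sqrtr// dotp_ge0. Qed.

Lemma enorm_ge0 n (s : n.-tuple R) : 0 <= enorm s.
Proof. exact: sqrtr_ge0. Qed.

Lemma measurable_dotp n : measurable_fun setT (fun z : n.-tuple R * n.-tuple R => dotp z.1 z.2).
Proof.
apply: measurable_sum => i; apply: measurable_funM.
  exact: (measurableT_comp (measurable_tnth i) measurable_fst).
exact: (measurableT_comp (measurable_tnth i) measurable_snd).
Qed.

Lemma measurable_dotp2 d (T : measurableType d) n (f g : T -> n.-tuple R) :
  measurable_fun setT f -> measurable_fun setT g ->
  measurable_fun setT (fun x => dotp (f x) (g x)).
Proof.
move=> mf mg; exact: (measurableT_comp (@measurable_dotp n) (measurable_fun_pair mf mg)).
Qed.

Lemma ge0_integral_gaussS n (f : n.+1.-tuple R -> \bar R) :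
  measurable_fun setT f -> (forall z, 0 <= f z)%E ->
  (\int[gauss n.+1]_z f z =
   \int[gauss1 R]_x \int[gauss n]_t f (consTR (x, t)))%E.
Proof.
move=> mf f0; rewrite [LHS]ge0_integral_distribution//.
rewrite (fubini_tonelli1 (f \o @consTR R n))//; last by move=> x; exact: f0.
by apply: measurableT_comp => //; exact: measurable_consTR.
Qed.

Lemma integrable_gaussS n (f : n.+1.-tuple R -> R) : measurable_fun setT f ->
  (gauss1 R \x gauss n)%E.-integrable setT (fun z => (f (consTR z))%:E) ->
  (gauss n.+1).-integrable setT (EFin \o f) /\
  \int[gauss n.+1]_z f z = \int[(gauss1 R \x gauss n)%E]_z f (consTR z).
Proof.
move=> mf fi; split.
  apply/integrableP; split; first exact/measurable_EFinP.
  rewrite [ltLHS]ge0_integral_distribution//=; last first.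
    by do 2 apply: measurableT_comp => //.
  by case/integrableP : fi.
rewrite /Rintegral; congr fine.
rewrite [LHS]integral_distribution//.
exact/measurable_EFinP.
Qed.

Lemma measurable_cos_dotp n (a : n.-tuple R) : measurable_fun setT (fun z => cos (dotp a z)).
Proof. by apply: (measurableT_comp (@measurable_cos R)); exact: measurable_dotp2. Qed.

Lemma measurable_sin_dotp n (a : n.-tuple R) : measurable_fun setT (fun z => sin (dotp a z)).
Proof. by apply: (measurableT_comp (@measurable_sin R)); exact: measurable_dotp2. Qed.

Lemma gauss_bounded_integrable n (f : n.-tuple R -> R) M : measurable_fun setT f ->
  (forall x, `|f x| <= M) -> (gauss n).-integrable setT (fun x => (f x)%:E).
Proof. by move=> mf fM; apply: (@prob_bounded_integrable _ _ _ (gauss n) f M). Qed.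

(** The two integrals are the real and imaginary parts of the mean of [exp (i <a, z>)]. They are
    carried through one induction because the addition formulas mix them. *)
Lemma gauss_cos_sin n (a : n.-tuple R) :
  \int[gauss n]_z cos (dotp a z) = expR (- (dotp a a / 2)) /\
  \int[gauss n]_z sin (dotp a z) = 0.
Proof.
elim: n a => [|n IHn] a.
  have d0 (z : 0.-tuple R) : dotp a z = 0 by rewrite /dotp big_ord0.
  split.
    under eq_Rintegral do rewrite d0 cos0.
    by rewrite d0 mul0r oppr0 expR0; exact: Rintegral_cstT.
  under eq_Rintegral do rewrite d0 sin0.
  exact: Rintegral_cstT.
have [ic is_] := IHn (behead_tuple a).
set a' := behead_tuple a in ic is_; set a0 := thead a.
have aE : a = consT (a0, a') by rewrite consTK.
have i1 : (gauss1 R).-integrable setT (EFin \o (fun x : R => cos (a0 * x))).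
  apply: (@gauss1_bounded_integrable _ _ 1) => [|x]; last exact: cos_max.
  exact: (measurableT_comp (@measurable_cos R) (measurable_scale a0)).
have i2 : (gauss1 R).-integrable setT (EFin \o (fun x : R => sin (a0 * x))).
  apply: (@gauss1_bounded_integrable _ _ 1) => [|x]; last exact: sin_max.
  exact: (measurableT_comp (@measurable_sin R) (measurable_scale a0)).
have i3 : (gauss n).-integrable setT (EFin \o (fun z => cos (dotp a' z))).
  apply: (@gauss_bounded_integrable _ _ 1) => [|x]; last exact: cos_max.
  exact: measurable_cos_dotp.
have i4 : (gauss n).-integrable setT (EFin \o (fun z => sin (dotp a' z))).
  apply: (@gauss_bounded_integrable _ _ 1) => [|x]; last exact: sin_max.
  exact: measurable_sin_dotp.
have mcT : measurable_fun setT (fun z => cos (dotp a (consTR z))).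
  exact: (measurableT_comp (measurable_cos_dotp a) (@measurable_consTR R n)).
have msT : measurable_fun setT (fun z => sin (dotp a (consTR z))).
  exact: (measurableT_comp (measurable_sin_dotp a) (@measurable_consTR R n)).
have Ec z : cos (dotp a (consTR z)) = cos (a0 * z.1) * cos (dotp a' z.2) -
    sin (a0 * z.1) * sin (dotp a' z.2).
  by case: z => x t; rewrite /consTR aE dotp_consT cosD.
have Es z : sin (dotp a (consTR z)) = sin (a0 * z.1) * cos (dotp a' z.2) +
    cos (a0 * z.1) * sin (dotp a' z.2).
  by case: z => x t; rewrite /consTR aE dotp_consT sinD.
split.
- have [_ ->] := @integrable_gaussS n (fun z => cos (dotp a z)) (measurable_cos_dotp a)
    (@prob_bounded_integrable _ _ _ _ _ 1 mcT (fun=> cos_max _)).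
  under eq_Rintegral do rewrite Ec.
  rewrite RintegralB//=; last 2 first.
  + exact: (integrable_prod_mul i1 i3).
  + exact: (integrable_prod_mul i2 i4).
  rewrite (Rintegral_prod_mul i1 i3) (Rintegral_prod_mul i2 i4) gauss1_cos gauss1_sin.
  rewrite ic mul0r subr0 -expRD aE dotp_consT; congr expR; by field.
- have [_ ->] := @integrable_gaussS n (fun z => sin (dotp a z)) (measurable_sin_dotp a)
    (@prob_bounded_integrable _ _ _ _ _ 1 msT (fun=> sin_max _)).
  under eq_Rintegral do rewrite Es.
  rewrite RintegralD//=; last 2 first.
  + exact: (integrable_prod_mul i2 i3).
  + exact: (integrable_prod_mul i1 i4).
  rewrite (Rintegral_prod_mul i2 i3) (Rintegral_prod_mul i1 i4) gauss1_sin is_.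
  by rewrite mul0r mulr0 addr0.
Qed.

(** The squared coordinates are independent, so their variances add up; in the induction the
    vanishing means kill the cross term. It follows that [|z|^2 / n] deviates from 1 by order
    [1 / sqrt n]. *)
Lemma gauss_sqnorm_var n :
  [/\ (gauss n).-integrable setT (fun z => (dotp z z - n%:R)%:E),
      \int[gauss n]_z (dotp z z - n%:R) = 0,
      (gauss n).-integrable setT (fun z => ((dotp z z - n%:R) ^+ 2)%:E) &
      \int[gauss n]_z ((dotp z z - n%:R) ^+ 2) = n%:R * gauss1_var2 R].
Proof.
elim: n => [|n [q1 q2 q3 q4]].
  have d0 (z : 0.-tuple R) : dotp z z - 0%:R = 0 by rewrite /dotp big_ord0 subr0.
  have d1 (z : 0.-tuple R) : (dotp z z - 0%:R) ^+ 2 = 0 by rewrite d0 expr0n.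
  split.
  - by under eq_fun do rewrite d0; exact: finite_measure_integrable_cst.
  - by under eq_Rintegral do rewrite d0; exact: Rintegral_cstT.
  - by under eq_fun do rewrite d1; exact: finite_measure_integrable_cst.
  - by under eq_Rintegral do rewrite d1; rewrite mul0r; exact: Rintegral_cstT.
have c1 : (gauss n).-integrable setT (EFin \o (fun=> 1)).
  exact: finite_measure_integrable_cst.
have c1' : (gauss1 R).-integrable setT (EFin \o (fun=> 1)).
  exact: finite_measure_integrable_cst.
have p1 : (gauss1 R).-integrable setT (EFin \o (fun x : R => x ^+ 2 - 1)).
  have := integrableB measurableT (sqr_gauss1_integrable R) c1'.
  exact: eq_integrable.
have p2 : \int[gauss1 R]_x (x ^+ 2 - 1) = 0.
  rewrite RintegralB//; last exact: sqr_gauss1_integrable.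
  by rewrite gauss1_sqr Rintegral_cstT subrr.
have p3 := gauss1_var2_integrable R.
have mq : measurable_fun setT (fun z : n.+1.-tuple R => dotp z z - n.+1%:R).
  by apply: measurable_funB => //; exact: measurable_dotp2.
have E (z : measurableTypeR R * n.-tuple R) : dotp (consTR z) (consTR z) - n.+1%:R =
    (z.1 ^+ 2 - 1) * 1 + 1 * (dotp z.2 z.2 - n%:R).
  by case: z => x t; rewrite /consTR dotp_consT -natr1 /=; ring.
have E2 (z : measurableTypeR R * n.-tuple R) : (dotp (consTR z) (consTR z) - n.+1%:R) ^+ 2 =
    (z.1 ^+ 2 - 1) ^+ 2 * 1 + (2 * ((z.1 ^+ 2 - 1) * (dotp z.2 z.2 - n%:R)) +
    1 * (dotp z.2 z.2 - n%:R) ^+ 2).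
  by rewrite E; ring.
have j1 := integrable_prod_mul p1 c1; have j2 := integrable_prod_mul c1' q1.
have j3 := integrable_prod_mul p3 c1; have j4 := integrable_prod_mul p1 q1.
have j5 := integrable_prod_mul c1' q3.
have j6 := integrableZl measurableT 2 j4.
have k1 := integrableD measurableT j1 j2.
have k2 := integrableD measurableT j6 j5.
have k3 := integrableD measurableT j3 k2.
have [|r1 r2] := @integrable_gaussS n (fun z => dotp z z - n.+1%:R) mq.
  by apply: eq_integrable k1 => // z _; rewrite E EFinD.
have [|r3 r4] := @integrable_gaussS n (fun z => (dotp z z - n.+1%:R) ^+ 2) (measurable_funX 2 mq).
  by apply: eq_integrable k3 => // z _; rewrite E2 !EFinD EFinM.
split => //.
- rewrite r2; under eq_Rintegral do rewrite E.
  rewrite RintegralD//= (Rintegral_prod_mul p1 c1) (Rintegral_prod_mul c1' q1).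
  by rewrite p2 q2 mul0r mulr0 addr0.
- rewrite r4; under eq_Rintegral do rewrite E2.
  rewrite RintegralD//= RintegralD//= RintegralZl//=.
  rewrite (Rintegral_prod_mul p3 c1) (Rintegral_prod_mul p1 q1) (Rintegral_prod_mul c1' q3).
  by rewrite p2 q4 !Rintegral_cstT /gauss1_var2 -natr1; ring.
Qed.

End gauss_tuple.

(** * Gaussian and spherical averages *)

Section polar.
Context {R : realType}.
Notation mu := (@lebesgue_measure R).

Definition gauss_density n (z : n.-tuple R) : R :=
  normal_peak 1 ^+ n * expR (- (dotp z z / 2)).

Lemma measurable_gauss_density n : measurable_fun setT (@gauss_density n).
Proof.
apply: measurable_funM => //; apply: measurableT_comp => //.
apply: measurableT_comp => //; apply: measurable_funM => //.
exact: measurable_sqnorm.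
Qed.

Lemma gauss_density_ge0 n (z : n.-tuple R) : 0 <= gauss_density z.
Proof. by rewrite mulr_ge0 ?expR_ge0 ?exprn_ge0 ?normal_peak_ge0. Qed.

Lemma ge0_integral_lebesgueS n (f : n.+1.-tuple R -> \bar R) :
  measurable_fun setT f -> (forall z, 0 <= f z)%E ->
  (\int[lebesgue_tuple n.+1]_z f z =
   \int[mu]_x \int[lebesgue_tuple n]_t f (consTR (x, t)))%E.
Proof.
move=> mf f0; have mc := @measurable_consTR R n.
transitivity (\int[pushforward (mu \x lebesgue_tuple n)%E (@consTR R n)]_z f z)%E.
  by apply: eq_measure_integral.
rewrite ge0_integral_pushforward//=.
rewrite preimage_setT (fubini_tonelli1 (f \o @consTR R n))//; last by move=> x; exact: f0.
by apply: measurableT_comp => //; exact: measurable_consTR.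
Qed.

Lemma ge0_integral_gauss n (f : n.-tuple R -> \bar R) :
  measurable_fun setT f -> (forall z, 0 <= f z)%E ->
  (\int[gauss n]_z f z = \int[lebesgue_tuple n]_z (f z * (gauss_density z)%:E))%E.
Proof.
elim: n f => [|n IHn] f mf f0.
  rewrite /= /gauss_density; apply: eq_integral => z _.
  by rewrite /dotp big_ord0 mul0r oppr0 expR0 expr0 mulr1 mule1.
have mfc : measurable_fun setT (f \o @consTR R n).
  by apply: measurableT_comp => //; exact: measurable_consTR.
rewrite ge0_integral_gaussS// ge0_integral_lebesgueS//; last 2 first.
- by apply: emeasurable_funM => //; apply/measurable_EFinP; exact: measurable_gauss_density.
- by move=> z; rewrite mule_ge0// lee_fin gauss_density_ge0.
under eq_integral => x _.
  rewrite IHn//; last by apply: (measurableT_comp mfc).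
  over.
rewrite ge0_integral_gauss1//; last 2 first.
- apply: (@measurable_fun_fubini_tonelli_F _ _ _ _ _ (lebesgue_tuple n)
    (fun z => (f \o @consTR R n) z * (gauss_density z.2)%:E)%E).
    apply: emeasurable_funM => //; apply/measurable_EFinP.
    exact: (measurableT_comp (@measurable_gauss_density n)).
  by move=> z; rewrite mule_ge0 ?lee_fin ?gauss_density_ge0 ?f0.
- by move=> x; apply: integral_ge0 => z _; rewrite mule_ge0 ?lee_fin ?gauss_density_ge0 ?f0.
apply: eq_integral => x _.
rewrite -ge0_integralZr//; last 3 first.
- apply: emeasurable_funM; first by apply: (measurableT_comp mfc).
  by apply/measurable_EFinP; exact: measurable_gauss_density.
- by move=> z _; rewrite mule_ge0 ?lee_fin ?gauss_density_ge0 ?f0.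
- by rewrite lee_fin gpdf_ge0.
apply: eq_integral => z _; rewrite -muleA -EFinM; congr (_ * _%:E)%E.
rewrite /gauss_density /consTR dotp_consT /gpdf [in RHS](exprSr _ n) mulrACA -!expRD.
by congr (_ * expR _); field.
Qed.

(** Uniqueness of Lebesgue measure: the rescaled measure has the right value on half-open intervals,
    whose preimages under multiplication by [r] are [r] times shorter. *)
Lemma lebesgue_measure_scale (r : R) (A : set (measurableTypeR R)) : 0 < r ->
  measurable A ->
  (r%:E * pushforward mu ( *%R r : measurableTypeR R -> measurableTypeR R) A = mu A)%E.
Proof.
move=> r0 mA.
have mr : measurable_fun setT ( *%R r : measurableTypeR R -> measurableTypeR R).
  exact: measurable_scale.
apply/esym; apply: etrans (@lebesgue_measure_unique R
  (mscale (NngNum (ltW r0)) (pushforward mu ( *%R r : measurableTypeR R -> measurableTypeR R))) _ _ mA) _ => //.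
move=> _ [[a b]] _ <-.
have E : ( *%R r : measurableTypeR R -> measurableTypeR R) @^-1` `]a, b]%classic =
    `](r^-1 * a), (r^-1 * b)]%classic.
  apply/seteqP; split=> x /=; rewrite !in_itv /= !(mulrC r^-1).
    by rewrite ltr_pdivrMr// ler_pdivlMr// (mulrC x).
  by rewrite ltr_pdivrMr// ler_pdivlMr// (mulrC x).
transitivity (r%:E * mu `](r^-1 * a)%R, (r^-1 * b)%R]%classic)%E; last by rewrite -E.
rewrite !lebesgue_measure_itv/= !lte_fin ltr_pM2l ?invr_gt0//.
case: ifPn => _; last by rewrite mule0.
by rewrite -!EFinD -EFinM -mulrBr mulrA divff ?mul1r// gt_eqF.
Qed.

Lemma ge0_integral_lebesgue_scale (r : R) (f : measurableTypeR R -> \bar R) : 0 < r ->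
  measurable_fun setT f -> (forall x, 0 <= f x)%E ->
  (r%:E * \int[mu]_x f (r * x)%R = \int[mu]_x f x)%E.
Proof.
move=> r0 mf f0.
have mr : measurable_fun setT ( *%R r : measurableTypeR R -> measurableTypeR R).
  exact: measurable_scale.
transitivity (r%:E * \int[pushforward mu ( *%R r : measurableTypeR R -> measurableTypeR R)]_x f x)%E.
  by rewrite ge0_integral_pushforward//= preimage_setT.
rewrite -(@ge0_integral_mscale _ _ _ _ _ measurableT (NngNum (ltW r0)) f)//.
by apply: eq_measure_integral => A mA _; exact: lebesgue_measure_scale.
Qed.

Definition scalet n (r : R) (z : n.-tuple R) : n.-tuple R := [tuple r * tnth z i | i < n].

Lemma measurable_scalet n (r : R) : measurable_fun setT (@scalet n r).
Proof.
apply/measurable_fun_tnthP => i.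
rewrite (_ : _ \o _ = fun z : n.-tuple R => r * tnth z i).
  by apply: measurable_funM => //; exact: measurable_tnth.
by apply/funext => z /=; rewrite tnth_mktuple.
Qed.

Lemma scalet_consTR n (r x : R) (z : n.-tuple R) :
  scalet r (consTR (x, z)) = consTR (r * x, scalet r z).
Proof.
apply/eq_from_tnth => i; rewrite tnth_mktuple /consTR /consT /=.
by case: (unliftP ord0 i) => [j|] ->; rewrite ?tnthS ?tnth0 ?tnth_mktuple.
Qed.

Lemma ge0_integral_lebesgue_tuple_scale n (r : R) (f : n.-tuple R -> \bar R) : 0 < r ->
  measurable_fun setT f -> (forall x, 0 <= f x)%E ->
  ((r ^+ n)%:E * \int[lebesgue_tuple n]_x f (scalet r x) = \int[lebesgue_tuple n]_x f x)%E.
Proof.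
move=> r0; elim: n f => [|n IHn] f mf f0.
  by rewrite expr0 mul1e; apply: eq_integral => x _; rewrite [scalet _ _]tuple0 [x]tuple0.
have mfc : measurable_fun setT (f \o @consTR R n).
  by apply: measurableT_comp => //; exact: measurable_consTR.
have mfs : measurable_fun setT (f \o scalet r).
  by apply: measurableT_comp => //; exact: measurable_scalet.
rewrite [X in (_ * X)%E]ge0_integral_lebesgueS//.
rewrite [RHS]ge0_integral_lebesgueS//.
rewrite -[RHS](ge0_integral_lebesgue_scale r0); last 2 first.
- exact: (@measurable_fun_fubini_tonelli_F _ _ _ _ _ (lebesgue_tuple n)
    (f \o @consTR R n) mfc (fun z => f0 _)).
- by move=> x; apply: integral_ge0 => z _; exact: f0.
rewrite exprS EFinM -muleA; congr (_ * _)%E.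
rewrite -ge0_integralZl//; last 3 first.
- apply: (@measurable_fun_fubini_tonelli_F _ _ _ _ _ (lebesgue_tuple n)
    (fun z => f (scalet r (consTR z)))) => //.
  by apply: (measurableT_comp mfs); exact: measurable_consTR.
- by move=> x _; apply: integral_ge0 => z _; exact: f0.
- by rewrite lee_fin exprn_ge0// ltW.
apply: eq_integral => x _; rewrite -[RHS]IHn//.
  by congr (_ * _)%E; apply: eq_integral => z _; rewrite scalet_consTR.
exact: (measurableT_comp mfc).
Qed.

Lemma dotp_scalet n (r : R) (z : n.-tuple R) :
  dotp (scalet r z) (scalet r z) = r ^+ 2 * dotp z z.
Proof.
by rewrite /dotp mulr_sumr; apply: eq_bigr => i _; rewrite !tnth_mktuple; ring.
Qed.

Lemma enorm_scalet n (r : R) (z : n.-tuple R) : 0 <= r ->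
  enorm (scalet r z) = r * enorm z.
Proof. by move=> r0; rewrite /enorm dotp_scalet sqrtrM ?sqr_ge0// sqrtr_sqr ger0_norm. Qed.

Lemma normalize_scalet n (r : R) (z : n.-tuple R) : 0 < r ->
  normalize (scalet r z) = normalize z.
Proof.
move=> r0; apply/eq_from_tnth => i; rewrite !tnth_mktuple enorm_scalet ?ltW//.
by rewrite -mulf_div divff ?mul1r// gt_eqF.
Qed.

(** The origin is excluded because [normalize] sends it to the zero vector, which is not a
    direction. *)
Definition cone n (A : set (n.-tuple R)) : set (n.-tuple R) :=
  [set z | A (normalize z)] `&` [set z | 0 < enorm z].

Lemma measurable_enorm_gt0 n : measurable [set z : n.-tuple R | 0 < enorm z].
Proof.
rewrite (_ : mkset _ = enorm @^-1` `]0, +oo[%classic).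
  by rewrite -[X in measurable X]setTI; apply: measurable_enorm.
by apply/seteqP; split => x /=; rewrite in_itv /= andbT.
Qed.

Lemma measurable_cone n (A : set (n.-tuple R)) : measurable A -> measurable (cone A).
Proof.
move=> mA; apply: measurableI; last exact: measurable_enorm_gt0.
by rewrite -[X in measurable X]setTI; apply: measurable_normalize.
Qed.

Lemma cone_scalet n (A : set (n.-tuple R)) (r : R) (z : n.-tuple R) : 0 < r ->
  cone A (scalet r z) = cone A z.
Proof.
move=> r0; rewrite /cone /= /setI /= normalize_scalet// enorm_scalet ?ltW//.
by rewrite pmulr_rgt0.
Qed.

Lemma measurable_natr_bool d (T : measurableType d) (b : T -> bool) :
  measurable_fun setT b -> measurable_fun setT (fun x => (b x)%:R : R).
Proof.
move=> mb; rewrite (_ : (fun _ => _) = fun x => if b x then 1 else 0 : R).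
  exact: measurable_fun_ifT.
by apply/funext => x; case: (b x).
Qed.

(* Layer cake: [exp (- |z|^2 / 2)] is the measure of the [y] in [(0, 1)] with
   [|z| < sqrt (- 2 ln y)], and the part of a cone in the ball of radius [r] has
   [r ^ n] times the volume of its part in the unit ball. *)
Definition layer_weight n (y : R) : R :=
  if 0 < y < 1 then Num.sqrt (- (2 * ln y)) ^+ n else 0.

Lemma measurable_layer_weight n : measurable_fun setT (layer_weight n).
Proof.
rewrite (_ : layer_weight n = fun y => \1_(`]0, 1[%classic : set R) y *
    Num.sqrt (- (2 * ln y)) ^+ n).
  apply: measurable_funM; first exact: measurable_indic.
  apply: measurable_funX; apply: measurableT_comp.
    by apply: continuous_measurable_fun; exact: sqrt_continuous.
  apply: measurableT_comp => //; apply: measurable_funM => //; exact: measurable_ln.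
apply/funext => y; rewrite /layer_weight indicE mem_setE in_itv /=.
by case: ifP => _; rewrite ?mul1r ?mul0r.
Qed.

Lemma lebesgue_layer n (A : set (n.-tuple R)) (y : R) : measurable A ->
  (\int[lebesgue_tuple n]_z
    (\1_(cone A) z * (0 < y <= expR (- (dotp z z / 2)))%R%:R)%:E =
   (layer_weight n y)%:E * lebesgue_tuple n (cone A `&` punctured_ball R n))%E.
Proof.
move=> mA; rewrite /layer_weight.
(* For [y >= 1] only the origin could satisfy [y <= exp (- |z|^2 / 2)], and a cone does not contain
   it. *)
have z0 z : y <= 0 \/ 1 <= y ->
    (\1_(cone A) z * (0 < y <= expR (- (dotp z z / 2)))%R%:R : R) = 0.
  move=> h; rewrite indicE; have [|] := boolP (z \in cone A); last by rewrite mul0r.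
  rewrite inE => -[_ /= nz]; rewrite mul1r; case: h => y1.
    by rewrite ltNge y1.
  have : expR (- (dotp z z / 2)) < 1.
    by rewrite expR_lt1 oppr_lt0 divr_gt0// -enorm_sqr exprn_gt0.
  by move=> /lt_le_trans /(_ y1); rewrite ltNge => /negbTE ->; rewrite andbF.
case: ifPn => [/andP[y0 y1]|]; last first.
  rewrite negb_and -!leNgt => /orP h; under eq_integral do rewrite z0//.
  by rewrite integral0 mul0e.
have ly : ln y < 0 by rewrite ln_lt0// y0.
(* The radius at which the Gaussian weight equals [y]: after substituting [rho * z] for [z], the
   level condition becomes [|z| <= 1], and the Jacobian is [rho ^+ n]. *)
pose rho := Num.sqrt (- (2 * ln y)).
have rho0 : 0 < rho by rewrite sqrtr_gt0; lra.
have rho2 : rho ^+ 2 = - (2 * ln y) by rewrite sqr_sqrtr//; lra.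
rewrite -/rho -(ge0_integral_lebesgue_tuple_scale rho0); last 2 first.
- apply/measurable_EFinP; apply: measurable_funM.
    by apply: measurable_indic; exact: measurable_cone.
  rewrite y0 /=; apply: measurable_natr_bool.
  apply: measurable_fun_ler => //; apply: measurableT_comp => //.
  apply: measurableT_comp => //; apply: measurable_funM => //.
  exact: measurable_sqnorm.
- by move=> z; rewrite lee_fin mulr_ge0// ler0n.
congr (_ * _)%E.
transitivity (\int[lebesgue_tuple n]_z (\1_(cone A `&` punctured_ball R n) z)%:E)%E; last first.
  rewrite integral_indic ?setIT//.
  by apply: measurableI; [exact: measurable_cone|exact: measurable_punctured_ball].
apply: eq_integral => z _; congr EFin.
rewrite !indicE (_ : (scalet rho z \in cone A) = (z \in cone A)); last first.
  by apply/idP/idP; rewrite !inE cone_scalet.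
have [zA|zA] := boolP (z \in cone A); last first.
  rewrite mul0r (_ : (z \in _) = false)//; apply/negbTE; apply: contra zA.
  by rewrite !inE => -[].
rewrite mul1r (_ : (z \in cone A `&` punctured_ball R n) = (enorm z <= 1)); last first.
  apply/idP/idP; rewrite inE; first by case=> _ /andP[].
  by move=> z1; move: zA; rewrite inE => zA; split => //; apply/andP; split => //; case: zA.
rewrite y0 dotp_scalet rho2 /=; congr (_ %:R); congr nat_of_bool.
rewrite -{1}(lnK y0) ler_expR.
rewrite (_ : - (- (2 * ln y) * dotp z z / 2) = ln y * dotp z z); last by field.
rewrite -[X in X <= _]mulr1 ler_nM2l// -enorm_sqr.
by rewrite expr_le1// enorm_ge0.
Qed.

(** Tonelli exchanges [z] with the layer height [y]. What matters is that the factor in front of the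
    volume does not depend on [A]; its value is found later from the total mass. *)
Lemma gauss_cone n (A : set (n.-tuple R)) : measurable A ->
  (gauss n (cone A) = ((normal_peak 1 ^+ n)%:E * \int[mu]_y (layer_weight n y)%:E) *
    lebesgue_tuple n (cone A `&` punctured_ball R n))%E.
Proof.
move=> mA; have mC := measurable_cone mA.
transitivity (\int[gauss n]_z (\1_(cone A) z)%:E)%E.
  by rewrite integral_indic// setIT.
rewrite ge0_integral_gauss//; last first.
  by apply/measurable_EFinP; exact: measurable_indic.
have me : measurable_fun setT (fun z : n.-tuple R => expR (- (dotp z z / 2))).
  apply: measurableT_comp => //; apply: measurableT_comp => //.
  by apply: measurable_funM => //; exact: measurable_sqnorm.
under eq_integral do rewrite -EFinM /gauss_density mulrCA EFinM.
rewrite ge0_integralZl//; last 2 first.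
- by apply/measurable_EFinP; apply: measurable_funM => //; exact: measurable_indic.
- by rewrite lee_fin exprn_ge0// normal_peak_ge0.
rewrite -muleA; congr (_ * _)%E.
pose F (p : n.-tuple R * measurableTypeR R) : \bar R :=
  (\1_(cone A) p.1 * (0 < p.2 <= expR (- (dotp p.1 p.1 / 2)))%R%:R)%:E.
have mF : measurable_fun setT F.
  apply/measurable_EFinP; apply: measurable_funM.
    have mI : measurable_fun setT (\1_(cone A) : n.-tuple R -> R) by exact: measurable_indic.
    exact: (measurableT_comp mI measurable_fst).
  apply: measurable_natr_bool.
  apply: measurable_and.
    by apply: measurable_fun_ltr => //; exact: measurable_snd.
  apply: measurable_fun_ler; first exact: measurable_snd.
  exact: (measurableT_comp me measurable_fst).
have F0 p : (0 <= F p)%E by rewrite lee_fin mulr_ge0.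
transitivity (\int[lebesgue_tuple n]_z \int[mu]_y F (z, y))%E.
  apply: eq_integral => z _; rewrite /F /=.
  rewrite -[in LHS](mulr1 (\1_(cone A) z)).
  under [RHS]eq_integral do rewrite EFinM.
  rewrite ge0_integralZl//; last first.
    apply/measurable_EFinP; apply: measurable_natr_bool.
    apply: measurable_and; first exact: measurable_fun_ltr.
    exact: measurable_fun_ler.
  rewrite mulr1 EFinM; congr (_ * _)%E.
  transitivity (mu `]0%R, (expR (- (dotp z z / 2)))]%classic).
    by rewrite lebesgue_measure_itv /= lte_fin expR_gt0 oppr0 adde0.
  transitivity (\int[mu]_y (\1_(`]0%R, (expR (- (dotp z z / 2)))]%classic) y)%:E)%E.
    by rewrite integral_indic// setIT.
  by apply: eq_integral => y _; rewrite indicE mem_setE in_itv.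
rewrite (fubini_tonelli F)//.
under eq_integral do rewrite /F /= lebesgue_layer//.
rewrite ge0_integralZr//.
- by apply/measurable_EFinP; exact: measurable_layer_weight.
- by move=> y _; rewrite lee_fin /layer_weight; case: ifP => // _; rewrite exprn_ge0// sqrtr_ge0.
Qed.

(** The origin lies in the hyperplane where the first coordinate vanishes, which is null because a
    normal law has no atom at 0. *)
Lemma gauss_enorm_eq0 n : (0 < n)%N ->
  gauss n (~` [set z : n.-tuple R | 0 < enorm z]) = 0%E.
Proof.
case: n => // n _.
have m0 := @measurable_enorm_gt0 n.+1.
pose D := [set z : n.+1.-tuple R | tnth z ord0 = 0].
  have mD : measurable D.
    rewrite (_ : D = (fun z => tnth z ord0) @^-1` [set 0]); last by [].
    by rewrite -[X in measurable X]setTI; apply: measurable_tnth.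
  apply/eqP; rewrite -measure_le0; apply: (@le_trans _ _ (gauss n.+1 D)).
    apply: le_measure; rewrite ?inE//; first exact: measurableC.
    move=> z /= /negP; rewrite -leNgt => z0; rewrite /D /=.
    have : dotp z z <= 0 by rewrite -enorm_sqr; have := enorm_ge0 z; nra.
    rewrite /dotp big_ord_recl => h; apply/eqP; rewrite -sqrf_eq0 expr2 eq_le.
    have h2 : 0 <= \sum_(i < n) tnth z (lift ord0 i) * tnth z (lift ord0 i).
      by apply: sumr_ge0 => i _; rewrite -expr2 sqr_ge0.
    by rewrite -!expr2 sqr_ge0 andbT expr2; lra.
  have E : @consTR R n @^-1` D = [set 0] `*` setT.
    apply/seteqP; split => -[x t] /=; rewrite /D /= /consTR /consT /= tnth0.
      by move=> ->.
    by case.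
  rewrite [leLHS](_ : _ = (gauss1 R \x gauss n)%E (@consTR R n @^-1` D))// E.
  by rewrite product_measure1E// [X in (X * _)%E]gauss1_set0 mul0e.
Qed.

Lemma gauss_setI_enorm_gt0 n (B : set (n.-tuple R)) : (0 < n)%N -> measurable B ->
  gauss n (B `&` [set z | 0 < enorm z]) = gauss n B.
Proof.
move=> n0 mB; have m0 := @measurable_enorm_gt0 n.
rewrite [RHS](measureDI (gauss n) mB m0).
rewrite [X in (X + _)%E](_ : _ = 0%E) ?add0e//.
apply/eqP; rewrite -measure_le0 -(gauss_enorm_eq0 n0).
apply: le_measure; rewrite ?inE//; first exact: measurableD.
  exact: measurableC.
Qed.

Lemma gauss_enorm_gt0 n : (0 < n)%N -> gauss n [set z : n.-tuple R | 0 < enorm z] = 1%E.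
Proof.
by move=> n0; rewrite -(setTI (mkset _)) gauss_setI_enorm_gt0//; exact: probability_setT.
Qed.

(** Both sides are proportional to the volume of the part of the cone inside the unit ball, and both
    give mass 1 to the full cone, which identifies the factors. *)
Lemma gauss_uniform_sphere n (A : set (n.-tuple R)) : (0 < n)%N -> measurable A ->
  uniform_sphere n A = gauss n (cone A).
Proof.
move=> n0 mA; rewrite uniform_sphereE// gauss_cone//.
have v0 := @ball_volume_gt0 R n n0; have vy := @ball_volume_lty R n.
have vf : lebesgue_tuple n (punctured_ball R n) \is a fin_num.
  by rewrite ge0_fin_numE// ltW.
have := @gauss_cone n setT measurableT.
have -> : cone setT = [set z : n.-tuple R | 0 < enorm z] by rewrite /cone setTI.
rewrite gauss_enorm_gt0// (_ : _ `&` punctured_ball R n = punctured_ball R n); last first.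
  by apply/setIidr => z /= /andP[].
have -> : cone A `&` punctured_ball R n = [set x | A (normalize x)] `&` punctured_ball R n.
  apply/seteqP; split => z [] /=; first by case.
  by move=> Az /andP[z0 z1]; split => //; apply/andP.
set c := (X in (X * lebesgue_tuple n (punctured_ball R n))%E).
move=> c1; rewrite muleC; congr (_ * _)%E.
have VV : (lebesgue_tuple n (punctured_ball R n) *
    (fine (lebesgue_tuple n (punctured_ball R n)))^-1%:E = 1)%E.
  by rewrite -[X in (X * _)%E]fineK// -EFinM divff// gt_eqF// fine_gt0// v0.
by rewrite -[RHS]mule1 -VV muleA -c1 mul1e.
Qed.

(* [h] is typically a supremum over an uncountable family, whence the
   absence of any measurability hypothesis on it. *)
Lemma uniform_sphere_integral_le n (h K : n.-tuple R -> \bar R) : (0 < n)%N ->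
  (forall z, 0 <= h z)%E -> measurable_fun setT K -> (forall z, 0 <= K z)%E ->
  (forall z, (0 < enorm z)%R -> (h (normalize z) <= K z)%E) ->
  (\int[uniform_sphere n]_z h z <= \int[gauss n]_z K z)%E.
Proof.
move=> n0 h0 mK K0 hK; apply: (ge0_integral_pushforward_le measurable_normalize) => //.
- move=> A mA; apply: etrans (gauss_uniform_sphere n0 mA) _; rewrite /cone.
  have mN : measurable ((@normalize R n) @^-1` A).
    by rewrite -[X in measurable X]setTI; exact: measurable_normalize.
  by rewrite gauss_setI_enorm_gt0.
- exists (~` [set z : n.-tuple R | 0 < enorm z]); split.
  + by apply: measurableC; exact: measurable_enorm_gt0.
  + exact: gauss_enorm_eq0.
  + by move=> z /=; apply: contra_not => /hK.
Qed.

End polar.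

(** * Smoothing *)

Section smoothing.
Context {R : realType}.
Notation gauss1 := (gauss1 R).

(** Monotonicity gives [F x <= F (x + 2 / t - u / t)] for [|u| <= 2], while [G] moves by at most
    [e = q + L * (4 / t)] over such a window. For the other [u], of Gaussian mass at most [1 / 4],
    only the supremum [D] of the distance is available. The result is [D <= 4 / 3 * S + e + D / 3],
    and the last summand is absorbed on the left. *)
Lemma desmoothing (F G : R -> R) (S L q t : R) :
  0 < t -> 0 <= L -> 0 <= q ->
  measurable_fun setT F -> measurable_fun setT G ->
  (forall x, 0 <= F x <= 1) -> (forall x, 0 <= G x <= 1) ->
  {homo F : x y / x <= y} -> {homo G : x y / x <= y} ->
  (forall x y, x <= y -> G y - G x <= q + L * (y - x)) ->
  (forall x, `|\int[gauss1]_u F (x - u / t) - \int[gauss1]_u G (x - u / t)| <= S) ->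
  forall x, `|F x - G x| <= 2 * S + 2 * (q + L * (4 / t)).
Proof.
move=> t0 L0 q0 mF mG F01 G01 ndF ndG GL HS.
set e := q + L * (4 / t).
have p2 : 0 < 2 / t by rewrite divr_gt0.
have e0 : 0 <= e by rewrite addr_ge0// mulr_ge0// divr_ge0// ltW.
pose D := sup [set `|F x - G x| | x in setT].
have ub1 : ubound [set `|F x - G x| | x in setT] 1.
  move=> _ [x _ <-]; have /andP[? ?] := F01 x; have /andP[? ?] := G01 x.
  by rewrite ler_norml; lra.
have hs : has_sup [set `|F x - G x| | x in setT].
  by split; [exists `|F 0 - G 0|; exists 0|exists 1].
have leD x : `|F x - G x| <= D.
  by apply: ub_le_sup; [case: hs|exists x].
have D0 : 0 <= D by apply: le_trans (leD 0).
have msh (H : R -> R) (x : R) : measurable_fun setT H ->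
    measurable_fun setT (fun u : R => H (x - u / t)).
  move=> mH; apply: measurableT_comp => //.
  by apply: measurable_funB => //; exact: measurable_funM.
have ish (H : R -> R) (x : R) : measurable_fun setT H -> (forall x, 0 <= H x <= 1) ->
    gauss1.-integrable setT (EFin \o (fun u : R => H (x - u / t))).
  move=> mH H01; apply: (@gauss1_bounded_integrable _ _ 1) => [|u]; first exact: msh.
  by have /andP[h0 h1] := H01 (x - u / t); rewrite ger0_norm.
have i1 : gauss1.-integrable setT (EFin \o (fun u : R => u ^+ 2)).
  exact: sqr_gauss1_integrable.
have ic (c : R) : gauss1.-integrable setT (EFin \o (fun u : R => c)).
  exact: finite_measure_integrable_cst.
(* the bound is applied to the pair (F, G) and to (- G, - F) *)
have key (A B : R -> R) (d : R) :
    gauss1.-integrable setT (EFin \o A) -> gauss1.-integrable setT (EFin \o B) ->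
    `|\int[gauss1]_u A u - \int[gauss1]_u B u| <= S ->
    (forall u : R, `|u| <= 2 -> d - e <= A u - B u) -> (forall u, - D <= A u - B u) ->
    d <= 4 / 3 * S + e + D / 3.
  move=> iA iB ABS h1 h2.
  have S0 : 0 <= S by apply: le_trans ABS.
  have [de|de] := leP (d - e + D) 0; first lra.
  (* Chebyshev: [1 - u^2 / 4] is a lower bound for the indicator of [|u| <= 2]. *)
  have : \int[gauss1]_u ((d - e) + (- ((d - e + D) / 4)) * u ^+ 2) <=
      \int[gauss1]_u (A u - B u).
    apply: le_Rintegral => //.
    - apply: eq_integrable (integrableD measurableT (ic (d - e)) (integrableZl measurableT (- ((d - e + D) / 4)) i1)) => //.
    - exact: eq_integrable (integrableB measurableT iA iB).
    - move=> u _; have [u2|u2] := leP `|u| 2.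
        have := h1 u u2; have := sqr_ge0 u; nra.
      have := h2 u; have : 4 <= u ^+ 2 by rewrite -real_normK ?num_real//; nra.
      nra.
  rewrite RintegralB// RintegralD//; last first.
    exact: (integrableZl measurableT (- ((d - e + D) / 4)) i1).
  rewrite RintegralZl// gauss1_sqr Rintegral_cstT => h3.
  have := ler_norm (\int[gauss1]_u A u - \int[gauss1]_u B u); lra.
have h2t u : `|u| <= 2 -> - (2 / t) <= u / t <= 2 / t.
  move=> u2; rewrite -ler_norml normrM normfV (gtr0_norm t0).
  by rewrite ler_pM2r// invr_gt0.
have eE : e = q + L * (2 / t + 2 / t) by rewrite /e; congr (_ + _ * _); field; rewrite gt_eqF.
have fin x : `|F x - G x| <= 4 / 3 * S + e + D / 3.
  rewrite ler_norml; apply/andP; split.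
    rewrite lerNl opprB.
    apply: (key (fun u => G (x - 2 / t - u / t)) (fun u => F (x - 2 / t - u / t)) _).
    - exact: ish.
    - exact: ish.
    - by rewrite distrC.
    - move=> u /h2t /andP[u1 u2].
      have : F (x - 2 / t - u / t) <= F x by apply: ndF; lra.
      have : G (x - (2 / t + 2 / t)) <= G (x - 2 / t - u / t) by apply: ndG; lra.
      have xx : x - (2 / t + 2 / t) <= x by lra.
      have := GL _ _ xx; rewrite eE (_ : x - (x - _) = 2 / t + 2 / t); [lra|ring].
    - by move=> u; have := leD (x - 2 / t - u / t); rewrite ler_norml; lra.
  apply: (key (fun u => F (x + 2 / t - u / t)) (fun u => G (x + 2 / t - u / t)) _).
  - exact: ish.
  - exact: ish.
  - exact: HS.
  - move=> u /h2t /andP[u1 u2].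
    have : F x <= F (x + 2 / t - u / t) by apply: ndF; lra.
    have : G (x + 2 / t - u / t) <= G (x + (2 / t + 2 / t)) by apply: ndG; lra.
    have xx : x <= x + (2 / t + 2 / t) by lra.
    have := GL _ _ xx; rewrite eE (_ : x + _ - x = 2 / t + 2 / t); [lra|ring].
  - by move=> u; have := leD (x + 2 / t - u / t); rewrite ler_norml; lra.
have De : D <= 4 / 3 * S + e + D / 3.
  apply: ge_sup; first by case: hs.
  by move=> _ [x _ <-]; exact: fin.
by move=> x; apply: (le_trans (leD x)); lra.
Qed.

Context d (T : measurableType d) (P : probability T R) (xi : T -> R).
Hypothesis mxi : measurable_fun setT xi.

Definition rcdf (x : R) : R := fine (P [set w | xi w <= x]).

Lemma measurable_rcdf_set x : measurable [set w | xi w <= x].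
Proof.
rewrite (_ : mkset _ = xi @^-1` `]-oo, x]%classic).
  by rewrite -[X in measurable X]setTI; apply: mxi.
by apply/seteqP; split => w /=; rewrite in_itv.
Qed.

Lemma rcdfE x : P [set w | xi w <= x] = (rcdf x)%:E.
Proof. by rewrite /rcdf fineK// fin_num_measure//; exact: measurable_rcdf_set. Qed.

Lemma rcdf_itv x : 0 <= rcdf x <= 1.
Proof. by rewrite -!lee_fin -rcdfE measure_ge0 probability_le1//; exact: measurable_rcdf_set. Qed.

Lemma rcdf_mono : {homo rcdf : x y / x <= y}.
Proof.
move=> x y xy; rewrite -lee_fin -!rcdfE; apply: le_measure; rewrite ?inE; try exact: measurable_rcdf_set.
by move=> w /= /le_trans; apply.
Qed.

Lemma rcdf_indic x : rcdf x = \int[P]_w (xi w <= x)%R%:R.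
Proof.
rewrite /Rintegral /rcdf; congr fine.
rewrite -[LHS](_ : \int[P]_w (\1_[set w | xi w <= x] w)%:E = _)%E.
  by apply: eq_integral => w _; rewrite indicE mem_setE.
by rewrite integral_indic ?setIT//; exact: measurable_rcdf_set.
Qed.

(** By Fubini, convolution with a normal law of standard deviation [1 / t] acts on the indicator of
    [xi w <= x] alone and turns it into a value of [Phi]. *)
Lemma rcdf_smooth t x : 0 < t ->
  \int[gauss1]_u rcdf (x - u / t) = \int[P]_w Phi (t * (x - xi w)).
Proof.
move=> t0; under eq_Rintegral do rewrite rcdf_indic.
have m1 : measurable_fun setT (fun z : measurableTypeR R * T => (xi z.2 <= x - z.1 / t)%R%:R : R).
  apply: measurable_natr_bool; apply: measurable_fun_ler.
    exact: (measurableT_comp mxi measurable_snd).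
  by apply: measurable_funB => //; apply: measurable_funM => //; exact: measurable_fst.
rewrite (@Rintegral_Fubini_bounded _ _ _ _ _ gauss1 P (fun u w => (xi w <= x - u / t)%R%:R) 1)//; last first.
  by move=> u w; case: (xi w <= x - u / t)%R; rewrite ?normr1 ?normr0.
apply: eq_Rintegral => w _.
rewrite /Rintegral -[RHS]/(fine (Phi _)%:E) -Phi_gauss1; congr fine.
rewrite -[RHS](_ : \int[gauss1]_u (\1_(`]-oo, (t * (x - xi w))%R]%classic) u)%:E = _)%E.
  apply: eq_integral => u _; rewrite indicE mem_setE in_itv /=; congr (_ %:R%:E).
  by rewrite lerBrDl -lerBrDr ler_pdivrMr// mulrC.
by rewrite integral_indic// setIT.
Qed.

Definition re_chf (s : R) : R := \int[P]_w cos (s * xi w).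
Definition im_chf (s : R) : R := \int[P]_w sin (s * xi w).

Lemma integrable_cos_scale s : P.-integrable setT (fun w => (cos (s * xi w))%:E).
Proof.
apply: (@prob_bounded_integrable _ _ _ P (fun w => cos (s * xi w)) 1) => [|w]; last exact: cos_max.
by apply: (measurableT_comp (@measurable_cos R)); exact: measurable_funM.
Qed.

Lemma integrable_sin_scale s : P.-integrable setT (fun w => (sin (s * xi w))%:E).
Proof.
apply: (@prob_bounded_integrable _ _ _ P (fun w => sin (s * xi w)) 1) => [|w]; last exact: sin_max.
by apply: (measurableT_comp (@measurable_sin R)); exact: measurable_funM.
Qed.

Lemma normr_sinc_le (a u : R) : `|sin (a * u) / u| <= `|a|.
Proof.
have [->|y0] := eqVneq u 0; first by rewrite invr0 mulr0 normr0.
by rewrite normrM normfV ler_pdivrMr ?normr_gt0// -normrM normr_sin_le.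
Qed.

Hypothesis ixi : P.-integrable setT (EFin \o xi).

(** The mean of [sin (t * (x - xi w) * u) / u] over [w], expanded by the subtraction formula so that
    the law of [xi] enters through its characteristic function only. *)
Definition sinc_kernel (t x u : R) : R :=
  (sin (t * x * u) * re_chf (t * u) - cos (t * x * u) * im_chf (t * u)) / u.

(** Fubini is applied to the sinc representation of [Phi]; since [|sin (a * u) / u| <= |a|], a first
    moment of [xi] dominates. The constant [c] is a parameter so that two variables can share it. *)
Lemma Phi_smooth_rep (c : R) (t x : R) : 0 < t ->
  (forall y, Phi y = c + normal_peak 1 * \int[gauss1]_u (sin (y * u) / u)) ->
  gauss1.-integrable setT (fun u => (sinc_kernel t x u)%:E) /\
  \int[P]_w Phi (t * (x - xi w)) = c + normal_peak 1 * \int[gauss1]_u sinc_kernel t x u.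
Proof.
move=> t0 PhiE.
pose f (z : measurableTypeR R * T) : R := sin (t * (x - xi z.2) * z.1) / z.1.
have mf : measurable_fun setT f.
  apply: measurable_funM; last exact: (measurableT_comp (@measurable_invr R) measurable_fst).
  apply: (measurableT_comp (@measurable_sin R)); apply: measurable_funM; last exact: measurable_fst.
  apply: measurable_funM => //; apply: measurable_funB => //.
  exact: (measurableT_comp mxi measurable_snd).
have ib : P.-integrable setT (EFin \o (fun w => t * (`|x| + `|xi w|))).
  have i1 : P.-integrable setT (EFin \o (fun w => `|x|)) by exact: finite_measure_integrable_cst.
  have := integrableZl measurableT t (integrableD measurableT i1 (integrable_norm ixi)).
  exact: eq_integrable.
have i1 : gauss1.-integrable setT (EFin \o (fun u : R => 1)) by exact: finite_measure_integrable_cst.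
have fb z : `|f z| <= t * (`|x| + `|xi z.2|).
  rewrite (le_trans (normr_sinc_le _ _))// normrM (gtr0_norm t0) ler_pM2l//.
  exact: ler_normB.
have fi : (gauss1 \x P)%E.-integrable setT (EFin \o f).
  apply: le_integrable (integrable_prod_mul i1 ib) => //; first exact/measurable_EFinP.
  move=> z _; rewrite /= lee_fin mul1r (le_trans (fb z))//; exact: ler_norm.
have fP u : P.-integrable setT (fun w => (f (u, w))%:E).
  apply: le_integrable ib => //.
    by apply/measurable_EFinP; exact: (measurable_sect1 u mf).
  by move=> w _; rewrite /= lee_fin (le_trans (fb (u, w)))//; exact: ler_norm.
have fg w : gauss1.-integrable setT (fun u => (f (u, w))%:E).
  apply: (@gauss1_bounded_integrable _ (fun u => f (u, w)) (t * (`|x| + `|xi w|))).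
    exact: (measurable_sect2 w mf).
  by move=> u; exact: (fb (u, w)).
have kE u : \int[P]_w f (u, w) = sinc_kernel t x u.
  rewrite /sinc_kernel /f /=.
  under eq_Rintegral => w _.
    rewrite (_ : t * (x - xi w) * u = t * x * u - (t * u) * xi w); last by ring.
    rewrite sinB mulrBl (mulrAC (sin _)) (mulrAC (cos _)).
    over.
  have a1 := integrableZl measurableT (sin (t * x * u) / u) (integrable_cos_scale (t * u)).
  have a2 := integrableZl measurableT (cos (t * x * u) / u) (integrable_sin_scale (t * u)).
  rewrite RintegralB// !RintegralZl//; try exact: integrable_cos_scale; try exact: integrable_sin_scale.
  by rewrite /re_chf /im_chf mulrBl (mulrAC (sin _)) (mulrAC (cos _)).
split.
  have := integrable_Rintegral1 fi fP.
  by apply: eq_integrable => // u _; rewrite kE.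
under eq_Rintegral do rewrite PhiE.
have i2 : P.-integrable setT (fun w => (\int[gauss1]_u (sin (t * (x - xi w) * u) / u))%:E).
  (* The inner integral is an affine function of a value of [Phi], hence bounded. *)
  apply: (@prob_bounded_integrable _ _ _ P (fun w => \int[gauss1]_u (sin (t * (x - xi w) * u) / u)) ((normal_peak 1)^-1 * (`|c| + 1))).
    have mfs : measurable_fun setT (fun z : T * measurableTypeR R => f (z.2, z.1)).
      exact: (measurableT_comp mf (@measurable_swap _ _ T (measurableTypeR R))).
    exact: (measurable_Rintegral1 gauss1 mfs).
  move=> w; rewrite ler_pdivlMl ?normal_peak_gt0 ?oner_neq0//.
  set I := \int[gauss1]_u _; have E : normal_peak 1 * I = Phi (t * (x - xi w)) - c.
    by rewrite PhiE [c + _]addrC addrK.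
  rewrite -[X in X * _]ger0_norm ?normal_peak_ge0// -normrM E (le_trans (ler_normB _ _))//.
  by rewrite addrC lerD2l ger0_norm ?Phi_ge0 ?Phi_le1.
have i3 : P.-integrable setT (EFin \o (fun w => c)) by exact: finite_measure_integrable_cst.
rewrite RintegralD//; last exact: (integrableZl measurableT (normal_peak 1) i2).
rewrite Rintegral_cstT RintegralZl//; congr (_ + _ * _).
rewrite -(@Rintegral_Fubini _ _ _ _ _ gauss1 P f fi fP fg).
by apply: eq_Rintegral => u _; rewrite kE.
Qed.

End smoothing.

(** The shared constant cancels. The point [x] enters the remaining integrand through a sine and a
    cosine only; bounding them by 1 makes the estimate uniform in [x]. The bound is an extended
    real, ready for Tonelli. *)
Lemma Phi_smooth_diff (R : realType) d (T : measurableType d) (P : probability T R) (xi : T -> R)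
    d' (U : measurableType d') (Q : probability U R) (eta : U -> R) (t x : R) :
  0 < t -> measurable_fun setT xi -> measurable_fun setT eta ->
  P.-integrable setT (EFin \o xi) -> Q.-integrable setT (EFin \o eta) ->
  (`|\int[P]_w Phi (t * (x - xi w)) - \int[Q]_w Phi (t * (x - eta w))|%:E <=
   \int[gauss1 R]_u
     ((`|re_chf P xi (t * u) - re_chf Q eta (t * u)| + `|im_chf P xi (t * u) - im_chf Q eta (t * u)|)
       / `|u|)%:E)%E.
Proof.
move=> t0 mxi meta ixi ieta; have [c PhiE] := Phi_sinc R.
have [k1 ->] := Phi_smooth_rep mxi ixi x t0 PhiE.
have [k2 ->] := Phi_smooth_rep meta ieta x t0 PhiE.
rewrite opprD addrACA subrr add0r -mulrBr -RintegralB//.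
have k12 := integrableB measurableT k1 k2.
rewrite normrM (ger0_norm (normal_peak_ge0 _)).
apply: (@le_trans _ _ `|\int[gauss1 R]_u (sinc_kernel P xi t x u - sinc_kernel Q eta t x u)|%:E).
  by rewrite lee_fin ler_piMl// normal_peak1_le1.
rewrite EFin_normr_Rintegral//.
apply: le_trans (le_abse_integral _ _ _) _ => //.
  by case/integrableP : k12.
apply: ge0_le_integral_measurable_ub => u; first exact: abse_ge0.
rewrite /= lee_fin /sinc_kernel -mulrBl normrM normfV ler_wpM2r ?invr_ge0//.
set a := re_chf P _ _; set b := im_chf P _ _; set a' := re_chf Q _ _; set b' := im_chf Q _ _.
rewrite (_ : _ - _ = sin (t * x * u) * (a - a') - cos (t * x * u) * (b - b')); last by ring.
rewrite (le_trans (ler_normB _ _))// !normrM.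
by rewrite lerD// ler_piMl// ?sin_max ?cos_max.
Qed.

(** * Characteristic functions of the projections *)

Section variance.
Context {R : realType} (n : nat) d (T : measurableType d) (P : probability T R)
  (X : T -> n.-tuple R).
Hypothesis mX : measurable_fun setT X.

Lemma dotp_scalel (s : R) (x z : n.-tuple R) : dotp (scalet s x) z = s * dotp x z.
Proof.
by rewrite /dotp mulr_sumr; apply: eq_bigr => i _; rewrite tnth_mktuple mulrA.
Qed.

Lemma dotp_tsubl (x y z : n.-tuple R) : dotp (tsub x y) z = dotp x z - dotp y z.
Proof.
by rewrite /dotp -sumrB; apply: eq_bigr => i _; rewrite tnth_mktuple mulrBl.
Qed.

Lemma dotp_tsub (x y : n.-tuple R) :
  dotp (tsub x y) (tsub x y) = dotp x x + dotp y y - 2 * dotp x y.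
Proof.
rewrite /dotp mulr_sumr -big_split /= -sumrB; apply: eq_bigr => i _.
by rewrite tnth_mktuple; ring.
Qed.

Lemma gauss_cos_scale (s : R) (x : n.-tuple R) :
  \int[gauss n]_z cos (s * dotp x z) = expR (- (s ^+ 2 * dotp x x / 2)).
Proof.
have [h _] := gauss_cos_sin (scalet s x).
rewrite -dotp_scalet -h; apply: eq_Rintegral => z _; by rewrite dotp_scalel.
Qed.

Lemma gauss_cos_diff (s : R) (x y : n.-tuple R) :
  \int[gauss n]_z cos (s * dotp x z - s * dotp y z) =
  expR (- (s ^+ 2 * dotp (tsub x y) (tsub x y) / 2)).
Proof.
rewrite -gauss_cos_scale; apply: eq_Rintegral => z _.
by rewrite dotp_tsubl mulrBr.
Qed.

Let mXz : measurable_fun setT (fun p : n.-tuple R * T => dotp (X p.2) p.1).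
Proof. by apply: measurable_dotp2 => //; exact: (measurableT_comp mX measurable_snd). Qed.

Let mXw (z : n.-tuple R) : measurable_fun setT (fun w => dotp (X w) z).
Proof. exact: measurable_dotp2. Qed.

Let mX1 : measurable_fun setT (fun p : T * T => X p.1).
Proof. exact: (measurableT_comp mX measurable_fst). Qed.

Let mX2 : measurable_fun setT (fun p : T * T => X p.2).
Proof. exact: (measurableT_comp mX measurable_snd). Qed.

Lemma measurable_tsubX : measurable_fun setT (fun p : T * T => dotp (tsub (X p.1) (X p.2)) (tsub (X p.1) (X p.2))).
Proof.
under eq_fun do rewrite dotp_tsub.
apply: measurable_funB; first by apply: measurable_funD; exact: measurable_dotp2.
by apply: measurable_funM => //; exact: measurable_dotp2.
Qed.

Definition proj_re (s : R) (z : n.-tuple R) : R := re_chf P (fun w => dotp (X w) z) s.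
Definition proj_im (s : R) (z : n.-tuple R) : R := im_chf P (fun w => dotp (X w) z) s.
Definition mix_chf (s : R) : R := \int[P]_w expR (- (s ^+ 2 * dotp (X w) (X w) / 2)).

Lemma measurable_proj_re s : measurable_fun setT (proj_re s).
Proof.
apply: (@measurable_Rintegral1 _ _ _ _ _ P (fun p : n.-tuple R * T => cos (s * dotp (X p.2) p.1))).
by apply: (measurableT_comp (@measurable_cos R)); exact: measurable_funM.
Qed.

Lemma measurable_proj_im s : measurable_fun setT (proj_im s).
Proof.
apply: (@measurable_Rintegral1 _ _ _ _ _ P (fun p : n.-tuple R * T => sin (s * dotp (X p.2) p.1))).
by apply: (measurableT_comp (@measurable_sin R)); exact: measurable_funM.
Qed.

Lemma proj_re_le1 s z : `|proj_re s z| <= 1.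
Proof.
apply: normr_Rintegral_le => [|w]; last exact: cos_max.
by apply: (measurableT_comp (@measurable_cos R)); exact: measurable_funM.
Qed.

Lemma proj_im_le1 s z : `|proj_im s z| <= 1.
Proof.
apply: normr_Rintegral_le => [|w]; last exact: sin_max.
by apply: (measurableT_comp (@measurable_sin R)); exact: measurable_funM.
Qed.

Lemma expRN_le1 (a : R) : 0 <= a -> `|expR (- a)| <= 1.
Proof. by move=> a0; rewrite ger0_norm ?expR_ge0// expR_le1 oppr_le0. Qed.

Lemma half_sqr_ge0 (s b : R) : 0 <= b -> 0 <= s ^+ 2 * b / 2.
Proof. by move=> b0; rewrite divr_ge0// mulr_ge0// sqr_ge0. Qed.

Lemma measurable_gaussweight s : measurable_fun setT (fun w => expR (- (s ^+ 2 * dotp (X w) (X w) / 2))).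
Proof.
apply: measurableT_comp => //; apply: measurableT_comp => //.
by apply: measurable_funM => //; apply: measurable_funM => //; exact: measurable_dotp2.
Qed.

Lemma integrable_gaussweight s :
  P.-integrable setT (EFin \o (fun w => expR (- (s ^+ 2 * dotp (X w) (X w) / 2)))).
Proof.
apply: (@prob_bounded_integrable _ _ _ _ _ 1); first exact: measurable_gaussweight.
by move=> w; rewrite expRN_le1// half_sqr_ge0// dotp_ge0.
Qed.

Lemma integral_proj_re s : \int[gauss n]_z proj_re s z = mix_chf s.
Proof.
rewrite /proj_re /re_chf (@Rintegral_Fubini_bounded _ _ _ _ _ (gauss n) P (fun z w => cos (s * dotp (X w) z)) 1).
- by apply: eq_Rintegral => w _; rewrite gauss_cos_scale.
- by apply: (measurableT_comp (@measurable_cos R)); exact: measurable_funM.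
- by move=> z w; exact: cos_max.
Qed.

Let ic s z := @integrable_cos_scale _ _ _ P _ (mXw z) s.
Let is_ s z := @integrable_sin_scale _ _ _ P _ (mXw z) s.

(** A squared modulus of a characteristic function is a mean over two independent copies, realized
    here as the coordinates of [P \x P]. *)
Lemma sqr_proj_prod s z : proj_re s z ^+ 2 + proj_im s z ^+ 2 =
  \int[(P \x P)%E]_w cos (s * dotp (X w.1) z - s * dotp (X w.2) z).
Proof.
under eq_Rintegral do rewrite cosB.
rewrite RintegralD//; last 2 first.
- exact: (integrable_prod_mul (ic s z) (ic s z)).
- exact: (integrable_prod_mul (is_ s z) (is_ s z)).
by rewrite (Rintegral_prod_mul (ic s z) (ic s z)) (Rintegral_prod_mul (is_ s z) (is_ s z)) !expr2.
Qed.

Let mcosdiff s : measurable_fun setT (fun p : n.-tuple R * (T * T) =>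
  cos (s * dotp (X p.2.1) p.1 - s * dotp (X p.2.2) p.1)).
Proof.
apply: (measurableT_comp (@measurable_cos R)).
by apply: measurable_funB; apply: measurable_funM => //; apply: measurable_dotp2 => //;
  [exact: (measurableT_comp mX1 measurable_snd)|exact: (measurableT_comp mX2 measurable_snd)].
Qed.

Lemma integral_sqr_proj s : \int[gauss n]_z (proj_re s z ^+ 2 + proj_im s z ^+ 2) =
  \int[(P \x P)%E]_w expR (- (s ^+ 2 * dotp (tsub (X w.1) (X w.2)) (tsub (X w.1) (X w.2)) / 2)).
Proof.
under eq_Rintegral do rewrite sqr_proj_prod.
rewrite (@Rintegral_Fubini_bounded _ _ _ _ _ (gauss n) (P \x P)%E
  (fun z w => cos (s * dotp (X w.1) z - s * dotp (X w.2) z)) 1).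
- by apply: eq_Rintegral => w _; rewrite gauss_cos_diff.
- exact: mcosdiff.
- by move=> z w; exact: cos_max.
Qed.

Definition proj_var (s : R) : R :=
  \int[gauss n]_z ((proj_re s z - mix_chf s) ^+ 2 + proj_im s z ^+ 2).

Lemma integrable_sqr_proj s :
  (gauss n).-integrable setT (EFin \o (fun z => proj_re s z ^+ 2 + proj_im s z ^+ 2)).
Proof.
apply: (@gauss_bounded_integrable _ _ _ 2).
  by apply: measurable_funD; apply: measurable_funX; [exact: measurable_proj_re|exact: measurable_proj_im].
move=> z; rewrite ger0_norm ?addr_ge0 ?sqr_ge0//.
have := proj_re_le1 s z; have := proj_im_le1 s z; rewrite !ler_norml; nra.
Qed.

Lemma integrable_proj_re s : (gauss n).-integrable setT (EFin \o (proj_re s)).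
Proof.
by apply: (@gauss_bounded_integrable _ _ _ 1); [exact: measurable_proj_re|exact: proj_re_le1].
Qed.

Lemma proj_varE s : proj_var s = \int[(P \x P)%E]_w
  (expR (- (s ^+ 2 * dotp (tsub (X w.1) (X w.2)) (tsub (X w.1) (X w.2)) / 2)) -
   expR (- (s ^+ 2 * dotp (X w.1) (X w.1) / 2)) * expR (- (s ^+ 2 * dotp (X w.2) (X w.2) / 2))).
Proof.
have i0 c : (gauss n).-integrable setT (EFin \o (fun z : n.-tuple R => c : R)).
  exact: finite_measure_integrable_cst.
have i1 := integrable_sqr_proj s; have i2 := integrable_proj_re s.
have i3 := integrableZl measurableT (- 2 * mix_chf s) i2.
have i4 := integrableD measurableT i3 (i0 (mix_chf s ^+ 2)).
transitivity (\int[gauss n]_z (proj_re s z ^+ 2 + proj_im s z ^+ 2) +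
    \int[gauss n]_z ((- 2 * mix_chf s) * proj_re s z + mix_chf s ^+ 2)).
  rewrite -RintegralD//; apply: eq_Rintegral => z _; ring.
rewrite (RintegralD _ i3 (i0 _))// RintegralZl// Rintegral_cstT integral_proj_re integral_sqr_proj.
rewrite RintegralB//; last 2 first.
- apply: (@prob_bounded_integrable _ _ _ _ _ 1).
    apply: measurableT_comp => //; apply: measurableT_comp => //.
    by apply: measurable_funM => //; apply: measurable_funM => //; exact: measurable_tsubX.
  by move=> w; rewrite expRN_le1// half_sqr_ge0// dotp_ge0.
- exact: (integrable_prod_mul (integrable_gaussweight s) (integrable_gaussweight s)).
rewrite (Rintegral_prod_mul (integrable_gaussweight s) (integrable_gaussweight s)) -/(mix_chf s).
by ring.
Qed.

Definition near_diag : set (T * T) := [set w | enorm (tsub (X w.1) (X w.2)) ^+ 2 <= n%:R / 4].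

Lemma measurable_near_diag : measurable near_diag.
Proof.
rewrite (_ : near_diag = (fun p : T * T => dotp (tsub (X p.1) (X p.2)) (tsub (X p.1) (X p.2))) @^-1`
    `]-oo, (n%:R / 4)]%classic).
  by rewrite -[X in measurable X]setTI; apply: measurable_tsubX.
by apply/seteqP; split => w; rewrite /near_diag /= in_itv /= enorm_sqr.
Qed.

Definition diag_prob : R := fine ((P \x P)%E near_diag).

Lemma diag_probE : (P \x P)%E near_diag = diag_prob%:E.
Proof. by rewrite /diag_prob fineK//; apply: prob_fin_num; exact: measurable_near_diag. Qed.

Lemma diag_prob_ge0 : 0 <= diag_prob.
Proof. by rewrite fine_ge0. Qed.

Lemma integrable_diffweight s : (P \x P)%E.-integrable setT (EFin \o (fun w =>
   expR (- (s ^+ 2 * dotp (tsub (X w.1) (X w.2)) (tsub (X w.1) (X w.2)) / 2)))).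
Proof.
apply: (@prob_bounded_integrable _ _ _ _ _ 1).
  apply: measurableT_comp => //; apply: measurableT_comp => //.
  by apply: measurable_funM => //; apply: measurable_funM => //; exact: measurable_tsubX.
by move=> w; rewrite expRN_le1// half_sqr_ge0// dotp_ge0.
Qed.

(** Off the event [near_diag] the exponent is controlled by [|X - Y|^2 > n / 4]; on it the integrand
    is at most 1. The bound concerns the second moment about zero, because [diag_moment_lb]
    confronts it with a lower bound; it passes to the variance. *)
Lemma sqr_proj_le_diag s : \int[gauss n]_z (proj_re s z ^+ 2 + proj_im s z ^+ 2) <=
  diag_prob + expR (- (s ^+ 2 * n%:R / 8)).
Proof.
rewrite integral_sqr_proj.
have -> : diag_prob = \int[(P \x P)%E]_w (\1_near_diag w).
  by rewrite /Rintegral integral_indic ?setIT//; exact: measurable_near_diag.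
rewrite -[X in _ <= _ + X](Rintegral_cstT (P \x P)%E).
have i1 : (P \x P)%E.-integrable setT (EFin \o (\1_near_diag)).
  apply: (@prob_bounded_integrable _ _ _ _ _ 1).
    by apply: measurable_indic; exact: measurable_near_diag.
  by move=> w; rewrite indicE; case: (w \in _); rewrite ?normr1 ?normr0.
have i2 : (P \x P)%E.-integrable setT (EFin \o (fun=> expR (- (s ^+ 2 * n%:R / 8)))).
  exact: prob_integrable_cst.
have i3 := integrable_diffweight s.
rewrite -RintegralD//; apply: le_Rintegral => //.
  exact: (integrableD measurableT i1 i2).
move=> w _; rewrite indicE; have [wA|wA] := boolP (w \in near_diag).
  have := expRN_le1 (half_sqr_ge0 s (dotp_ge0 (tsub (X w.1) (X w.2)))).
  rewrite (ger0_norm (expR_ge0 _)); have := expR_ge0 (- (s ^+ 2 * n%:R / 8)).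
  by rewrite mulr1n; lra.
rewrite add0r ler_expR lerN2.
have : n%:R / 4 < dotp (tsub (X w.1) (X w.2)) (tsub (X w.1) (X w.2)).
  rewrite ltNge; apply: contra wA => h; rewrite inE /near_diag /= enorm_sqr.
  exact: h.
have := sqr_ge0 s; nra.
Qed.

Lemma proj_var_le_diag s : proj_var s <= diag_prob + expR (- (s ^+ 2 * n%:R / 8)).
Proof.
apply: le_trans (sqr_proj_le_diag s); rewrite proj_varE integral_sqr_proj.
have i4 := integrable_prod_mul (integrable_gaussweight s) (integrable_gaussweight s).
apply: le_Rintegral => //; last by move=> w _; rewrite lerBlDr lerDl mulr_ge0 ?expR_ge0.
  exact: (integrableB measurableT (integrable_diffweight s) i4).
exact: integrable_diffweight.
Qed.

Variable M : R.
(** Here [M] stands for [M_1], with the bound extended from the sphere to all vectors by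
    homogeneity. *)
Hypothesis HM : forall v : n.-tuple R,
  (\int[P]_w `|dotp (X w) v|%:E <= (M * enorm v)%:E)%E.

Lemma dotp_integrable (v : n.-tuple R) : P.-integrable setT (EFin \o (fun w => dotp (X w) v)).
Proof.
apply/integrableP; split; first by apply/measurable_EFinP; exact: mXw.
by apply: le_lt_trans (HM v) _; rewrite ltry.
Qed.

Definition basis_tuple (i : 'I_n) : n.-tuple R := [tuple (j == i)%:R | j < n].

Lemma dotp_basis (x : n.-tuple R) i : dotp x (basis_tuple i) = tnth x i.
Proof.
rewrite /dotp (bigD1 i)//= tnth_mktuple eqxx mulr1 big1 ?addr0// => j ji.
by rewrite tnth_mktuple (negbTE ji) mulr0.
Qed.

Lemma coord_integrable i : P.-integrable setT (EFin \o (fun w => tnth (X w) i)).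
Proof.
by apply: eq_integrable (dotp_integrable (basis_tuple i)) => // w _; rewrite /= dotp_basis.
Qed.

Lemma coord_mul_integrable (g : T -> R) i : measurable_fun setT g -> (forall w, `|g w| <= 1) ->
  P.-integrable setT (EFin \o (fun w => tnth (X w) i * g w)).
Proof.
move=> mg g1; apply: le_integrable (coord_integrable i) => //.
  apply/measurable_EFinP; apply: measurable_funM => //.
  exact: (measurableT_comp (measurable_tnth i) mX).
by move=> w _; rewrite /= lee_fin normrM ler_piMr.
Qed.

(* duality: the vector [a = E (g X)] satisfies [|a|^2 = E (g <X, a>) <= M |a|]. *)
Lemma weighted_mean_le (g : T -> R) : measurable_fun setT g -> (forall w, `|g w| <= 1) ->
  \sum_(i < n) (\int[P]_w (tnth (X w) i * g w)) ^+ 2 <= M ^+ 2.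
Proof.
move=> mg g1; pose a : n.-tuple R := [tuple \int[P]_w (tnth (X w) i * g w) | i < n].
have aE : \sum_(i < n) (\int[P]_w (tnth (X w) i * g w)) ^+ 2 = enorm a ^+ 2.
  by rewrite enorm_sqr /dotp; apply: eq_bigr => i _; rewrite !tnth_mktuple expr2.
have ia : P.-integrable setT (EFin \o (fun w => dotp (X w) a * g w)).
  apply: le_integrable (dotp_integrable a) => //.
    by apply/measurable_EFinP; apply: measurable_funM => //; exact: mXw.
  by move=> w _; rewrite /= lee_fin normrM ler_piMr.
have E : enorm a ^+ 2 = \int[P]_w (dotp (X w) a * g w).
  have ii i := coord_mul_integrable i mg g1.
  under eq_Rintegral.
    move=> w _; rewrite (_ : dotp (X w) a * g w =
      \sum_(i < n) (\int[P]_w (tnth (X w) i * g w)) * (tnth (X w) i * g w)); last first.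
      by rewrite /dotp mulr_suml; apply: eq_bigr => i _; rewrite tnth_mktuple mulrAC mulrC.
    over.
  rewrite Rintegral_bigsum; last by move=> i; exact: integrable_scale.
  by rewrite -aE; apply: eq_bigr => i _; rewrite RintegralZl// expr2.
have aM : enorm a ^+ 2 <= M * enorm a.
  rewrite E; apply: le_trans (ler_norm _) _; apply: le_trans (le_normr_Rintegral _ ia) _ => //.
  rewrite -lee_fin -Rintegral_EFin; last exact: (integrable_norm ia).
  apply: le_trans (HM a); apply: ge0_le_integral => //.
  - apply/measurable_EFinP; apply: measurableT_comp => //.
    by apply: measurable_funM => //; exact: mXw.
  - by apply/measurable_EFinP; apply: measurableT_comp => //; exact: mXw.
  - by move=> w _; rewrite lee_fin normrM ler_piMr.
rewrite aE; have := enorm_ge0 a; move: aM; set e := enorm a => aM e0.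
have [->|en] := eqVneq e 0; first by rewrite expr0n sqr_ge0.
have : e <= M by rewrite -(ler_pM2r (x := e)) ?lt_def ?en// -expr2.
by move=> eM; rewrite ler_pXn2r ?nnegrE// (le_trans e0).
Qed.

Lemma dotp_prod_integrable (g : T * T -> R) : measurable_fun setT g -> (forall w, `|g w| <= 1) ->
  (P \x P)%E.-integrable setT (EFin \o (fun w => dotp (X w.1) (X w.2) * g w)).
Proof.
move=> mg g1.
have i1 : (P \x P)%E.-integrable setT (fun w => \sum_(i < n) (tnth (X w.1) i * tnth (X w.2) i)%:E)%E.
  apply: integrable_sum => // i _.
  exact: (integrable_prod_mul (coord_integrable i) (coord_integrable i)).
apply: le_integrable i1 => //.
  by apply/measurable_EFinP; apply: measurable_funM => //; exact: measurable_dotp2.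
by move=> w _; rewrite /= sumEFin /= lee_fin normrM ler_piMr.
Qed.

(** With independent copies the weighted inner product factors coordinatewise into the squared norm
    of the mean of [g X], to which [weighted_mean_le] applies. *)
Lemma Rintegral_dotp_prod (g : T -> R) : measurable_fun setT g -> (forall w, `|g w| <= 1) ->
  \int[(P \x P)%E]_w (dotp (X w.1) (X w.2) * (g w.1 * g w.2)) =
  \sum_(i < n) (\int[P]_w (tnth (X w) i * g w)) ^+ 2.
Proof.
move=> mg g1; pose h i w := tnth (X w) i * g w.
have ih i : P.-integrable setT (EFin \o h i) by exact: coord_mul_integrable.
have ihh i := integrable_prod_mul (ih i) (ih i).
have E w : dotp (X w.1) (X w.2) * (g w.1 * g w.2) = \sum_(i < n) (h i w.1 * h i w.2).
  by rewrite /dotp mulr_suml; apply: eq_bigr => i _; rewrite /h; ring.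
under eq_Rintegral do rewrite E.
rewrite (Rintegral_bigsum ihh); apply: eq_bigr => i _.
by rewrite (Rintegral_prod_mul (ih i) (ih i)) expr2.
Qed.

(** The exponential couples the two copies. As the Gaussian mean over [z] of
    [cos (s <X, z> - s <Y, z>)], it splits by the subtraction formula into a product of cosines and
    a product of sines. For fixed [z] each product contributes at most [M ^+ 2]. *)
Lemma Rintegral_dotp_gauss s : \int[(P \x P)%E]_w (dotp (X w.1) (X w.2) *
    expR (- (s ^+ 2 * dotp (tsub (X w.1) (X w.2)) (tsub (X w.1) (X w.2)) / 2))) <= 2 * M ^+ 2.
Proof.
pose f (z : n.-tuple R) (w : T * T) :=
  dotp (X w.1) (X w.2) * cos (s * dotp (X w.1) z - s * dotp (X w.2) z).
have mf : measurable_fun setT (fun p : n.-tuple R * (T * T) => f p.1 p.2).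
  apply: measurable_funM; last exact: mcosdiff.
  by apply: measurable_dotp2; [exact: (measurableT_comp mX1 measurable_snd)|
    exact: (measurableT_comp mX2 measurable_snd)].
have i0 : (P \x P)%E.-integrable setT (EFin \o (fun w => dotp (X w.1) (X w.2))).
  have n1 (w : T * T) : `|1 : R| <= 1 by rewrite normr1.
  have := dotp_prod_integrable (measurable_cst (1 : R)) n1.
  by apply: eq_integrable => // w _; rewrite /= mulr1.
have fi : (gauss n \x (P \x P))%E.-integrable setT (EFin \o (fun p => f p.1 p.2)).
  have i1 : (gauss n).-integrable setT (EFin \o (fun=> 1 : R)) by exact: prob_integrable_cst.
  apply: le_integrable (integrable_prod_mul i1 i0) => //; first exact/measurable_EFinP.
  by move=> p _; rewrite /= lee_fin mul1r normrM ler_piMr// cos_max.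
have f1 z : (P \x P)%E.-integrable setT (fun w => (f z w)%:E).
  apply: le_integrable i0 => //.
    by apply/measurable_EFinP; exact: (measurable_sect1 z mf).
  by move=> p _; rewrite /= lee_fin normrM ler_piMr// cos_max.
have f2 w : (gauss n).-integrable setT (fun z => (f z w)%:E).
  apply: (@gauss_bounded_integrable _ _ _ `|dotp (X w.1) (X w.2)|).
    exact: (measurable_sect2 w mf).
  by move=> z; rewrite normrM ler_piMr// cos_max.
have -> : \int[(P \x P)%E]_w (dotp (X w.1) (X w.2) *
    expR (- (s ^+ 2 * dotp (tsub (X w.1) (X w.2)) (tsub (X w.1) (X w.2)) / 2))) =
    \int[(P \x P)%E]_w \int[gauss n]_z f z w.
  apply: eq_Rintegral => w _; rewrite -gauss_cos_diff -RintegralZl//.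
  apply: (@gauss_bounded_integrable _ _ _ 1) => [|z]; last exact: cos_max.
  exact: (measurable_sect2 w (mcosdiff s)).
rewrite -(@Rintegral_Fubini _ _ _ _ _ (gauss n) (P \x P)%E (fun p => f p.1 p.2) fi f1 f2) /=.
have cm z : measurable_fun setT (fun w => cos (s * dotp (X w) z)).
  by apply: (measurableT_comp (@measurable_cos R)); exact: measurable_funM.
have sm z : measurable_fun setT (fun w => sin (s * dotp (X w) z)).
  by apply: (measurableT_comp (@measurable_sin R)); exact: measurable_funM.
have c1 z w : `|cos (s * dotp (X w) z)| <= 1 by exact: cos_max.
have s1 z w : `|sin (s * dotp (X w) z)| <= 1 by exact: sin_max.
have fz z : \int[(P \x P)%E]_w f z w <= 2 * M ^+ 2.
  have := weighted_mean_le (cm z) (c1 z); have := weighted_mean_le (sm z) (s1 z).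
  rewrite -!Rintegral_dotp_prod// => h1 h2.
  have -> : \int[(P \x P)%E]_w f z w =
    \int[(P \x P)%E]_w (dotp (X w.1) (X w.2) * (cos (s * dotp (X w.1) z) * cos (s * dotp (X w.2) z))) +
    \int[(P \x P)%E]_w (dotp (X w.1) (X w.2) * (sin (s * dotp (X w.1) z) * sin (s * dotp (X w.2) z))).
    rewrite -RintegralD//.
    - by apply: eq_Rintegral => w _; rewrite /f cosB mulrDr.
    - apply: dotp_prod_integrable.
        by apply: measurable_funM; [exact: (measurableT_comp (cm z) measurable_fst)|
          exact: (measurableT_comp (cm z) measurable_snd)].
      by move=> w; rewrite normrM mulr_ile1 ?cos_max.
    - apply: dotp_prod_integrable.
        by apply: measurable_funM; [exact: (measurableT_comp (sm z) measurable_fst)|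
          exact: (measurableT_comp (sm z) measurable_snd)].
      by move=> w; rewrite normrM mulr_ile1 ?sin_max.
  lra.
rewrite -[leRHS](Rintegral_cstT (gauss n)); apply: le_Rintegral => //.
- exact: (integrable_Rintegral1 fi f1).
- exact: prob_integrable_cst.
Qed.

(* The Poincare inequality for [z |-> E exp (i s <X, z>)] under the Gaussian
   measure reduces to the pointwise bound [exp a - 1 <= a exp a]. *)
Lemma proj_var_le_moment s : proj_var s <= 2 * s ^+ 2 * M ^+ 2.
Proof.
rewrite proj_varE.
have i3 := integrable_diffweight s.
have i4 := integrable_prod_mul (integrable_gaussweight s) (integrable_gaussweight s).
have i5 : (P \x P)%E.-integrable setT (EFin \o (fun w => dotp (X w.1) (X w.2) *
    expR (- (s ^+ 2 * dotp (tsub (X w.1) (X w.2)) (tsub (X w.1) (X w.2)) / 2)))).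
  apply: dotp_prod_integrable; first by case/integrableP: i3 => /measurable_EFinP.
  by move=> w; rewrite expRN_le1// half_sqr_ge0// dotp_ge0.
rewrite (_ : 2 * s ^+ 2 * M ^+ 2 = s ^+ 2 * (2 * M ^+ 2)); last by ring.
apply: le_trans (ler_wpM2l (sqr_ge0 s) (Rintegral_dotp_gauss s)).
rewrite -RintegralZl//; apply: le_Rintegral => //.
- exact: (integrableB measurableT i3 i4).
- exact: (integrableZl measurableT (s ^+ 2) i5).
move=> w _; rewrite -expRD.
set x := X w.1; set y := X w.2; set E := expR (- (s ^+ 2 * dotp (tsub x y) _ / 2)).
have -> : - (s ^+ 2 * dotp x x / 2) - s ^+ 2 * dotp y y / 2 =
    - (s ^+ 2 * dotp (tsub x y) (tsub x y) / 2) + (- (s ^+ 2 * dotp x y)).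
  by rewrite dotp_tsub; field.
rewrite expRD -/E; have := expR_ge1Dx (- (s ^+ 2 * dotp x y)); have := expR_gt0 (- (s ^+ 2 * dotp (tsub x y) (tsub x y) / 2)).
by rewrite -/E; nra.
Qed.

Lemma integrable_proj_abs s : (gauss n).-integrable setT
  (EFin \o (fun z => `|proj_re s z - mix_chf s| + `|proj_im s z|)).
Proof.
apply: (@gauss_bounded_integrable _ _ _ (2 + `|mix_chf s|)).
  apply: measurable_funD; apply: measurableT_comp => //; last exact: measurable_proj_im.
  by apply: measurable_funB => //; exact: measurable_proj_re.
move=> z; rewrite ger0_norm ?addr_ge0//.
have := proj_re_le1 s z; have := proj_im_le1 s z; have := ler_normB (proj_re s z) (mix_chf s); lra.
Qed.

(** Cauchy-Schwarz in additive form: [|a| <= c / 2 + a^2 / (2 c)] for every [c > 0], summed over the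
    real and imaginary parts. The choice [c = b] gives [b + b / 2]; for [b = 0], [c] tends to 0. *)
Lemma proj_abs_le s (b : R) : 0 <= b -> proj_var s <= b ^+ 2 ->
  \int[gauss n]_z (`|proj_re s z - mix_chf s| + `|proj_im s z|) <= 3 / 2 * b.
Proof.
move=> b0 Vb.
have key c : 0 < c -> \int[gauss n]_z (`|proj_re s z - mix_chf s| + `|proj_im s z|) <=
    c + (2 * c)^-1 * b ^+ 2.
  move=> c0.
  have i1 : (gauss n).-integrable setT (EFin \o (fun z =>
      (proj_re s z - mix_chf s) ^+ 2 + proj_im s z ^+ 2)).
    apply: (@gauss_bounded_integrable _ _ _ ((1 + `|mix_chf s|) ^+ 2 + 1)).
      apply: measurable_funD; apply: measurable_funX; last exact: measurable_proj_im.
      by apply: measurable_funB => //; exact: measurable_proj_re.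
    move=> z; rewrite ger0_norm ?addr_ge0 ?sqr_ge0//; apply: lerD.
      rewrite -real_normK ?num_real// ler_pXn2r ?nnegrE ?addr_ge0//.
      by rewrite (le_trans (ler_normB _ _))// lerD2r proj_re_le1.
    by rewrite -real_normK ?num_real// expr_le1// proj_im_le1.
  apply: (@le_trans _ _ (c + (2 * c)^-1 * proj_var s)); last first.
    by rewrite lerD2l ler_wpM2l// invr_ge0 mulr_ge0// ltW.
  rewrite -[X in _ <= X + _](Rintegral_cstT (gauss n)) /proj_var -RintegralZl// -RintegralD//; last 2 first.
  - exact: prob_integrable_cst.
  - exact: integrable_scale.
  apply: le_Rintegral => //; first exact: integrable_proj_abs.
    exact: (integrableD measurableT (prob_integrable_cst (gauss n) c) (integrable_scale _ i1)).
  move=> z _.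
  have ag (a : R) : `|a| <= c / 2 + (2 * c)^-1 * a ^+ 2.
    rewrite -(ler_pM2l (x := 2 * c)); last by rewrite mulr_gt0.
    rewrite mulrDr (mulrA (2 * c) _ (a ^+ 2)) divff ?gt_eqF ?mulr_gt0// mul1r -[a ^+ 2]real_normK ?num_real//.
    rewrite (_ : 2 * c * (c / 2) = c ^+ 2); last by field.
    by have := sqr_ge0 (`|a| - c); nra.
  by have := ag (proj_re s z - mix_chf s); have := ag (proj_im s z); lra.
have [b1|b1] := ltP 0 b.
  apply: le_trans (key b b1) _; rewrite (_ : (2 * b)^-1 * b ^+ 2 = b / 2); first lra.
  by field; rewrite gt_eqF.
have -> : b = 0 by apply/eqP; rewrite eq_le b1 b0.
rewrite mulr0; apply/ler_addgt0Pl => e e0.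
have := key e e0; have -> : b = 0 by apply/eqP; rewrite eq_le b1 b0.
by rewrite expr0n mulr0 !addr0.
Qed.

Hypothesis M0 : 0 <= M.

Lemma proj_abs_le_moment s :
  \int[gauss n]_z (`|proj_re s z - mix_chf s| + `|proj_im s z|) <= 3 * `|s| * M.
Proof.
rewrite (_ : 3 * `|s| * M = 3 / 2 * (2 * `|s| * M)); last by field.
apply: proj_abs_le; first by rewrite !mulr_ge0.
apply: le_trans (proj_var_le_moment s) _; rewrite !exprMn real_normK ?num_real//.
have := sqr_ge0 s; have := sqr_ge0 M; nra.
Qed.

Lemma proj_abs_le_diag s :
  \int[gauss n]_z (`|proj_re s z - mix_chf s| + `|proj_im s z|) <=
  3 / 2 * (Num.sqrt diag_prob + expR (- (s ^+ 2 * n%:R / 16))).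
Proof.
apply: proj_abs_le; first by rewrite addr_ge0 ?sqrtr_ge0 ?expR_ge0.
apply: le_trans (proj_var_le_diag s) _.
have -> : expR (- (s ^+ 2 * n%:R / 8)) = expR (- (s ^+ 2 * n%:R / 16)) ^+ 2.
  by rewrite -expRM_natl; congr expR; field.
rewrite -{1}(sqr_sqrtr diag_prob_ge0).
have := sqrtr_ge0 diag_prob; have := expR_ge0 (- (s ^+ 2 * n%:R / 16)); nra.
Qed.

(** The right-hand side of [Phi_smooth_diff] at [t = n], for [<X, z> / sqrt n] against the mixture:
    the frequency [n * u] of the scaled projection is the frequency [sqrt n * u] of [<X, z>]. *)
Definition fourier_dist (z : n.-tuple R) : \bar R :=
  (\int[gauss1 R]_u ((`|proj_re (Num.sqrt n%:R * u) z - mix_chf (Num.sqrt n%:R * u)| +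
     `|proj_im (Num.sqrt n%:R * u) z|) / `|u|)%:E)%E.

Lemma measurable_proj_re2 : measurable_fun setT (fun p : measurableTypeR R * n.-tuple R =>
  proj_re (Num.sqrt n%:R * p.1) p.2).
Proof.
apply: (@measurable_Rintegral1 _ _ _ _ _ P (fun p : (measurableTypeR R * n.-tuple R) * T =>
  cos (Num.sqrt n%:R * p.1.1 * dotp (X p.2) p.1.2))).
apply: (measurableT_comp (@measurable_cos R)); apply: measurable_funM.
  by apply: measurable_funM => //; exact: (measurableT_comp measurable_fst measurable_fst).
apply: measurable_dotp2; first exact: (measurableT_comp mX measurable_snd).
exact: (measurableT_comp measurable_snd measurable_fst).
Qed.

Lemma measurable_proj_im2 : measurable_fun setT (fun p : measurableTypeR R * n.-tuple R =>
  proj_im (Num.sqrt n%:R * p.1) p.2).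
Proof.
apply: (@measurable_Rintegral1 _ _ _ _ _ P (fun p : (measurableTypeR R * n.-tuple R) * T =>
  sin (Num.sqrt n%:R * p.1.1 * dotp (X p.2) p.1.2))).
apply: (measurableT_comp (@measurable_sin R)); apply: measurable_funM.
  by apply: measurable_funM => //; exact: (measurableT_comp measurable_fst measurable_fst).
apply: measurable_dotp2; first exact: (measurableT_comp mX measurable_snd).
exact: (measurableT_comp measurable_snd measurable_fst).
Qed.

Lemma measurable_mix_chf2 : measurable_fun setT (fun u : measurableTypeR R => mix_chf (Num.sqrt n%:R * u)).
Proof.
apply: (@measurable_Rintegral1 _ _ _ _ _ P (fun p : measurableTypeR R * T =>
  expR (- ((Num.sqrt n%:R * p.1) ^+ 2 * dotp (X p.2) (X p.2) / 2)))).
apply: measurableT_comp => //; apply: measurableT_comp => //.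
apply: measurable_funM => //; apply: measurable_funM => //.
  by apply: measurable_funX; apply: measurable_funM => //; exact: measurable_fst.
by apply: measurable_dotp2; exact: (measurableT_comp mX measurable_snd).
Qed.

Let fd_kernel (p : measurableTypeR R * n.-tuple R) : R :=
  (`|proj_re (Num.sqrt n%:R * p.1) p.2 - mix_chf (Num.sqrt n%:R * p.1)| +
     `|proj_im (Num.sqrt n%:R * p.1) p.2|) / `|p.1|.

Let mfd_kernel : measurable_fun setT fd_kernel.
Proof.
apply: measurable_funM; last first.
  apply: (measurableT_comp (@measurable_invr R)).
  by apply: measurableT_comp => //; exact: measurable_fst.
apply: measurable_funD; apply: measurableT_comp => //; last exact: measurable_proj_im2.
apply: measurable_funB; first exact: measurable_proj_re2.
exact: (measurableT_comp measurable_mix_chf2 measurable_fst).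
Qed.

Let fd_kernel_ge0 p : 0 <= fd_kernel p.
Proof. by rewrite mulr_ge0 ?invr_ge0 ?addr_ge0. Qed.

Lemma measurable_fourier_dist : measurable_fun setT fourier_dist.
Proof.
apply: (@measurable_fun_fubini_tonelli_G _ _ _ _ _ (gauss1 R) (EFin \o fd_kernel)).
  exact/measurable_EFinP.
by move=> p; rewrite lee_fin.
Qed.

Lemma fourier_dist_ge0 z : (0 <= fourier_dist z)%E.
Proof. by apply: integral_ge0 => u _; rewrite lee_fin (fd_kernel_ge0 (u, z)). Qed.

Lemma integral_fourier_dist : (\int[gauss n]_z fourier_dist z =
  \int[gauss1 R]_u ((\int[gauss n]_z (`|proj_re (Num.sqrt n%:R * u) z - mix_chf (Num.sqrt n%:R * u)| +
     `|proj_im (Num.sqrt n%:R * u) z|))%R / `|u|)%:E)%E.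
Proof.
rewrite /fourier_dist -(fubini_tonelli (EFin \o fd_kernel))//; last exact/measurable_EFinP.
apply: eq_integral => u _; rewrite /fd_kernel /=.
rewrite (@Rintegral_EFin _ _ _ (gauss n) (fun z => (`|proj_re (Num.sqrt n%:R * u) z - mix_chf (Num.sqrt n%:R * u)| +
     `|proj_im (Num.sqrt n%:R * u) z|) / `|u|)).
  by rewrite RintegralZr//; exact: integrable_proj_abs.
by under eq_fun do rewrite mulrC; apply: integrable_scale; exact: integrable_proj_abs.
Qed.

End variance.

(** * Averaged Fourier distance *)

Section log_bounds.
Context {R : realType}.
Notation gauss1 := (gauss1 R).

Lemma ler_ln_sub (x : R) : 0 < x -> 1 - x^-1 <= ln x.
Proof.
move=> x0; have := @expR_ge1Dx R (- ln x); rewrite expRN lnK ?posrE//; lra.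
Qed.

Lemma harmonic_le_ln n : \sum_(1 <= k < n.+2) k%:R^-1 <= 1 + ln n.+1%:R :> R.
Proof.
elim: n => [|n IHn]; first by rewrite big_nat1 invr1 ln1 addr0.
rewrite big_nat_recr//=; have : 0 < n.+2%:R / n.+1%:R :> R by rewrite divr_gt0.
move=> /ler_ln_sub; rewrite lnM ?posrE ?invr_gt0// lnV ?posrE// invfM invrK.
have -> : 1 - (n.+2%:R)^-1 * n.+1%:R = (n.+2%:R)^-1 :> R.
  by rewrite -[X in X - _](@mulVf _ n.+2%:R) ?pnatr_eq0// -mulrBr -natrB// subSnn mulr1.
by move=> h; apply: (le_trans (lerD IHn h)); rewrite -addrA [ln n.+1%:R + _]addrC subrK.
Qed.

Lemma gauss1_ball (a : R) : 0 <= a -> \int[gauss1]_u (`|u| <= a)%R%:R <= 2 * a.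
Proof.
move=> a0; rewrite -lee_fin -Rintegral_EFin; last first.
  apply: (@gauss1_bounded_integrable _ _ 1) => [|u].
    by apply: measurable_natr_bool; apply: measurable_fun_ler => //; exact: measurableT_comp.
  by case: (`|u| <= a)%R; rewrite ?normr1 ?normr0.
rewrite [leLHS](_ : _ = \int[gauss1]_u (\1_(`[- a, a]%classic) u)%:E)%E; last first.
  by apply: eq_integral => u _; rewrite indicE mem_setE in_itv /= ler_norml.
rewrite integral_indic// setIT.
rewrite [leLHS](gauss1E `[- a, a]%classic).
apply: le_trans.
  apply: (@ge0_le_integral _ _ _ _ _ _ _ (cst 1%:E)) => //.
  - by move=> u _; rewrite lee_fin gpdf_ge0.
  - by apply/measurable_EFinP; apply: measurable_funTS; exact: measurable_gpdf.
  - by move=> u _; rewrite lee_fin gpdf_le1.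
rewrite integral_cst// mul1e [leLHS](lebesgue_measure_itv `[- a, a])/= lte_fin.
case: ifP => _; rewrite ?lee_fin ?mulr_ge0//; lra.
Qed.

(* [1 / |u|] is at most one more than the number of positive integers [k] with
   [k <= 1 / |u|]. *)
Lemma invr_le_count n (u : R) : (0 < n)%N -> n%:R^-1 < `|u| ->
  `|u|^-1 <= 1 + \sum_(1 <= k < n) (`|u| <= k%:R^-1)%R%:R.
Proof.
elim: n => // -[_ _|n IHn _].
  by rewrite invr1 big_geq// addr0 => u1; rewrite invf_le1 ?(lt_trans _ u1)// ltW.
move=> un; have u0 : 0 < `|u| by apply: lt_trans un; rewrite invr_gt0.
rewrite big_nat_recr//=; have [h|h] := leP `|u| (n.+1%:R^-1); last first.
  by rewrite addr0; exact: IHn.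
rewrite big_nat (eq_bigr (fun=> 1)).
  rewrite -big_nat sumr_const_nat subn1 /= mulr1n natr1 nat1r.
  by rewrite -[leRHS]invrK lef_pV2 ?posrE ?invr_gt0// ltW.
move=> k /andP[k1 kn]; rewrite (le_trans h)// lef_pV2 ?posrE ?ltr0n// ler_nat.
exact: ltnW.
Qed.

End log_bounds.

Section fourier_bound.
Context {R : realType} (n : nat) d (T : measurableType d) (P : probability T R)
  (X : T -> n.-tuple R).
Hypothesis mX : measurable_fun setT X.
Variable M : R.
Hypothesis HM : forall v : n.-tuple R,
  (\int[P]_w `|dotp (X w) v|%:E <= (M * enorm v)%:E)%E.
Hypothesis M0 : 0 <= M.
Hypothesis n1 : (1 < n)%N.

Definition moment_rate : R :=
  M * Num.sqrt (ln n%:R / n%:R) + Num.sqrt (diag_prob P X) * ln n%:R + n%:R^-1.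

Lemma ln_ge_half : 1 / 2 <= ln n%:R :> R.
Proof.
apply: (@le_trans _ _ (ln 2)).
  have : 0 < 2 :> R by []. move=> /ler_ln_sub; lra.
by rewrite ler_ln ?posrE ?ltr0n// ?ler_nat// ltnW.
Qed.

Let n0 : 0 < n%:R :> R. Proof. by rewrite ltr0n ltnW. Qed.

Let p0 : 0 <= Num.sqrt (diag_prob P X). Proof. exact: sqrtr_ge0. Qed.

(** The frequency cutoff. The number 32 is chosen so that [exp (- n^2 u^2 / 16) <= 1 / n^2] for
    [|u| > a]; one factor [1 / n] then pays for [1 / |u| <= n]. *)
Let a : R := Num.sqrt (32 * ln n%:R) / n%:R.

Let a0 : 0 <= a. Proof. by rewrite divr_ge0// sqrtr_ge0. Qed.

Let nia : n%:R^-1 <= a.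
Proof.
rewrite /a -[X in X <= _]mul1r ler_wpM2r ?invr_ge0 ?ler0n// -[X in X <= _]sqrtr1 ler_wsqrtr//.
have := ln_ge_half; lra.
Qed.

(** A majorant of [1 / |u|] for [|u| > 1 / n]. As the normal density is at most 1, its mean is
    bounded by a harmonic sum, and additive constants are absorbed by [ln n >= 1 / 2]. *)
Let count (u : R) : R := 1 + \sum_(1 <= k < n) (`|u| <= k%:R^-1)%R%:R.

Let count_ge1 u : 1 <= count u.
Proof. by rewrite lerDl sumr_ge0. Qed.

Let mball (b : R) : measurable_fun setT (fun u : R => (`|u| <= b)%R%:R : R).
Proof. by apply: measurable_natr_bool; apply: measurable_fun_ler => //; exact: measurableT_comp. Qed.

Let iball (b : R) : (gauss1 R).-integrable setT (EFin \o (fun u : R => (`|u| <= b)%R%:R : R)).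
Proof.
apply: (@gauss1_bounded_integrable _ _ 1) => // u.
by case: (`|u| <= b)%R; rewrite ?normr1 ?normr0.
Qed.

Let isum : (gauss1 R).-integrable setT
  (EFin \o (fun u : R => \sum_(1 <= k < n) (`|u| <= k%:R^-1)%R%:R)).
Proof.
apply: (@gauss1_bounded_integrable _ _ n%:R); first exact: measurable_sum.
move=> u; rewrite ger0_norm ?sumr_ge0//.
apply: (@le_trans _ _ (\sum_(1 <= k < n) 1)); last by rewrite sumr_const_nat ler_nat leq_subr.
by apply: ler_sum => k _; case: (`|u| <= _)%R.
Qed.

Let int_count : \int[gauss1 R]_u count u <= 8 * ln n%:R.
Proof.
rewrite /count RintegralD//; last exact: prob_integrable_cst.
rewrite Rintegral_cstT.
have -> : \int[gauss1 R]_u (\sum_(1 <= k < n) (`|u| <= k%:R^-1)%R%:R) =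
    \sum_(1 <= k < n) \int[gauss1 R]_u (`|u| <= k%:R^-1)%R%:R.
  under eq_Rintegral do rewrite big_add1 big_mkord.
  by rewrite Rintegral_bigsum// big_add1 big_mkord.
apply: (@le_trans _ _ (1 + \sum_(1 <= k < n) 2 * k%:R^-1)).
  by rewrite lerD2l; apply: ler_sum => k _; apply: gauss1_ball; rewrite invr_ge0.
have : \sum_(1 <= k < n) k%:R^-1 <= 1 + ln n%:R :> R.
  case: (n) n1 => [|[|m]]// _; apply: le_trans (@harmonic_le_ln R m) _.
  by rewrite lerD2l ler_ln ?posrE// ler_nat.
rewrite -mulr_sumr; have := ln_ge_half; lra.
Qed.

Let sqrtn0 : 0 < Num.sqrt n%:R :> R. Proof. by rewrite sqrtr_gt0. Qed.

Let exp_tail (u : R) : a < `|u| -> expR (- ((Num.sqrt n%:R * u) ^+ 2 * n%:R / 16)) / `|u| <= n%:R^-1.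
Proof.
move=> au; have u0 : 0 < `|u| by apply: le_lt_trans au.
rewrite ler_pdivrMr//.
have h : expR (- ((Num.sqrt n%:R * u) ^+ 2 * n%:R / 16)) <= n%:R^-1 ^+ 2.
  rewrite -[n%:R]lnK ?posrE// -!expRN -expRM_natl ler_expR.
  rewrite lnK ?posrE// exprMn sqr_sqrtr ?(ltW n0)// -[u ^+ 2]real_normK ?num_real//.
  have : 32 * ln n%:R <= (n%:R * `|u|) ^+ 2.
    rewrite -[leLHS]sqr_sqrtr; last by have := ln_ge_half; lra.
    rewrite ler_pXn2r ?nnegrE ?sqrtr_ge0// ?mulr_ge0// ?(ltW n0)//.
    by move: (ltW au); rewrite /a ler_pdivrMr// [_ * n%:R]mulrC.
  rewrite exprMn => h; have -> : n%:R * `|u| ^+ 2 * n%:R / 16 = n%:R ^+ 2 * `|u| ^+ 2 / 16 by field.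
  lra.
apply: (le_trans h); rewrite expr2 ler_wpM2l ?invr_ge0 ?(ltW n0)//.
exact: le_trans nia (ltW au).
Qed.

Lemma integral_fourier_dist_le : (\int[gauss n]_z fourier_dist P X z <= (36 * moment_rate)%:E)%E.
Proof.
rewrite integral_fourier_dist//.
apply: (@le_trans _ _ (\int[gauss1 R]_u (3 * Num.sqrt n%:R * M * (`|u| <= a)%R%:R +
    (3 / 2 * Num.sqrt (diag_prob P X) * count u + 3 / 2 * n%:R^-1))%:E)%E).
  apply: ge0_le_integral_measurable_ub => u.
    by rewrite lee_fin divr_ge0// Rintegral_ge0// => z _; rewrite addr_ge0.
  have r0 : 0 <= 3 / 2 * Num.sqrt (diag_prob P X) * count u + 3 / 2 * n%:R^-1.
    rewrite addr_ge0 ?mulr_ge0 ?invr_ge0 ?(ltW n0)//.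
    exact: le_trans (count_ge1 u).
  have l0 : 0 <= 3 * Num.sqrt n%:R * M * (`|u| <= a)%R%:R by rewrite !mulr_ge0 ?ler0n// ltW.
  rewrite lee_fin; have [u0|u0] := eqVneq u 0.
    by rewrite [X in _ / `|X|]u0 normr0 invr0 mulr0 addr_ge0.
  have {}u0 : 0 < `|u| by rewrite normr_gt0.
  (* Below the cutoff the factor [|u|] of the moment bound cancels the singularity, leaving a
     constant to integrate over an interval of length [2 * a]. *)
  have [ua|au] := leP `|u| a.
    rewrite mulr1 -[X in X <= _]addr0; apply: lerD => //.
    rewrite ler_pdivrMr//; apply: le_trans (proj_abs_le_moment mX HM M0 _) _.
    by rewrite normrM (ger0_norm (ltW sqrtn0)) le_eqVlt; apply/orP; left; apply/eqP; ring.
  rewrite mulr0 add0r; apply: (@le_trans _ _ (3 / 2 * (Num.sqrt (diag_prob P X) +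
      expR (- ((Num.sqrt n%:R * u) ^+ 2 * n%:R / 16))) / `|u|)).
    by rewrite ler_wpM2r ?invr_ge0//; exact: proj_abs_le_diag.
  rewrite mulrDr mulrDl; apply: lerD.
    rewrite ler_wpM2l// ?mulr_ge0//; apply: invr_le_count; first exact: ltnW.
    exact: le_lt_trans nia au.
  by rewrite -mulrA ler_wpM2l// exp_tail.
have i1 := @integrable_scale _ _ _ (gauss1 R) (3 * Num.sqrt n%:R * M) _ (iball a).
have i2 : (gauss1 R).-integrable setT (EFin \o count).
  exact: (integrableD measurableT (prob_integrable_cst (gauss1 R) 1) isum).
have i3 := @integrable_scale _ _ _ (gauss1 R) (3 / 2 * Num.sqrt (diag_prob P X)) _ i2.
have i4 := @prob_integrable_cst _ _ _ (gauss1 R) (3 / 2 * n%:R^-1).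
have i5 := integrableD measurableT i3 i4.
rewrite Rintegral_EFin; last exact: (integrableD measurableT i1 i5).
rewrite lee_fin RintegralD// RintegralD// Rintegral_cstT !RintegralZl//.
have h1 := gauss1_ball a0.
have h2 := int_count.
(* The fraction [34 / 6] is a rational upper bound for the square root of 32. *)
have h3 : Num.sqrt n%:R * a <= 34 / 6 * Num.sqrt (ln n%:R / n%:R).
  have l0 : 0 <= ln n%:R :> R by have := ln_ge_half; lra.
  have -> : Num.sqrt n%:R * a = Num.sqrt 32 * Num.sqrt (ln n%:R / n%:R).
    have E : n%:R^-1 = (Num.sqrt n%:R)^-1 ^+ 2 :> R by rewrite exprVn sqr_sqrtr ?(ltW n0).
    rewrite /a !sqrtrM// sqrtrV ?(ltW n0)// [in LHS]E.
    by field; rewrite gt_eqF.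
  rewrite ler_wpM2r ?sqrtr_ge0// -[leRHS]ger0_norm// -sqrtr_sqr ler_wsqrtr//; lra.
rewrite /moment_rate.
have h4 : 0 <= n%:R^-1 :> R by rewrite invr_ge0 ltW.
have h5 : 3 * Num.sqrt n%:R * M * \int[gauss1 R]_u (`|u| <= a)%R%:R <=
    34 * (M * Num.sqrt (ln n%:R / n%:R)).
  apply: (@le_trans _ _ (3 * Num.sqrt n%:R * M * (2 * a))).
    by rewrite ler_wpM2l// !mulr_ge0// ltW.
  have := ler_wpM2l M0 h3; lra.
have h6 := ler_wpM2l p0 h2.
have h7 : 0 <= M * Num.sqrt (ln n%:R / n%:R) by rewrite mulr_ge0.
have h8 : 0 <= Num.sqrt (diag_prob P X) * ln n%:R.
  by rewrite mulr_ge0//; have := ln_ge_half; lra.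
lra.
Qed.

End fourier_bound.

(** * The Gaussian mixture *)

Lemma Rintegral_prod1_bounded d (T : measurableType d) d' (U : measurableType d')
    (R : realType) (P : probability T R) (Q : probability U R) (f : T * U -> R) M :
  measurable_fun setT f -> (forall z, `|f z| <= M) ->
  \int[(P \x Q)%E]_z f z = \int[P]_x \int[Q]_y f (x, y).
Proof.
move=> mf fM; apply: Rintegral_prod1; first exact: (@prob_bounded_integrable _ _ _ _ _ M).
move=> x; apply: (@prob_bounded_integrable _ _ _ _ _ M) => //.
exact: (measurable_sect1 x mf).
Qed.

Lemma gauss1_cdf_scale (R : realType) (u x : R) : 0 < u ->
  \int[gauss1 R]_g (u * g <= x)%R%:R = Phi (x / u).
Proof.
move=> u0; rewrite /Rintegral -[RHS]/(fine (Phi _)%:E) -Phi_gauss1; congr fine.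
rewrite -[RHS](_ : \int[gauss1 R]_g (\1_(`]-oo, (x / u)%R]%classic) g)%:E = _)%E.
  apply: eq_integral => g _; rewrite indicE mem_setE in_itv /=; congr (_ %:R%:E).
  by rewrite ler_pdivlMr// mulrC.
by rewrite integral_indic// setIT.
Qed.

Section mixture.
Context {R : realType} (n : nat) d (T : measurableType d) (P : probability T R)
  (X : T -> n.-tuple R).
Hypothesis mX : measurable_fun setT X.

Definition gauss_radial (p : T * measurableTypeR R) : R :=
  enorm (X p.1) / Num.sqrt n%:R * p.2.

Definition mix_cdf (x : R) : R := rcdf (P \x gauss1 R)%E gauss_radial x.

Let mnX : measurable_fun setT (fun w => enorm (X w)).
Proof. exact: (measurableT_comp measurable_enorm mX). Qed.

Lemma measurable_gauss_radial : measurable_fun setT gauss_radial.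
Proof.
apply: measurable_funM; last exact: measurable_snd.
by apply: measurable_funM => //; exact: (measurableT_comp mnX measurable_fst).
Qed.

Let rad (w : T) : R := enorm (X w) / Num.sqrt n%:R.

Let mrad : measurable_fun setT rad.
Proof. exact: measurable_funM. Qed.

(** The distribution function of [u * g]. It is kept as an integral because at [u = 0], that is
    where [X] vanishes, it is a step function and not [Phi (x / u)]. *)
Let H (x u : R) : R := \int[gauss1 R]_g (u * g <= x)%R%:R.

Let mindic (x : R) : measurable_fun setT
  (fun p : T * measurableTypeR R => (rad p.1 * p.2 <= x)%R%:R : R).
Proof.
apply: measurable_natr_bool; apply: measurable_fun_ler => //.
exact: measurable_gauss_radial.
Qed.

Let H01 x u : 0 <= H x u <= 1.
Proof.
have m : measurable_fun setT (fun g : measurableTypeR R => (u * g <= x)%R%:R : R).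
  by apply: measurable_natr_bool; apply: measurable_fun_ler => //; exact: measurable_funM.
rewrite Rintegral_ge0//=.
rewrite (le_trans (ler_norm _))//; apply: normr_Rintegral_le => // g.
by case: (_ <= x)%R; rewrite ?normr1 ?normr0.
Qed.

Let H_abs x u : `|H x u| <= 1.
Proof. by case/andP: (H01 x u) => h1 h2; rewrite ger0_norm. Qed.

Let mH x : measurable_fun setT (fun w => H x (rad w)).
Proof. exact: (measurable_Rintegral1 (gauss1 R) (mindic x)). Qed.

Let iH x : P.-integrable setT (EFin \o (fun w => H x (rad w))).
Proof. by apply: (@prob_bounded_integrable _ _ _ _ _ 1) => // w; exact: H_abs. Qed.

Let mix_cdfE x : mix_cdf x = \int[P]_w H x (rad w).
Proof.
rewrite /mix_cdf rcdf_indic; last exact: measurable_gauss_radial.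
apply: (@Rintegral_prod1_bounded _ _ _ _ _ P (gauss1 R) _ 1 (mindic x)).
by move=> p; case: (_ <= x)%R; rewrite ?normr1 ?normr0.
Qed.

Hypothesis n1 : (0 < n)%N.

Let n0 : 0 < n%:R :> R. Proof. by rewrite ltr0n. Qed.

Let sq0 : 0 < Num.sqrt n%:R :> R. Proof. by rewrite sqrtr_gt0. Qed.

Let rad_ge0 w : 0 <= rad w.
Proof. by rewrite divr_ge0 ?enorm_ge0// ltW. Qed.

Let rad_sqr w : rad w ^+ 2 = enorm (X w) ^+ 2 / n%:R.
Proof. by rewrite /rad exprMn exprVn (sqr_sqrtr (ltW n0)). Qed.

Let H_pos x u : 0 < u -> H x u = Phi (x / u).
Proof. exact: gauss1_cdf_scale. Qed.

Let H0 x : H x 0 = (0 <= x)%R%:R.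
Proof.
rewrite /H -[RHS](Rintegral_cstT (gauss1 R)); apply: eq_Rintegral => g _.
by rewrite mul0r.
Qed.

(** Given the radius, this is [Phi_scale], uniformly in that radius; where [X] vanishes,
    multiplication by [r] preserves the sign of [x]. It will pay for replacing [z] by its
    direction. *)
Lemma mix_cdf_scale r x : 0 < r -> `|mix_cdf (r * x) - mix_cdf x| <= 2 * `|r^-1 ^+ 2 - 1|.
Proof.
move=> r0; rewrite !mix_cdfE -RintegralB//; apply: normr_Rintegral_le.
  by apply: measurable_funB; exact: mH.
move=> w; have := rad_ge0 w; rewrite le_eqVlt => /predU1P[<-|u0].
  by rewrite !H0 pmulr_rge0// subrr normr0 mulr_ge0.
rewrite !H_pos// (_ : r * x / rad w = x / rad w / r^-1); first by rewrite Phi_scale// invr_gt0.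
by rewrite invrK -mulrA mulrC.
Qed.

Lemma mix_cdf_normal x : (`|mix_cdf x - Phi x|%:E <=
  2%:E * \int[P]_w `|enorm (X w) ^+ 2 / n%:R - 1|%:E)%E.
Proof.
have ic : P.-integrable setT (EFin \o (fun=> Phi x)) by exact: prob_integrable_cst.
rewrite -[X in _ - X](Rintegral_cstT P) mix_cdfE -RintegralB//.
have mr : measurable_fun setT (fun w => `|enorm (X w) ^+ 2 / n%:R - 1|).
  apply: measurableT_comp => //; apply: measurable_funB => //; apply: measurable_funM => //.
  exact: measurable_funX.
rewrite EFin_normr_Rintegral//; last exact: (integrableB measurableT (iH x) ic).
rewrite -ge0_integralZl//; last exact/measurable_EFinP.
apply: le_trans (le_abse_integral _ _ _) _ => //.
  by apply/measurable_EFinP; apply: measurable_funB => //; exact: mH.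
apply: ge0_le_integral_measurable_ub => w; first exact: abse_ge0.
rewrite /= lee_fin -rad_sqr.
(* Where [X] vanishes, the deviation on the right is exactly 1, so the bound holds with room to
   spare. *)
have := rad_ge0 w; rewrite le_eqVlt => /predU1P[<-|u0]; last by rewrite H_pos// Phi_scale.
rewrite expr0n sub0r normrN1 mulr1.
have /andP[? ?] := H01 x 0; have := Phi_ge0 x; have := Phi_le1 x; rewrite ler_norml; lra.
Qed.

Definition small_prob : R := fine (P [set w | enorm (X w) ^+ 2 <= n%:R / 16]).

Lemma measurable_small : measurable [set w | enorm (X w) ^+ 2 <= n%:R / 16].
Proof.
rewrite (_ : mkset _ = (fun w => enorm (X w) ^+ 2) @^-1` `]-oo, (n%:R / 16)]%classic).
  by rewrite -[X in measurable X]setTI; apply: measurable_funX.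
by apply/seteqP; split => w /=; rewrite in_itv.
Qed.

Lemma small_probE : P [set w | enorm (X w) ^+ 2 <= n%:R / 16] = small_prob%:E.
Proof. by rewrite /small_prob fineK//; apply: prob_fin_num; exact: measurable_small. Qed.

(** Off the small-norm event the radius [|X| / sqrt n] exceeds [1 / 4], so the conditional law is
    4-Lipschitz; on it the increment is at most 1. *)
Lemma mix_cdf_lip x y : x <= y -> mix_cdf y - mix_cdf x <= small_prob + 4 * (y - x).
Proof.
move=> xy; rewrite !mix_cdfE -RintegralB//.
set A := [set w | enorm (X w) ^+ 2 <= n%:R / 16].
have mA : measurable A := measurable_small.
have -> : small_prob = \int[P]_w (\1_A w).
  by rewrite /Rintegral integral_indic ?setIT.
rewrite -[X in _ <= _ + X](Rintegral_cstT P).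
have i1 : P.-integrable setT (EFin \o (\1_A)).
  apply: (@prob_bounded_integrable _ _ _ _ _ 1); first exact: measurable_indic.
  by move=> w; rewrite indicE; case: (w \in _); rewrite ?normr1 ?normr0.
have i2 : P.-integrable setT (EFin \o (fun=> 4 * (y - x))) by exact: prob_integrable_cst.
rewrite -RintegralD//; apply: le_Rintegral => //.
- exact: (integrableB measurableT (iH y) (iH x)).
- exact: (integrableD measurableT i1 i2).
move=> w _; rewrite indicE; have [wA|wA] := boolP (w \in A).
  have /andP[? ?] := H01 x (rad w); have /andP[? ?] := H01 y (rad w).
  by rewrite mulr1n; lra.
rewrite add0r.
have h : (1 / 4) ^+ 2 < rad w ^+ 2.
  rewrite rad_sqr ltr_pdivlMr// ltNge; apply: contra wA => h; rewrite inE /A /=; lra.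
have u4 : 1 / 4 < rad w by move: h; rewrite ltr_pXn2r ?nnegrE.
have u0 : 0 < rad w by apply: lt_trans u4.
rewrite !H_pos//; apply: le_trans (Phi_lip _) _; first by rewrite ler_pM2r// invr_gt0.
rewrite -mulrBl mulrC ler_wpM2r ?subr_ge0// -[leRHS]invrK lef_pV2 ?posrE ?invr_gt0//; lra.
Qed.

Lemma re_chf_gauss_radial s : re_chf (P \x gauss1 R)%E gauss_radial s = mix_chf P X (s / Num.sqrt n%:R).
Proof.
rewrite /re_chf (@Rintegral_prod1_bounded _ _ _ _ _ P (gauss1 R) _ 1)//.
- apply: eq_Rintegral => w _; rewrite /gauss_radial /=.
  under eq_Rintegral do rewrite mulrA.
  rewrite gauss1_cos; congr (expR (- (_ / 2))).
  by rewrite -enorm_sqr -!exprMn; congr (_ ^+ 2); ring.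
- apply: (measurableT_comp (@measurable_cos R)); apply: measurable_funM => //.
  exact: measurable_gauss_radial.
- by move=> z; exact: cos_max.
Qed.

Lemma im_chf_gauss_radial s : im_chf (P \x gauss1 R)%E gauss_radial s = 0.
Proof.
rewrite /im_chf (@Rintegral_prod1_bounded _ _ _ _ _ P (gauss1 R) _ 1)//.
- rewrite -[RHS](Rintegral_cstT P); apply: eq_Rintegral => w _; rewrite /gauss_radial /=.
  under eq_Rintegral do rewrite mulrA.
  by rewrite gauss1_sin.
- apply: (measurableT_comp (@measurable_sin R)); apply: measurable_funM => //.
  exact: measurable_gauss_radial.
- by move=> z; exact: sin_max.
Qed.

End mixture.

(** * Comparison of a projection with the Gaussian mixture *)

Section projection_mixture.
Context {R : realType} (n : nat) d (T : measurableType d) (P : probability T R)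
  (X : T -> n.-tuple R).
Hypothesis mX : measurable_fun setT X.
Variable M : R.
Hypothesis HM : forall v : n.-tuple R,
  (\int[P]_w `|dotp (X w) v|%:E <= (M * enorm v)%:E)%E.
Hypothesis n1 : (0 < n)%N.

Let n0 : 0 < n%:R :> R. Proof. by rewrite ltr0n. Qed.

Let sq0 : 0 < Num.sqrt n%:R :> R. Proof. by rewrite sqrtr_gt0. Qed.

Lemma enorm_le_sum (x : n.-tuple R) : enorm x <= \sum_(i < n) `|tnth x i|.
Proof.
rewrite -[leRHS]ger0_norm ?sumr_ge0// -sqrtr_sqr ler_wsqrtr// expr2 /dotp mulr_suml.
apply: ler_sum => i _; rewrite -expr2 -real_normK ?num_real// expr2 ler_wpM2l//.
by rewrite (bigD1 i)//= lerDl sumr_ge0.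
Qed.

Lemma enorm_integrable : P.-integrable setT (EFin \o (fun w => enorm (X w))).
Proof.
have i1 : P.-integrable setT (EFin \o (fun w => \sum_(i < n) `|tnth (X w) i|)).
  by apply: integrable_bigsum => i; exact: (integrable_norm (coord_integrable mX HM i)).
apply: le_integrable i1 => //.
  by apply/measurable_EFinP; exact: (measurableT_comp measurable_enorm mX).
by move=> w _; rewrite /= lee_fin !ger0_norm ?sumr_ge0 ?enorm_ge0// enorm_le_sum.
Qed.

Lemma gauss_radial_integrable :
  (P \x gauss1 R)%E.-integrable setT (EFin \o (gauss_radial (n := n) X)).
Proof.
have i1 : P.-integrable setT (EFin \o (fun w => enorm (X w) / Num.sqrt n%:R)).
  by under eq_fun do rewrite mulrC; apply: integrable_scale; exact: enorm_integrable.
have i2 : (gauss1 R).-integrable setT (EFin \o (fun g : R => g)).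
  exact: (gauss1_integrable _ (@abs_le_expR4 R)).2.
exact: (integrable_prod_mul i1 i2).
Qed.

(** As [|z|] is close to [sqrt n] for a Gaussian [z], this is nearly the projection on the direction
    of [z], while remaining linear in [z]. *)
Definition proj_scaled (z : n.-tuple R) (w : T) : R := (Num.sqrt n%:R)^-1 * dotp (X w) z.

Let mproj z : measurable_fun setT (proj_scaled z).
Proof. by apply: measurable_funM => //; exact: measurable_dotp2. Qed.

Let mrad := measurable_gauss_radial mX.

Lemma fourier_smooth z x :
  (`|\int[gauss1 R]_u rcdf P (proj_scaled z) (x - u / n%:R) -
     \int[gauss1 R]_u mix_cdf P X (x - u / n%:R)|%:E <= fourier_dist P X z)%E.
Proof.
rewrite /mix_cdf !rcdf_smooth//.
have ip : P.-integrable setT (EFin \o (proj_scaled z)).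
  by apply: integrable_scale; exact: dotp_integrable.
apply: le_trans (Phi_smooth_diff x n0 (mproj z) mrad ip gauss_radial_integrable) _.
rewrite /fourier_dist le_eqVlt; apply/orP; left; apply/eqP; apply: eq_integral => u _.
have E : n%:R * u / Num.sqrt n%:R = Num.sqrt n%:R * u.
  by rewrite mulrAC -[in X in X / _](sqr_sqrtr (ltW n0)) expr2 mulfK ?gt_eqF.
rewrite re_chf_gauss_radial// im_chf_gauss_radial// subr0 E.
have -> : re_chf P (proj_scaled z) (n%:R * u) = proj_re P X (Num.sqrt n%:R * u) z.
  by apply: eq_Rintegral => w _; rewrite /proj_scaled mulrA E.
have -> : im_chf P (proj_scaled z) (n%:R * u) = proj_im P X (Num.sqrt n%:R * u) z.
  by apply: eq_Rintegral => w _; rewrite /proj_scaled mulrA E.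
by [].
Qed.

Lemma measurable_rcdf d' (T' : measurableType d') (P' : probability T' R) (xi : T' -> R) :
  measurable_fun setT xi -> measurable_fun setT (rcdf P' xi).
Proof.
move=> mxi; apply: nondecreasing_measurable => //.
exact: rcdf_mono.
Qed.

Lemma proj_scaled_mix z x : fourier_dist P X z \is a fin_num ->
  `|rcdf P (proj_scaled z) x - mix_cdf P X x| <=
    2 * fine (fourier_dist P X z) + 2 * (small_prob P X + 4 * (4 / n%:R)).
Proof.
move=> fz; apply: desmoothing => //.
- by rewrite /small_prob fine_ge0.
- exact: measurable_rcdf.
- exact: measurable_rcdf.
- exact: rcdf_itv.
- by move=> y; apply: rcdf_itv.
- exact: rcdf_mono.
- by apply: rcdf_mono.
- by move=> a b ab; exact: mix_cdf_lip.
- by move=> y; rewrite -lee_fin fineK//; exact: fourier_smooth.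
Qed.

(** The number 32 is [2 * 4 * 4]: the factor of [desmoothing], the Lipschitz constant of the
    mixture, and the window [4 / n]. The last summand is the price of normalizing [z]. *)
Definition mix_error (z : n.-tuple R) : \bar R :=
  (2%:E * fourier_dist P X z +
   (2 * small_prob P X + 32 / n%:R + 2 * `|enorm z ^+ 2 / n%:R - 1|)%:E)%E.

Lemma mix_error_ge0 z : (0 <= mix_error z)%E.
Proof.
rewrite adde_ge0 ?mule_ge0 ?fourier_dist_ge0// lee_fin !addr_ge0// ?mulr_ge0//.
by rewrite /small_prob fine_ge0.
Qed.

Lemma dotp_normalize (x z : n.-tuple R) : dotp x (normalize z) = dotp x z / enorm z.
Proof.
by rewrite /dotp mulr_suml; apply: eq_bigr => i _; rewrite tnth_mktuple mulrA.
Qed.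

Lemma proj_mix_error z x : 0 < enorm z ->
  (`|P [set w | (dotp (X w) (normalize z) <= x)%R] - (mix_cdf P X x)%:E| <= mix_error z)%E.
Proof.
move=> z0; rewrite /mix_error.
have [fz|] := boolP (fourier_dist P X z \is a fin_num); last first.
  rewrite ge0_fin_numE ?fourier_dist_ge0// -leNgt leye_eq => /eqP ->.
  by rewrite mulry gtr0_sg// mul1e addye// leey.
set r := enorm z / Num.sqrt n%:R.
have r0 : 0 < r by rewrite divr_gt0.
have -> : [set w | dotp (X w) (normalize z) <= x] = [set w | proj_scaled z w <= r * x].
  have E : Num.sqrt n%:R * (r * x) = x * enorm z by rewrite /r; field; rewrite gt_eqF.
  by apply/seteqP; split => w /=; rewrite dotp_normalize ler_pdivrMr// /proj_scaled ler_pdivrMl// E.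
rewrite rcdfE// -EFinB -[fourier_dist _ _ _]fineK// lee_fin.
have h1 := proj_scaled_mix (r * x) fz.
have ri : 0 < r^-1 by rewrite invr_gt0.
(* Scaling back from [r * x] by the inverse factor yields the error [|r^2 - 1|] instead of
   [|r^-2 - 1|]; the former is [| |z|^2 / n - 1 |], whose Gaussian mean is under control. *)
have h2 := mix_cdf_scale P mX (r * x) ri.
rewrite mulKf ?gt_eqF// invrK distrC in h2.
have h3 := ler_distD (mix_cdf P X (r * x)) (rcdf P (proj_scaled z) (r * x)) (mix_cdf P X x).
have rE : r ^+ 2 = enorm z ^+ 2 / n%:R by rewrite /r exprMn exprVn (sqr_sqrtr (ltW n0)).
apply: (le_trans h3); apply: (le_trans (lerD h1 h2)); rewrite rE.
clear h1 h2 h3; set a := fine _; set b := small_prob _ _; set c := `|_|; lra.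
Qed.

End projection_mixture.

Section mix_error_bound.
Context {R : realType} (n : nat) d (T : measurableType d) (P : probability T R)
  (X : T -> n.-tuple R).
Hypothesis mX : measurable_fun setT X.
Variable M : R.
Hypothesis HM : forall v : n.-tuple R,
  (\int[P]_w `|dotp (X w) v|%:E <= (M * enorm v)%:E)%E.
Hypothesis M0 : 0 <= M.
Hypothesis n1 : (1 < n)%N.

Let n0 : 0 < n%:R :> R. Proof. by rewrite ltr0n ltnW. Qed.

Let sq0 : 0 < Num.sqrt n%:R :> R. Proof. by rewrite sqrtr_gt0. Qed.

Let sqK : Num.sqrt n%:R ^+ 2 = n%:R :> R. Proof. by rewrite sqr_sqrtr// ltW. Qed.

Lemma diag_prob_le1 : diag_prob P X <= 1.
Proof. by rewrite -lee_fin -diag_probE// probability_le1//; exact: measurable_near_diag. Qed.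

Lemma small_prob_ge0 : 0 <= small_prob P X.
Proof. by rewrite /small_prob fine_ge0. Qed.

Lemma tsub_sqr_le (x y : n.-tuple R) : enorm (tsub x y) ^+ 2 <= 2 * (enorm x ^+ 2 + enorm y ^+ 2).
Proof.
rewrite !enorm_sqr /dotp -big_split /= mulr_sumr; apply: ler_sum => i _.
rewrite tnth_mktuple; have := sqr_ge0 (tnth x i + tnth y i); lra.
Qed.

(** Two independent copies of squared norm at most [n / 16] satisfy
    [|X - Y|^2 <= 2 (n / 16 + n / 16) = n / 4]; this dictates the threshold. *)
Lemma small_prob_le : small_prob P X <= Num.sqrt (diag_prob P X).
Proof.
rewrite -[leLHS]ger0_norm ?small_prob_ge0// -sqrtr_sqr ler_wsqrtr//.
rewrite -lee_fin expr2 EFinM -small_probE// -product_measure1E; try exact: measurable_small.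
rewrite -diag_probE//; apply: le_measure; rewrite ?inE.
- by apply: measurableX; exact: measurable_small.
- exact: measurable_near_diag.
move=> [w1 w2] [/= h1 h2]; rewrite /near_diag /=.
have := tsub_sqr_le (X w1) (X w2); lra.
Qed.

Lemma one_subr_cos_le (t : R) : 1 - cos t <= `|t|.
Proof.
have -> : t = (t / 2) *+ 2 by rewrite mulr2n; field.
rewrite cos_mulr2n normrMn; have := cos2Dsin2 (t / 2); have := normr_sin_le (t / 2).
have : sin (t / 2) ^+ 2 <= `|sin (t / 2)|.
  by rewrite -real_normK ?num_real// expr2 ler_piMl// sin_max.
rewrite !mulr2n; lra.
Qed.

Lemma one_subr_proj_re_le s z : 1 - proj_re P X s z <= `|s| * (M * enorm z).
Proof.
have mXz : measurable_fun setT (fun w => dotp (X w) z) by exact: measurable_dotp2.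
have ic := @integrable_cos_scale _ _ _ P _ mXz s.
rewrite -[X in X - _](Rintegral_cstT P) -RintegralB//; last exact: prob_integrable_cst.
have id1 : P.-integrable setT (EFin \o (fun w => `|dotp (X w) z|)).
  exact: (integrable_norm (dotp_integrable mX HM z)).
apply: (@le_trans _ _ (\int[P]_w (`|s| * `|dotp (X w) z|))).
  apply: le_Rintegral => //.
  - exact: (integrableB measurableT (prob_integrable_cst P 1) ic).
  - exact: integrable_scale.
  - by move=> w _; rewrite -normrM one_subr_cos_le.
rewrite RintegralZl// ler_wpM2l// -lee_fin -Rintegral_EFin//; exact: HM.
Qed.

(* When [M] and the collision probability are both small, the projections of
   [X] would concentrate, against the Gaussian decay of their second moment. *)
Lemma diag_moment_lb : 1 - expR (- (1 / 8)) <= diag_prob P X + 2 * M.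
Proof.
(* At this frequency [s^2 n = 1]: the upper bound becomes the collision probability plus
   [exp (- 1 / 8)], and [s * |z|] is of order 1. *)
pose s : R := (Num.sqrt n%:R)^-1.
have s0 : 0 < s by rewrite invr_gt0.
have sE : s ^+ 2 * n%:R = 1 by rewrite exprVn sqK mulVf// gt_eqF.
have [iq mean0 _ _] := @gauss_sqnorm_var R n.
(* Pointwise, [re^2 >= 1 - 2 (1 - re) >= 1 - 2 s M |z|], and [s |z| <= 1 + (|z|^2 - n) / (2 n)]
   linearizes the norm in terms of a quantity of mean zero. *)
have h1 : \int[gauss n]_z (1 - 2 * M + (- (M / n%:R)) * (dotp z z - n%:R)) <=
    \int[gauss n]_z (proj_re P X s z ^+ 2 + proj_im P X s z ^+ 2).
  apply: le_Rintegral => //.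
  - exact: (integrableD measurableT (prob_integrable_cst (gauss n) (1 - 2 * M)) (integrable_scale (- (M / n%:R)) iq)).
  - exact: integrable_sqr_proj.
  move=> z _; have := one_subr_proj_re_le s z; have := proj_re_le1 P mX s z.
  have := sqr_ge0 (proj_im P X s z).
  rewrite (gtr0_norm s0) ler_norml => h2 /andP[h3 h4] h5.
  have h6 : s * (M * enorm z) <= M + M / (2 * n%:R) * (dotp z z - n%:R).
    have h7 : s * enorm z <= 1 + (2 * n%:R)^-1 * (dotp z z - n%:R).
      have := sqr_ge0 (s * enorm z - 1).
      rewrite sqrrB exprMn enorm_sqr; have -> : s ^+ 2 = n%:R^-1 by rewrite exprVn sqK.
      rewrite mulr1 expr1n mulr2n => h.
      have -> : (2 * n%:R)^-1 * (dotp z z - n%:R) = n%:R^-1 * dotp z z / 2 - 1 / 2.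
        by field; rewrite gt_eqF.
      lra.
    by rewrite (mulrCA s); apply: le_trans (ler_wpM2l M0 h7) _; rewrite mulrDr mulr1 mulrA.
  have -> : - (M / n%:R) * (dotp z z - n%:R) = - (2 * (M / (2 * n%:R) * (dotp z z - n%:R))).
    by field; rewrite gt_eqF.
  by nra.
have h2 := sqr_proj_le_diag P mX s.
rewrite sE in h2; move: h1.
rewrite RintegralD//; last exact: integrable_scale.
  rewrite Rintegral_cstT RintegralZl// mean0; lra.
exact: prob_integrable_cst.
Qed.

(** With [a = | |z|^2 - n |], completing the square gives [a / n <= c + c a^2 / n] for
    [c = 1 / (2 sqrt n)]; the mean of [a^2] is [n] times [gauss1_var2]. *)
Lemma gauss_sqnorm_dev : \int[gauss n]_z `|enorm z ^+ 2 / n%:R - 1| <=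
  (1 + gauss1_var2 R) / (2 * Num.sqrt n%:R).
Proof.
have [iq _ iq2 E2] := @gauss_sqnorm_var R n.
have i1 : (gauss n).-integrable setT (EFin \o (fun z : n.-tuple R => `|enorm z ^+ 2 / n%:R - 1|)).
  have := integrable_norm (integrable_scale n%:R^-1 iq).
  apply: eq_integrable => // z _ /=; congr (`|_|%:E).
  by rewrite enorm_sqr mulrBr mulVf ?gt_eqF// mulrC.
set c : R := (2 * Num.sqrt n%:R)^-1.
apply: (@le_trans _ _ (\int[gauss n]_z (c + c / n%:R * (dotp z z - n%:R) ^+ 2))).
  apply: le_Rintegral => //.
    exact: (integrableD measurableT (prob_integrable_cst (gauss n) c) (integrable_scale _ iq2)).
  move=> z _; rewrite enorm_sqr.
  have -> : dotp z z / n%:R - 1 = (dotp z z - n%:R) / n%:R by field; rewrite gt_eqF.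
  rewrite normrM normfV (gtr0_norm n0).
  rewrite -[(_ - _) ^+ 2]real_normK ?num_real//; set a := `|_|.
  rewrite -sqK -subr_ge0.
  have -> : c + c / Num.sqrt n%:R ^+ 2 * a ^+ 2 - a / Num.sqrt n%:R ^+ 2 =
      c * (1 - a / Num.sqrt n%:R) ^+ 2 by rewrite /c; field; rewrite gt_eqF.
  by rewrite mulr_ge0 ?sqr_ge0// invr_ge0 mulr_ge0// ltW.
rewrite RintegralD//; last first.
- exact: integrable_scale.
- exact: prob_integrable_cst.
by rewrite Rintegral_cstT RintegralZl// E2 mulrA divfK ?gt_eqF// mulrDl mul1r (mulrC c) lexx.
Qed.

End mix_error_bound.

Section mix_error_rate.
Context {R : realType}.

Definition kappa : R := 1 - expR (- (1 / 8)).

Lemma kappa_gt0 : 0 < kappa.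
Proof. by rewrite subr_gt0 expR_lt1 oppr_lt0. Qed.

(** In multiples of the rate, 108 is [72 + 4 + 32]: twice the 36 of the Fourier bound, the
    small-norm probability, and the Lipschitz window. The fraction comes from the normalization of
    [z]. *)
Definition mix_const : R := 108 + 4 * (1 + gauss1_var2 R) / kappa.

Lemma gauss1_var2_ge0 : 0 <= gauss1_var2 R.
Proof. by apply: Rintegral_ge0 => x _; rewrite sqr_ge0. Qed.

Lemma mix_const_ge0 : 0 <= mix_const.
Proof.
rewrite addr_ge0// divr_ge0 ?(ltW kappa_gt0)// mulr_ge0// addr_ge0//.
exact: gauss1_var2_ge0.
Qed.

Context (n : nat) d (T : measurableType d) (P : probability T R)
  (X : T -> n.-tuple R).
Hypothesis mX : measurable_fun setT X.
Variable M : R.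
Hypothesis HM : forall v : n.-tuple R,
  (\int[P]_w `|dotp (X w) v|%:E <= (M * enorm v)%:E)%E.
Hypothesis M0 : 0 <= M.
Hypothesis n1 : (1 < n)%N.

Let n0 : 0 < n%:R :> R. Proof. by rewrite ltr0n ltnW. Qed.

Let sq0 : 0 < Num.sqrt n%:R :> R. Proof. by rewrite sqrtr_gt0. Qed.

Let L0 : 1 / 2 <= ln n%:R :> R. Proof. exact: ln_ge_half. Qed.

Let p0 : 0 <= Num.sqrt (diag_prob P X). Proof. exact: sqrtr_ge0. Qed.

Let rate := moment_rate P X M.

Lemma diag_le_rate : Num.sqrt (diag_prob P X) <= 2 * rate.
Proof.
have h1 : 0 <= M * Num.sqrt (ln n%:R / n%:R) by rewrite mulr_ge0.
have h2 : 0 <= n%:R^-1 :> R by rewrite invr_ge0 ltW.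
have h3 := ler_wpM2l p0 L0; have h4 := p0.
rewrite /rate /moment_rate; lra.
Qed.

Lemma invn_le_rate : n%:R^-1 <= rate.
Proof.
have h1 : 0 <= M * Num.sqrt (ln n%:R / n%:R) by rewrite mulr_ge0.
have h3 := ler_wpM2l p0 L0; have h4 := p0.
rewrite /rate /moment_rate; lra.
Qed.

(** This divides [diag_moment_lb] by [sqrt n]. The collision probability is at most its own square
    root, since it is at most 1, and [1 / sqrt n <= 2 sqrt (ln n / n)] because [ln n >= 1 / 2]. *)
Lemma invsqrt_le_rate : kappa / Num.sqrt n%:R <= 4 * rate.
Proof.
have h1 : kappa / Num.sqrt n%:R <= (diag_prob P X + 2 * M) / Num.sqrt n%:R.
  by rewrite ler_wpM2r ?invr_ge0 ?(ltW sq0)//; exact: diag_moment_lb.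
apply: (le_trans h1); rewrite mulrDl.
have h2 : diag_prob P X / Num.sqrt n%:R <= Num.sqrt (diag_prob P X).
  apply: (@le_trans _ _ (diag_prob P X)).
    rewrite ler_piMr ?diag_prob_ge0// invf_le1// -[leLHS]sqrtr1 ler_wsqrtr//.
    by rewrite ler1n ltnW.
  rewrite -{1}(sqr_sqrtr (diag_prob_ge0 P X)) expr2 ler_piMr//.
  by rewrite -[leRHS]sqrtr1 ler_wsqrtr// diag_prob_le1.
have h3 : 2 * M / Num.sqrt n%:R <= 4 * (M * Num.sqrt (ln n%:R / n%:R)).
  have h : (Num.sqrt n%:R)^-1 <= 2 * Num.sqrt (ln n%:R / n%:R) :> R.
    rewrite -sqrtrV ?(ltW n0)//.
    rewrite -[X in X * _](@ger0_norm _ 2)// -sqrtr_sqr -sqrtrM// ler_wsqrtr//.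
    rewrite mulrA -[leLHS]mul1r ler_wpM2r ?invr_ge0 ?(ltW n0)//; have := L0; lra.
  have := ler_wpM2l M0 h; lra.
have h4 := ler_wpM2l p0 L0; have h6 := p0.
have h5 : 0 <= n%:R^-1 :> R by rewrite invr_ge0 ltW.
rewrite /rate /moment_rate; lra.
Qed.

Lemma integral_mix_error : (\int[gauss n]_z mix_error P X z <= (mix_const * rate)%:E)%E.
Proof.
have mfd := measurable_fourier_dist P mX.
have [iq _ _ _] := @gauss_sqnorm_var R n.
pose g (z : n.-tuple R) : R := `|enorm z ^+ 2 / n%:R - 1|.
have ig : (gauss n).-integrable setT (EFin \o g).
  have := integrable_norm (integrable_scale n%:R^-1 iq).
  apply: eq_integrable => // z _ /=; congr (`|_|%:E).
  by rewrite enorm_sqr mulrBr mulVf ?gt_eqF// mulrC.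
set c := 2 * small_prob P X + 32 / n%:R.
have c0 : 0 <= c by rewrite addr_ge0 ?mulr_ge0 ?small_prob_ge0// invr_ge0 ltW.
have i1 : (gauss n).-integrable setT (EFin \o (fun z => c + 2 * g z)).
  exact: (integrableD measurableT (prob_integrable_cst (gauss n) c) (integrable_scale 2 ig)).
rewrite /mix_error ge0_integralD//; last 4 first.
- by move=> z _; rewrite mule_ge0// fourier_dist_ge0.
- exact: measurable_funeM.
- by move=> z _; rewrite lee_fin addr_ge0 ?mulr_ge0.
- by case/integrableP : i1.
rewrite ge0_integralZl//; last by move=> z _; exact: fourier_dist_ge0.
rewrite (Rintegral_EFin i1) RintegralD//; last 2 first.
- exact: prob_integrable_cst.
- exact: integrable_scale.
rewrite Rintegral_cstT RintegralZl//.
apply: (@le_trans _ _ (2%:E * (36 * rate)%:E + (c + 2 * ((1 + gauss1_var2 R) / (2 * Num.sqrt n%:R)))%:E)%E).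
  apply: leeD; first by rewrite lee_pmul2l//; exact: integral_fourier_dist_le.
  rewrite lee_fin lerD2l ler_wpM2l//.
  exact: (gauss_sqnorm_dev n1).
rewrite -EFinM -EFinD lee_fin /mix_const /c.
have h1 := diag_le_rate; have h2 := invn_le_rate.
have h3 : small_prob P X <= Num.sqrt (diag_prob P X) by exact: small_prob_le.
have h4 : 2 * ((1 + gauss1_var2 R) / (2 * Num.sqrt n%:R)) <= 4 * (1 + gauss1_var2 R) / kappa * rate.
  have -> : 2 * ((1 + gauss1_var2 R) / (2 * Num.sqrt n%:R)) =
      ((1 + gauss1_var2 R) / kappa) * (kappa / Num.sqrt n%:R).
    by field; rewrite !gt_eqF ?kappa_gt0.
  have -> : 4 * (1 + gauss1_var2 R) / kappa * rate = ((1 + gauss1_var2 R) / kappa) * (4 * rate) by ring.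
  rewrite ler_wpM2l ?invsqrt_le_rate// divr_ge0 ?(ltW kappa_gt0)// addr_ge0//.
  exact: gauss1_var2_ge0.
rewrite mulrDl; lra.
Qed.

End mix_error_rate.

(** * Kolmogorov distances *)

Section kolmogorov.
Context {R : realType}.

Lemma kolmogorov_dist_ge0 (U V : R -> \bar R) : (0 <= kolmogorov_dist U V)%E.
Proof.
apply: (@le_trans _ _ `|U 0%R - V 0%R|%E); first exact: abse_ge0.
by apply: ereal_sup_ubound; exists 0.
Qed.

Context (n : nat) d (T : measurableType d) (P : probability T R)
  (X : T -> n.-tuple R).
Hypothesis mX : measurable_fun setT X.
Variable M : R.
Hypothesis HM : forall v : n.-tuple R,
  (\int[P]_w `|dotp (X w) v|%:E <= (M * enorm v)%:E)%E.
Hypothesis n1 : (0 < n)%N.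

Let F (z : n.-tuple R) (x : R) : \bar R := P [set w | dotp (X w) z <= x].

Let mF z : measurable_fun setT (fun w => dotp (X w) z).
Proof. exact: measurable_dotp2. Qed.

Let FE z x : F z x = (rcdf P (fun w => dotp (X w) z) x)%:E.
Proof. exact: rcdfE. Qed.

Let mrc x : measurable_fun setT (fun z => rcdf P (fun w => dotp (X w) z) x).
Proof.
under eq_fun do rewrite rcdf_indic//.
apply: (@measurable_Rintegral1 _ _ _ _ _ P (fun p : n.-tuple R * T => (dotp (X p.2) p.1 <= x)%R%:R)).
apply: measurable_natr_bool; apply: measurable_fun_ler => //; apply: measurable_dotp2 => //.
exact: (measurableT_comp mX measurable_snd).
Qed.

Lemma measurable_mix_error : measurable_fun setT (mix_error P X).
Proof.
apply: emeasurable_funD; first by apply: measurable_funeM; exact: measurable_fourier_dist.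
apply/measurable_EFinP; apply: measurable_funD => //; apply: measurable_funM => //.
apply: measurableT_comp => //; apply: measurable_funB => //; apply: measurable_funM => //.
by apply: measurable_funX; exact: measurable_enorm.
Qed.

Lemma typical_mix_error x :
  (`|(mix_cdf P X x)%:E - \int[uniform_sphere n]_z F z x| <= \int[gauss n]_z mix_error P X z)%E.
Proof.
pose f z := rcdf P (fun w => dotp (X w) z) x.
have i1 : (uniform_sphere n).-integrable setT (EFin \o f).
  apply: (@prob_bounded_integrable _ _ _ _ _ 1); first exact: mrc.
  by move=> z; have /andP[h1 h2] := rcdf_itv P (mF z) x; rewrite ger0_norm.
under eq_integral do rewrite FE.
rewrite (Rintegral_EFin i1) -(Rintegral_cstT (uniform_sphere n) (mix_cdf P X x)) -EFinB -RintegralB//; last first.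
  exact: prob_integrable_cst.
have i2 : (uniform_sphere n).-integrable setT (EFin \o (fun z => mix_cdf P X x - f z)).
  exact: (integrableB measurableT (prob_integrable_cst (uniform_sphere n) (mix_cdf P X x)) i1).
rewrite -[X in (`|X| <= _)%E](Rintegral_EFin i2).
apply: le_trans (le_abse_integral _ _ _) _ => //; first by case/integrableP : i2.
apply: uniform_sphere_integral_le => //.
- exact: measurable_mix_error.
- by move=> z; exact: mix_error_ge0.
move=> z z0; have := proj_mix_error mX HM n1 x z0.
by rewrite -/(F _ _) FE -EFinB /= distrC.
Qed.

(** The triangle inequality through the mixture holds at every [x] with the same error, so the
    supremum is bounded by it. Taking for [V] the typical or the normal distribution function serves
    both comparisons. *)
Lemma integral_kolmogorov_le (V : R -> \bar R) (c : \bar R) : (0 <= c)%E ->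
  (forall x, `|(mix_cdf P X x)%:E - V x| <= c)%E ->
  (\int[uniform_sphere n]_z kolmogorov_dist (F z) V <= \int[gauss n]_z mix_error P X z + c)%E.
Proof.
move=> c0 Vc.
have mm := measurable_mix_error.
have gc : (\int[gauss n]_z c = c)%E by rewrite integral_cst// [X in (_ * X)%E]probability_setT mule1.
rewrite -[X in (_ <= _ + X)%E]gc -ge0_integralD//; last by move=> z _; exact: mix_error_ge0.
apply: uniform_sphere_integral_le => //.
- by move=> z; exact: kolmogorov_dist_ge0.
- exact: emeasurable_funD.
- by move=> z; rewrite adde_ge0// mix_error_ge0.
move=> z z0; apply: ge_ereal_sup => _ [x _ <-].
rewrite -[F _ x](@subeK _ _ (mix_cdf P X x)%:E)// -(addeA (F _ x - _)%E).
apply: (le_trans (lee_abs_add _ _)); apply: leeD; last exact: Vc.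
exact: proj_mix_error.
Qed.

End kolmogorov.

(** * Moments and collision probabilities *)

Section collision.
Context {R : realType} (n : nat) d (T : measurableType d) (P : probability T R)
  (X : T -> n.-tuple R).
Hypothesis mX : measurable_fun setT X.
Hypothesis n1 : (0 < n)%N.

Let n0 : 0 < n%:R :> R. Proof. by rewrite ltr0n. Qed.

Let mnX : measurable_fun setT (fun w => enorm (X w)).
Proof. exact: (measurableT_comp measurable_enorm mX). Qed.

Variables m s : R.
Hypothesis Hm : (\int[(P \x P)%E]_w (dotp (X w.1) (X w.2) ^+ 2)%:E = (n%:R * m ^+ 2)%:E)%E.
Hypothesis Hs : (\int[P]_w `|enorm (X w) ^+ 2 - n%:R|%:E = (Num.sqrt n%:R * s)%:E)%E.

(* Near the diagonal, either [<x, y> >= n / 4] or both [|x|^2] and [|y|^2] are at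
   most [3 n / 4]. *)
Lemma near_diag_le (x y : n.-tuple R) : enorm (tsub x y) ^+ 2 <= n%:R / 4 ->
  n%:R ^+ 2 / 16 <= dotp x y ^+ 2 + `|enorm x ^+ 2 - n%:R| * `|enorm y ^+ 2 - n%:R|.
Proof.
rewrite !enorm_sqr dotp_tsub => h.
have hx := dotp_ge0 x; have hy := dotp_ge0 y.
have [h1|h1] := leP (n%:R / 4) (dotp x y).
  rewrite -[leLHS]addr0 lerD ?mulr_ge0//.
  rewrite (_ : n%:R ^+ 2 / 16 = (n%:R / 4) ^+ 2); last by field.
  by rewrite ler_pXn2r// ?nnegrE ?(le_trans _ h1) ?divr_ge0// ltW.
rewrite -[leLHS]add0r lerD ?sqr_ge0//.
rewrite (_ : n%:R ^+ 2 / 16 = (n%:R / 4) * (n%:R / 4)); last by field.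
by rewrite ler_pM ?divr_ge0 ?(ltW n0)// distrC ler_normr; apply/orP; left; lra.
Qed.

(** Markov's inequality applied to [near_diag_le]. By independence the product of the two deviations
    has mean [(sqrt n * s) ^+ 2], so a first absolute moment of the deviation suffices for a term of
    order [s^2 / n]. *)
Lemma diag_prob_le_moments : diag_prob P X <= 16 * (m ^+ 2 + s ^+ 2) / n%:R.
Proof.
have mdot : measurable_fun setT (fun w : T * T => dotp (X w.1) (X w.2)).
  by apply: measurable_dotp2; exact: (measurableT_comp mX).
have mdev : measurable_fun setT (fun w => `|enorm (X w) ^+ 2 - n%:R|).
  by apply: measurableT_comp => //; apply: measurable_funB => //; exact: measurable_funX.
have i1 : (P \x P)%E.-integrable setT (EFin \o (fun w => dotp (X w.1) (X w.2) ^+ 2)).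
  apply/integrableP; split; first by apply/measurable_EFinP; exact: measurable_funX.
  under eq_integral do rewrite /= ger0_norm ?sqr_ge0//.
  by rewrite Hm ltry.
have i2 : P.-integrable setT (EFin \o (fun w => `|enorm (X w) ^+ 2 - n%:R|)).
  apply/integrableP; split; first exact/measurable_EFinP.
  under eq_integral do rewrite /= normr_id.
  by rewrite Hs ltry.
have E1 : \int[(P \x P)%E]_w (dotp (X w.1) (X w.2) ^+ 2) = n%:R * m ^+ 2.
  by apply: EFin_inj; rewrite -Rintegral_EFin.
have E2 : \int[P]_w `|enorm (X w) ^+ 2 - n%:R| = Num.sqrt n%:R * s.
  by apply: EFin_inj; rewrite -Rintegral_EFin.
have i3 := integrable_prod_mul i2 i2.
have E3 := Rintegral_prod_mul i2 i2; rewrite E2 in E3.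
have id1 : (P \x P)%E.-integrable setT (EFin \o (\1_(near_diag X))).
  apply: (@prob_bounded_integrable _ _ _ _ _ 1).
    by apply: measurable_indic; exact: measurable_near_diag.
  by move=> w; rewrite indicE; case: (w \in _); rewrite ?normr1 ?normr0.
have -> : diag_prob P X = \int[(P \x P)%E]_w (\1_(near_diag X) w).
  by rewrite /Rintegral integral_indic ?setIT//; exact: measurable_near_diag.
have -> : 16 * (m ^+ 2 + s ^+ 2) / n%:R = \int[(P \x P)%E]_w (16 / n%:R ^+ 2 *
    (dotp (X w.1) (X w.2) ^+ 2 + `|enorm (X w.1) ^+ 2 - n%:R| * `|enorm (X w.2) ^+ 2 - n%:R|)).
  rewrite RintegralZl//; last exact: (integrableD measurableT i1 i3).
  rewrite RintegralD// E1 E3 mulrACA -expr2 sqr_sqrtr ?(ltW n0)//.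
  by field; rewrite gt_eqF.
apply: le_Rintegral => //.
  by apply: integrable_scale; exact: (integrableD measurableT i1 i3).
move=> w _; rewrite indicE; have [wA|wA] := boolP (w \in near_diag X); last first.
  by rewrite mulr_ge0 ?addr_ge0 ?sqr_ge0 ?mulr_ge0// ?divr_ge0 ?sqr_ge0.
have := near_diag_le (set_mem wA); rewrite mulr1n => h.
rewrite mulrAC ler_pdivlMr ?exprn_gt0// mul1r; lra.
Qed.

End collision.

Section independence.
Context {R : realType} (n : nat) d (T : measurableType d) (P : probability T R).
Variables X Y : {RV P >-> n.-tuple R}.
Hypothesis XY : independent_copy X Y.

Let S : set (n.-tuple R * n.-tuple R) := [set p | enorm (tsub p.1 p.2) ^+ 2 <= n%:R / 4].

(** A given independent copy and the coordinates on [P \x P] have the same joint law: both image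
    measures agree with the product of the marginal laws on rectangles, which determines them. *)
Lemma diag_prob_copy : P [set w | enorm (tsub (X w) (Y w)) ^+ 2 <= n%:R / 4] = (diag_prob P X)%:E.
Proof.
have [YX ind] := XY.
have mX : measurable_fun setT X by [].
have mY : measurable_fun setT Y by [].
have mXY : measurable_fun setT (fun w => (X w, Y w)) by exact: measurable_fun_pair.
have mXX : measurable_fun setT (fun w : T * T => (X w.1, X w.2)).
  by apply: measurable_fun_pair; [exact: (measurableT_comp mX measurable_fst)|exact: (measurableT_comp mX measurable_snd)].
have mS : measurable S.
  exact: (measurable_near_diag (X := id)).
have mu := @product_measure_unique _ _ _ _ _ (distribution P X) (distribution P X).
have H1 : (P (S \o (fun w => (X w, Y w))) = (distribution P X \x distribution P X) S)%E.
  have H := mu (pushforward P (fun w => (X w, Y w))) _ _ mS.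
  rewrite (H mXY)// => A B mA mB.
  transitivity (P (X @^-1` A) * distribution P Y B)%E; first exact: ind.
  by rewrite YX.
have H2 : ((P \x P) (S \o (fun w => (X w.1, X w.2))) = (distribution P X \x distribution P X) S)%E.
  have H := mu (pushforward (P \x P)%E (fun w : T * T => (X w.1, X w.2))) _ _ mS.
  rewrite (H mXX)// => A B mA mB.
  have mXA : measurable (X @^-1` A) by rewrite -[X in measurable X]setTI; exact: mX.
  have mXB : measurable (X @^-1` B) by rewrite -[X in measurable X]setTI; exact: mX.
  exact: (product_measure1E P P mXA mXB).
by rewrite -diag_probE// /near_diag [LHS]H1 [RHS]H2.
Qed.

End independence.

Section rate.
Context {R : realType} (n : nat) d (T : measurableType d) (P : probability T R)
  (X : T -> n.-tuple R).
Hypothesis mX : measurable_fun setT X.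
Variable M : R.
Hypothesis HM : forall v : n.-tuple R,
  (\int[P]_w `|dotp (X w) v|%:E <= (M * enorm v)%:E)%E.
Hypothesis M0 : 0 <= M.
Hypothesis n1 : (1 < n)%N.
Variables m s : R.
Hypothesis Hm : (\int[(P \x P)%E]_w (dotp (X w.1) (X w.2) ^+ 2)%:E = (n%:R * m ^+ 2)%:E)%E.
Hypothesis Hs : (\int[P]_w `|enorm (X w) ^+ 2 - n%:R|%:E = (Num.sqrt n%:R * s)%:E)%E.
Hypotheses (m0 : 0 <= m) (s0 : 0 <= s).

Let n0 : 0 < n%:R :> R. Proof. by rewrite ltr0n ltnW. Qed.

Let sq0 : 0 < Num.sqrt n%:R :> R. Proof. by rewrite sqrtr_gt0. Qed.

Lemma sqrt_diag_prob_le : Num.sqrt (diag_prob P X) <= 4 * (m + s) / Num.sqrt n%:R.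
Proof.
rewrite -[leRHS]ger0_norm; last by rewrite divr_ge0 ?mulr_ge0 ?addr_ge0// ltW.
rewrite -sqrtr_sqr ler_wsqrtr//; apply: le_trans (diag_prob_le_moments mX (ltnW n1) Hm Hs) _.
rewrite !exprMn exprVn sqr_sqrtr ?(ltW n0)// ler_wpM2r ?invr_ge0 ?(ltW n0)//.
have := mulr_ge0 m0 s0; nra.
Qed.

(** The 6 is [2 + 4], from the first two terms of the rate. To bound [1 / n] by the moments one
    needs [M + m + s] bounded away from 0, which [diag_moment_lb] supplies through [kappa]. *)
Lemma moment_rate_le : moment_rate P X M <=
  (6 + 12 / kappa) * ((M + m + s) * (ln n%:R / Num.sqrt n%:R)).
Proof.
set W := (M + m + s) * (ln n%:R / Num.sqrt n%:R).
have L0 : 1 / 2 <= ln n%:R :> R by exact: ln_ge_half.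
have k0 : 0 < kappa :> R by exact: kappa_gt0.
have [M0' m0' s0'] := And3 M0 m0 s0.
set r : R := (Num.sqrt n%:R)^-1.
have r0 : 0 < r by rewrite invr_gt0.
have r1 : r <= 1.
  by rewrite invf_le1// -[leLHS]sqrtr1 ler_wsqrtr// ler1n ltnW.
have rE : r ^+ 2 = n%:R^-1 by rewrite exprVn sqr_sqrtr// ltW.
have Lr : r / 2 <= ln n%:R * r by rewrite mulrC ler_wpM2r ?(ltW r0)//; lra.
have MW : M * (ln n%:R * r) <= W.
  by rewrite /W ler_wpM2r ?mulr_ge0 ?(ltW r0)//; lra.
have msW : (m + s) * (ln n%:R * r) <= W.
  by rewrite /W ler_wpM2r ?mulr_ge0 ?(ltW r0)//; lra.
have h1 : M * Num.sqrt (ln n%:R / n%:R) <= 2 * W.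
  have h : Num.sqrt (ln n%:R / n%:R) <= 2 * (ln n%:R * r) :> R.
    rewrite -[leRHS]ger0_norm; last by rewrite !mulr_ge0 ?(ltW r0)//; lra.
    rewrite -sqrtr_sqr ler_wsqrtr// !exprMn rE mulrA ler_wpM2r ?invr_ge0 ?(ltW n0)//.
    nra.
  have := ler_wpM2l M0 h; lra.
have h2 : Num.sqrt (diag_prob P X) * ln n%:R <= 4 * W.
  have l0 : 0 <= ln n%:R :> R by lra.
  have := ler_wpM2r l0 sqrt_diag_prob_le; rewrite -/r; lra.
(* Here [kappa <= 4 * (m + s) + 2 * M], while [1 / n <= r <= 2 * (ln n * r)]; the product is at most
   [8 * W + 4 * W]. *)
have h3 : kappa * n%:R^-1 <= 12 * W.
  have hp : diag_prob P X <= 4 * (m + s) * r.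
    apply: le_trans sqrt_diag_prob_le.
    rewrite -{1}(sqr_sqrtr (diag_prob_ge0 P X)) expr2 ler_piMr ?sqrtr_ge0//.
    by rewrite -[leRHS]sqrtr1 ler_wsqrtr// diag_prob_le1.
  have hk : kappa <= diag_prob P X + 2 * M by exact: diag_moment_lb.
  have hk2 : kappa <= 4 * (m + s) + 2 * M.
    have : 4 * (m + s) * r <= 4 * (m + s) by rewrite ler_piMr// mulr_ge0// addr_ge0.
    lra.
  apply: (@le_trans _ _ ((4 * (m + s) + 2 * M) * (2 * (ln n%:R * r)))); last lra.
  apply: ler_pM => //; [exact: ltW|].
  rewrite -rE expr2; apply: (@le_trans _ _ r); last lra.
  by rewrite ler_piMr// ltW.
have h4 : n%:R^-1 <= 12 / kappa * W.
  by rewrite mulrAC ler_pdivlMr// mulrC.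
rewrite /moment_rate mulrDl; lra.
Qed.

End rate.

(** * The moment parameters as extended reals *)

Section maxmoment.
Context {R : realType} (n : nat) d (T : measurableType d) (P : probability T R)
  (X : {RV P >-> n.-tuple R}).
Hypothesis n1 : (0 < n)%N.

Lemma enorm_basis_tuple (i : 'I_n) : enorm (basis_tuple (R := R) i) = 1.
Proof. by rewrite /enorm dotp_basis tnth_mktuple eqxx sqrtr1. Qed.

Lemma maxmoment_ge0 (p : R) : (0 <= maxmoment X p)%E.
Proof.
apply: (@le_trans _ _ ('N[P]_(p%:E)[(fun w => (dotp (X w) (basis_tuple (Ordinal n1)))%:E)])%E).
  exact: Lnorm_ge0.
by apply: ereal_sup_ubound; exists (basis_tuple (Ordinal n1)) => //; exact: enorm_basis_tuple.
Qed.

Lemma enorm_normalize (v : n.-tuple R) : 0 < enorm v -> enorm (normalize v) = 1.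
Proof.
move=> v0; rewrite /enorm dotp_normalize dotpC dotp_normalize -enorm_sqr.
by rewrite expr2 mulfK ?gt_eqF// divff ?gt_eqF// sqrtr1.
Qed.

Lemma maxmoment1_le (M : R) (v : n.-tuple R) : maxmoment X 1 = M%:E ->
  (\int[P]_w `|dotp (X w) v|%:E <= (M * enorm v)%:E)%E.
Proof.
move=> MX; have := enorm_ge0 v; rewrite le_eqVlt => /predU1P[v0|v0].
  have vv : v = nseq_tuple n 0.
    apply: eq_from_tnth => i; rewrite tnth_nseq; apply/eqP; rewrite -normr_le0.
    rewrite -sqrtr_sqr [leRHS]v0 ler_wsqrtr// /dotp (bigD1 i)//= -expr2 lerDl.
    by rewrite sumr_ge0// => j _; rewrite -expr2 sqr_ge0.
  rewrite -v0 mulr0 integral0_eq// => w _; congr EFin; apply/eqP.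
  rewrite normr_eq0 vv /dotp big1// => i _; by rewrite tnth_nseq mulr0.
have mXv : measurable_fun setT (fun w => `|dotp (X w) (normalize v)|).
  by apply: measurableT_comp => //; exact: measurable_dotp2.
rewrite [leLHS](_ : _ = (enorm v)%:E * \int[P]_w `|dotp (X w) (normalize v)|%:E)%E; last first.
  rewrite -ge0_integralZl//; last 2 first.
  - exact/measurable_EFinP.
  - by rewrite lee_fin ltW.
  apply: eq_integral => w _; rewrite dotp_normalize -EFinM normrM normfV (gtr0_norm v0).
  by rewrite mulrCA divff ?mulr1// gt_eqF.
rewrite mulrC EFinM lee_pmul2l// -MX; apply: ereal_sup_ubound.
exists (normalize v); first exact: enorm_normalize.
by rewrite Lnorm1.
Qed.

End maxmoment.

Section moments.
Context {R : realType} (n : nat) d (T : measurableType d) (P : probability T R)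
  (X : {RV P >-> n.-tuple R}).
Hypothesis n1 : (1 < n)%N.

Let n0 : 0 < n%:R :> R. Proof. by rewrite ltr0n ltnW. Qed.

Let sq0 : 0 < Num.sqrt n%:R :> R. Proof. by rewrite sqrtr_gt0. Qed.

(** Here and in the next two lemmas: an infinite parameter makes the right-hand side of the theorem
    infinite, and otherwise the real-valued estimates apply. *)
Lemma maxmoment1_case : maxmoment X 1 = +oo%E \/ exists2 M, 0 <= M & maxmoment X 1 = M%:E.
Proof.
have := maxmoment_ge0 X (ltnW n1) 1; case: (maxmoment X 1) => [M|_|//]; last by left.
by rewrite lee_fin => M0; right; exists M.
Qed.

Lemma m2_case : m2 X = +oo%E \/ exists2 m, 0 <= m & m2 X = m%:E /\
  (\int[(P \x P)%E]_w (dotp (X w.1) (X w.2) ^+ 2)%:E = (n%:R * m ^+ 2)%:E)%E.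
Proof.
rewrite /m2; set I := (\int[_]_w _)%E.
have : (0 <= I)%E by apply: integral_ge0 => w _; rewrite lee_fin sqr_ge0.
case: I => [i|_|//] => [i0|].
  right; exists ((Num.sqrt n%:R)^-1 * Num.sqrt i); first by rewrite mulr_ge0 ?sqrtr_ge0// invr_ge0 ltW.
  split => //; congr EFin.
  by rewrite exprMn exprVn !sqr_sqrtr ?(ltW n0)// mulVKf// gt_eqF.
by left; rewrite mulry gtr0_sg ?mul1e// invr_gt0.
Qed.

Lemma sigma2_case : sigma2 X = +oo%E \/ exists2 s, 0 <= s & sigma2 X = s%:E /\
  (\int[P]_w `|enorm (X w) ^+ 2 - n%:R|%:E = (Num.sqrt n%:R * s)%:E)%E.
Proof.
rewrite /sigma2 unlock; set I := (\int[P]_w _)%E.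
have : (0 <= I)%E by apply: integral_ge0 => w _; rewrite lee_fin.
case: I => [i|_|//] => [i0|].
  right; exists ((Num.sqrt n%:R)^-1 * i); first by rewrite mulr_ge0// invr_ge0 ltW.
  by split => //; congr EFin; rewrite mulVKf// gt_eqF.
by left; rewrite mulry gtr0_sg ?mul1e// invr_gt0.
Qed.

Variable M : R.
Hypothesis M0 : 0 <= M.
Hypothesis MX : maxmoment X 1 = M%:E.

Let mX : measurable_fun setT X. Proof. by []. Qed.

Let HM v := maxmoment1_le v MX.

(** The factor 2 counts the averaged error twice: once for the projections against the mixture, once
    for the typical distribution function against it. *)
Lemma kolmogorov_typical_le :
  (\int[uniform_sphere n]_theta kolmogorov_dist (proj_cdf X theta) (typical_cdf X) <=
   (2 * mix_const * moment_rate P X M)%:E)%E.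
Proof.
have := integral_mix_error mX HM M0 n1; set A := mix_const * _ => hA.
have A0 : (0 <= A%:E)%E by apply: le_trans hA; apply: integral_ge0 => z _; exact: mix_error_ge0.
have Vc x : (`|(mix_cdf P X x)%:E - typical_cdf X x| <= A%:E)%E.
  by apply: le_trans hA; exact: (typical_mix_error mX HM (ltnW n1) x).
apply: le_trans (integral_kolmogorov_le mX HM (ltnW n1) A0 Vc) _.
rewrite -mulrA -/A mulr_natl mulr2n EFinD; exact: leeD.
Qed.

Lemma kolmogorov_normal_le (s : R) : 0 <= s ->
  (\int[P]_w `|enorm (X w) ^+ 2 - n%:R|%:E = (Num.sqrt n%:R * s)%:E)%E ->
  (\int[uniform_sphere n]_theta kolmogorov_dist (proj_cdf X theta) std_normal_cdf <=
   (mix_const * moment_rate P X M + 2 * (s / Num.sqrt n%:R))%:E)%E.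
Proof.
move=> s0 Hs.
have hs : (\int[P]_w `|enorm (X w) ^+ 2 / n%:R - 1|%:E = (s / Num.sqrt n%:R)%:E)%E.
  have -> : s / Num.sqrt n%:R = n%:R^-1 * (Num.sqrt n%:R * s).
    rewrite -[in n%:R^-1](sqr_sqrtr (ltW n0)); field; rewrite gt_eqF//.
  rewrite EFinM -Hs -ge0_integralZl//.
  - apply: eq_integral => w _; rewrite -EFinM; congr EFin.
    have -> : enorm (X w) ^+ 2 / n%:R - 1 = n%:R^-1 * (enorm (X w) ^+ 2 - n%:R).
      by field; rewrite gt_eqF.
    by rewrite normrM ger0_norm// invr_ge0 ltW.
  - apply/measurable_EFinP; apply: measurableT_comp => //; apply: measurable_funB => //.
    by apply: measurable_funX; exact: (measurableT_comp measurable_enorm mX).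
have c0 : (0 <= (2 * (s / Num.sqrt n%:R))%:E)%E by rewrite lee_fin mulr_ge0// divr_ge0// ltW.
have Vc x : (`|(mix_cdf P X x)%:E - std_normal_cdf x| <= (2 * (s / Num.sqrt n%:R))%:E)%E.
  by rewrite std_normal_cdfE EFinM -hs; exact: (mix_cdf_normal P mX (ltnW n1) x).
apply: le_trans (integral_kolmogorov_le mX HM (ltnW n1) c0 Vc) _.
by rewrite EFinD leeD2r//; exact: integral_mix_error.
Qed.

End moments.

(** * The three inequalities with one constant *)

Local Open Scope ereal_scope.

Theorem theorem6p3 (R : realType) :
  exists c : R, (0 < c)%R /\
  forall n : nat, (2 <= n)%N ->
  forall (d : measure_display) (T : measurableType d) (P : probability T R)
         (X : {RV P >-> n.-tuple R}),
  [/\ (forall Y : {RV P >-> n.-tuple R}, independent_copy X Y ->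
         maxmoment X 1 < +oo ->
         c%:E * (\int[uniform_sphere n]_theta
                  kolmogorov_dist (proj_cdf X theta) (typical_cdf X)) <=
         maxmoment X 1 * (Num.sqrt (ln n%:R / n%:R))%:E
         + sqrte (P [set w | (enorm (tsub (X w) (Y w)) ^+ 2 <= n%:R / 4)%R])
           * (ln n%:R)%:E
         + (n%:R^-1)%:E),
      (maxmoment X 2 < +oo -> 'E_P[(fun w => enorm (X w) ^+ 2)%R] = n%:R%:E ->
         c%:E * (\int[uniform_sphere n]_theta
                  kolmogorov_dist (proj_cdf X theta) (typical_cdf X)) <=
         (maxmoment X 1 + m2 X + sigma2 X) * (ln n%:R / Num.sqrt n%:R)%:E)
    & (maxmoment X 2 < +oo -> 'E_P[(fun w => enorm (X w) ^+ 2)%R] = n%:R%:E ->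
         c%:E * (\int[uniform_sphere n]_theta
                  kolmogorov_dist (proj_cdf X theta) std_normal_cdf) <=
         (maxmoment X 1 + m2 X + sigma2 X) * (ln n%:R / Num.sqrt n%:R)%:E)].
Proof.
set C : R := mix_const; set K : R := (6 + 12 / kappa)%R.
have C0 : (0 <= C)%R by exact: mix_const_ge0.
have K6 : (6 <= K)%R by rewrite lerDl divr_ge0// ltW// kappa_gt0.
have k0 : (0 < 2 * C * K + 4)%R.
  by rewrite ltr_wpDl// !mulr_ge0// (le_trans _ K6).
(* The summand [2 * C * K] covers the comparisons through the mixture; 4 covers the extra
   [2 * (s / sqrt n)] between the mixture and the normal law. *)
exists (2 * C * K + 4)^-1%R; split; first by rewrite invr_gt0.
move=> n n1 d T P X.
have n0 : (0 < n%:R :> R)%R by rewrite ltr0n ltnW.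
have sq0 : (0 < Num.sqrt n%:R :> R)%R by rewrite sqrtr_gt0.
have L0 : (1 / 2 <= ln n%:R :> R)%R by exact: ln_ge_half.
have l0 : (0 < ln n%:R :> R)%R by apply: lt_le_trans L0; rewrite divr_gt0.
have mX : measurable_fun setT X by [].
have red (I : \bar R) (W : R) : I <= ((2 * C * K + 4) * W)%:E -> ((2 * C * K + 4)^-1)%:E * I <= W%:E.
  by move=> h; rewrite lee_pdivrMl// -EFinM.
pose l : R := (ln n%:R / Num.sqrt n%:R)%R.
have l1 : (0 < l)%R by rewrite divr_gt0.
(* Reduction of the last two inequalities to real parameters: if one of them is [+oo], so is the
   right-hand side, as [l] is positive and no parameter is [-oo]. *)
have red2 (I : \bar R) : (forall M m s : R, (0 <= M)%R -> (0 <= m)%R -> (0 <= s)%R ->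
    maxmoment X 1 = M%:E ->
    \int[P \x P]_w (dotp (X w.1) (X w.2) ^+ 2)%:E = (n%:R * m ^+ 2)%:E ->
    \int[P]_w `|enorm (X w) ^+ 2 - n%:R|%:E = (Num.sqrt n%:R * s)%:E ->
    I <= ((2 * C * K + 4) * ((M + m + s) * l))%:E) ->
    ((2 * C * K + 4)^-1)%:E * I <= (maxmoment X 1 + m2 X + sigma2 X) * l%:E.
  move=> h.
  have top : ((2 * C * K + 4)^-1)%:E * I <= +oo * l%:E.
    by rewrite mulyr gtr0_sg// mul1e leey.
  have [->|[M M0 EM]] := maxmoment1_case X n1.
    have [->|[m m0 [-> _]]] := m2_case X n1; have [->|[s s0 [-> _]]] := sigma2_case X n1;
      by rewrite ?addye.
  have [->|[m m0 [Em Hm]]] := m2_case X n1.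
    by have [->|[s s0 [-> _]]] := sigma2_case X n1; rewrite EM ?addey ?addye.
  have [->|[s s0 [Es Hs]]] := sigma2_case X n1.
    by rewrite EM Em addey.
  by rewrite EM Em Es -!EFinD -EFinM; apply: red; exact: (h M m s).
split.
- move=> Y XY _.
  have [->|[M M0 EM]] := maxmoment1_case X n1.
    rewrite mulyr gtr0_sg ?sqrtr_gt0 ?divr_gt0// mul1e !addye ?leey//.
    by rewrite diag_prob_copy//= -EFinM.
  rewrite (diag_prob_copy XY) EM /= -!EFinM -!EFinD; apply: red.
  apply: le_trans (kolmogorov_typical_le n1 M0 EM) _.
  rewrite lee_fin -/(moment_rate P X M).
  have r0 : (0 <= moment_rate P X M)%R.
    by rewrite !addr_ge0 ?mulr_ge0 ?invr_ge0 ?sqrtr_ge0 ?(ltW l0)// ltW.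
  rewrite ler_wpM2r//.
  have := ler_wpM2l C0 K6; rewrite -/C; lra.
- move=> _ _; apply: red2 => M m s M0 m0 s0 EM Hm Hs.
  apply: le_trans (kolmogorov_typical_le n1 M0 EM) _.
  have := moment_rate_le mX (fun v => maxmoment1_le v EM) M0 n1 Hm Hs m0 s0.
  rewrite -/l -/C -/K lee_fin; set W := ((M + m + s) * l)%R => h.
  have W0 : (0 <= W)%R by rewrite mulr_ge0 ?addr_ge0// ltW.
  have C20 : (0 <= 2 * C)%R by rewrite mulr_ge0.
  have := ler_wpM2l C20 h; lra.
- move=> _ _; apply: red2 => M m s M0 m0 s0 EM Hm Hs.
  apply: le_trans (kolmogorov_normal_le n1 M0 EM s0 Hs) _.
  have := moment_rate_le mX (fun v => maxmoment1_le v EM) M0 n1 Hm Hs m0 s0.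
  rewrite -/l -/C -/K lee_fin; set W := ((M + m + s) * l)%R => h.
  have W0 : (0 <= W)%R by rewrite mulr_ge0 ?addr_ge0// ltW.
  have h1 := ler_wpM2l C0 h.
  (* The logarithm is inserted by means of [1 <= 2 * ln n]. *)
  have h2 : (s / Num.sqrt n%:R <= 2 * W)%R.
    apply: (@le_trans _ _ (2 * (s * l))%R).
      rewrite (_ : 2 * (s * l) = s * (2 * ln n%:R) / Num.sqrt n%:R)%R; last by rewrite /l; ring.
      by rewrite ler_wpM2r ?invr_ge0 ?(ltW sq0)// ler_peMr//; lra.
    by rewrite ler_pM2l// ler_pM2r//; lra.
  have : (0 <= C * (K * W))%R by apply: mulr_ge0 => //; apply: mulr_ge0 => //; apply: le_trans K6.
  lra.
Qed.
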